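(* There exist analytic maps $\varphi_t\colon\mathbb{D}\to\mathbb{D}$, $0\le t\le 1$, with the following properties. Let $X$ be any one of the spaces $\mathcal{M}$, $L^p=L^p(\mathbb{T},m)$ with $1\le p<\infty$, or $\mathcal{H}^p$ with $1\le p<\infty$. Then $C_{\varphi_0}$ is compact on $X$, $C_{\varphi_1}$ is not compact on $X$, and $t\mapsto C_{\varphi_t}$ is continuous from $[0,1]$ into the set of bounded operators on $X$ equipped with the operator norm. In particular, taking $X=\mathcal{H}^2$, the connected component of the set of all composition operators on $\mathcal{H}^2$ (with the operator-norm metric) that contains the compact composition operators also contains a non-compact composition operator.
   Context: $\mathbb{D}$ is the open unit disc, $\mathbb{T}=\partial\mathbb{D}$, and $m$ is normalized Lebesgue measure on $\mathbb{T}$. $\mathcal{M}$ is the Banach space of complex Borel measures on $\mathbb{T}$ with the total variation norm. For an analytic $\varphi\colon\mathbb{D}\to\mathbb{D}$, the composition operator $C_\varphi$ on $\mathcal{M}$ is defined as follows: for $\mu\in\mathcal{M}$, let $u(z)=\int_{\mathbb{T}}P_z\,d\mu$ with $P_z(\zeta)=(1-|z|^2)/|\zeta-z|^2$; then $u\circ\varphi$ is the Poisson integral of a unique $\nu\in\mathcal{M}$, and $C_\varphi\mu:=\nu$. This operator is bounded on $\mathcal{M}$, restricts to a bounded operator on each $L^p(\mathbb{T},m)$, and on the Hardy space $\mathcal{H}^p$ (identified with the subspace of $L^p$ of boundary values) it agrees with $f\mapsto f\circ\varphi$. *)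

(* Defs.v *)
From HB Require Import structures.
From mathcomp Require Import all_boot all_order all_algebra.
From mathcomp Require Import all_classical all_reals all_analysis.
From mathcomp Require Import complex.
From Stdlib Require Import ClassicalEpsilon.

Set Implicit Arguments.
Unset Strict Implicit.
Unset Printing Implicit Defensive.

Import Order.TTheory GRing.Theory Num.Theory.
Import numFieldNormedType.Exports.

Local Open Scope classical_set_scope.
Local Open Scope ring_scope.

(* The circle T is parametrized by theta in [0,1) via
   zeta theta = exp(2 pi i theta); normalized Lebesgue measure m on T
   corresponds to Lebesgue measure on [0,1).                           *)

Definition Icirc (R : realType) : set R := `[0%R, 1%R[%classic.
Arguments Icirc R : clear implicits.

Definition csq (R : realType) (z : R[i]) : R :=
  complex.Re z ^+ 2 + complex.Im z ^+ 2.

Definition cabs (R : realType) (z : R[i]) : R := Num.sqrt (csq z).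

Definition inD (R : realType) (z : R[i]) : Prop := cabs z < 1.

Definition zeta (R : realType) (theta : R) : R[i] :=
  Complex (cos (2 * pi * theta)) (sin (2 * pi * theta)).

Definition poisson (R : realType) (z : R[i]) (theta : R) : R :=
  (1 - csq z) / csq (zeta theta - z).

Definition analytic_self_map (R : realType) (phi : R[i] -> R[i]) : Prop :=
  (forall z, inD z -> inD (phi z)) /\
  (forall z, inD z -> exists l : R[i], forall e : R, 0 < e ->
      exists d : R, 0 < d /\ forall h : R[i], h != 0 -> cabs h < d ->
        cabs ((phi (z + h) - phi z) / h - l) < e).

(* Complex Borel measures on T.  A complex measure is encoded as its set
   function nu : set R -> R[i] on (Borel) subsets of R, living on [0,1)
   (nu A = nu (A `&` [0,1))) and equal to 0 on non-measurable sets.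
   Every complex measure is (mu1 - mu2) + i (mu3 - mu4) with mu_j finite
   positive measures; this is how we describe the class.              *)

Record cmrep (R : realType) := CMRep {
  cm1 : {finite_measure set R -> \bar R};
  cm2 : {finite_measure set R -> \bar R};
  cm3 : {finite_measure set R -> \bar R};
  cm4 : {finite_measure set R -> \bar R} }.

Definition cm_set (R : realType) (r : cmrep R) (A : set R) : R[i] :=
  if `[< measurable A >] then
    Complex (fine (cm1 r (A `&` Icirc R)) - fine (cm2 r (A `&` Icirc R)))
            (fine (cm3 r (A `&` Icirc R)) - fine (cm4 r (A `&` Icirc R)))
  else 0.

Definition is_cmeasure (R : realType) (nu : set R -> R[i]) : Prop :=
  exists r : cmrep R, nu = cm_set r.

Definition cm_int (R : realType) (r : cmrep R) (g : R -> R) : R[i] :=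
  Complex
  (fine (\int[cm1 r]_(x in Icirc R) (g x)%:E)%E
   - fine (\int[cm2 r]_(x in Icirc R) (g x)%:E)%E)
  (fine (\int[cm3 r]_(x in Icirc R) (g x)%:E)%E
   - fine (\int[cm4 r]_(x in Icirc R) (g x)%:E)%E).

(* Poisson integral u(z) = int_T P_z dnu  (independent of the chosen
   representation of nu) *)
Definition poisson_int (R : realType) (nu : set R -> R[i]) (z : R[i]) : R[i] :=
  epsilon (inhabits 0)
    (fun v => exists r : cmrep R, nu = cm_set r /\ v = cm_int r (poisson z)).

(* The composition operator: C_phi nu is the (unique) complex measure whose
   Poisson integral is (Poisson integral of nu) o phi. *)
Definition Cop (R : realType) (phi : R[i] -> R[i]) (nu : set R -> R[i])
  : set R -> R[i] :=
  epsilon (inhabits (fun _ => 0))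
    (fun nu' => is_cmeasure nu' /\
       forall z, inD z -> poisson_int nu' z = poisson_int nu (phi z)).

Definition cm_sub (R : realType) (nu1 nu2 : set R -> R[i]) : set R -> R[i] :=
  fun A => nu1 A - nu2 A.

Definition tv_norm (R : realType) (nu : set R -> R[i]) : \bar R :=
  ereal_sup [set x | exists (n : nat) (E : 'I_n -> set R),
     (forall i, measurable (E i)) /\
     (forall i j, i != j -> E i `&` E j = set0) /\
     (\big[setU/set0]_(i < n) E i) = Icirc R /\
     x = (\sum_(i < n) cabs (nu (E i)))%:E].

(* L^p(T, m), identified with the measures f dm                        *)

Definition leb (R : realType) := (@lebesgue_measure R).
Arguments leb R : clear implicits.

Definition cleb_int (R : realType) (D : set R) (f : R -> R[i]) : R[i] :=
  Complex (fine (\int[leb R]_(x in D) (complex.Re (f x))%:E)%E)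
          (fine (\int[leb R]_(x in D) (complex.Im (f x))%:E)%E).

Definition cintegrable (R : realType) (f : R -> R[i]) : Prop :=
  (leb R).-integrable (Icirc R) (fun x => (complex.Re (f x))%:E) /\
  (leb R).-integrable (Icirc R) (fun x => (complex.Im (f x))%:E).

Definition density (R : realType) (f : R -> R[i]) (A : set R) : R[i] :=
  if `[< measurable A >] then cleb_int (A `&` Icirc R) f else 0.

Definition lp_norm_fun (R : realType) (p : R) (f : R -> R[i]) : \bar R :=
  ((\int[leb R]_(x in Icirc R) ((cabs (f x)) `^ p)%:E) `^ p^-1)%E.

(* L^p norm of a measure nu (+oo if nu is not of the form f dm, f in L^p) *)
Definition lp_norm (R : realType) (p : R) (nu : set R -> R[i]) : \bar R :=
  ereal_inf [set x | exists f : R -> R[i],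
     cintegrable f /\ nu = density f /\ x = lp_norm_fun p f].

Definition in_Lp (R : realType) (p : R) (nu : set R -> R[i]) : Prop :=
  (lp_norm p nu < +oo)%E.

(* H^p: elements f dm of L^p whose negative Fourier coefficients
   hat f(-n) = int_T f zeta^n dm vanish for n >= 1. *)
Definition in_Hp (R : realType) (p : R) (nu : set R -> R[i]) : Prop :=
  exists f : R -> R[i], cintegrable f /\ nu = density f /\
    (lp_norm_fun p f < +oo)%E /\
    forall n : nat, (0 < n)%N ->
      cleb_int (Icirc R) (fun theta => f theta * zeta theta ^+ n) = 0.

Record bspace (R : realType) := BSpace {
  bs_mem : (set R -> R[i]) -> Prop;
  bs_norm : (set R -> R[i]) -> \bar R }.

Definition Mspace (R : realType) : bspace R :=
  @BSpace R (@is_cmeasure R) (@tv_norm R).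
Arguments Mspace R : clear implicits.
Definition Lspace (R : realType) (p : R) : bspace R :=
  @BSpace R (in_Lp p) (lp_norm p).
Definition Hspace (R : realType) (p : R) : bspace R :=
  @BSpace R (in_Hp p) (lp_norm p).

Definition admissible_space (R : realType) (X : bspace R) : Prop :=
  X = Mspace R \/
  exists p : R, 1 <= p /\ (X = Lspace p \/ X = Hspace p).

Notation cmop R := ((set R -> R[i]) -> (set R -> R[i])).

Definition opnorm (R : realType) (X : bspace R) (T : cmop R) : \bar R :=
  ereal_sup [set y | exists x, bs_mem X x /\ (bs_norm X x <= 1)%E /\
                                y = bs_norm X (T x)].

Definition bounded_op (R : realType) (X : bspace R) (T : cmop R) : Prop :=
  (forall x, bs_mem X x -> bs_mem X (T x)) /\ (opnorm X T < +oo)%E.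

Definition compact_op (R : realType) (X : bspace R) (T : cmop R) : Prop :=
  forall x : nat -> set R -> R[i],
    (forall n, bs_mem X (x n)) ->
    (exists M : R, forall n, (bs_norm X (x n) <= M%:E)%E) ->
    exists (s : nat -> nat) (y : set R -> R[i]),
      (forall n, (s n < s n.+1)%N) /\ bs_mem X y /\
      forall e : R, 0 < e -> exists N : nat, forall n, (N <= n)%N ->
        (bs_norm X (cm_sub (T (x (s n))) y) < e%:E)%E.

Definition op_sub (R : realType) (T1 T2 : cmop R) : cmop R :=
  fun nu => cm_sub (T1 nu) (T2 nu).

(* Main.v *)
Require Import Defs.
From HB Require Import structures.
From mathcomp Require Import all_boot all_order all_algebra.
From mathcomp Require Import all_classical all_reals all_analysis.
From mathcomp Require Import complex ring lra.
From mathcomp Require Import measurable_realfun.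
From Stdlib Require Import ClassicalEpsilon.
Set Implicit Arguments.
Unset Strict Implicit.
Unset Printing Implicit Defensive.
Import Order.TTheory GRing.Theory Num.Theory.
Import numFieldNormedType.Exports.
Local Open Scope classical_set_scope.
Local Open Scope ring_scope.

(** Let E be the Cantor set, sigma the Cantor measure, and for 0 <= t <= 1 put
    F_t = 1 + (Herglotz integral of sigma restricted to E n [0,t[),
    phi_t = (F_t - 1)/(F_t + 1).  Since sigma is singular, Re F_t = 1 a.e. on
    the circle, so that with K = Im F_t there, the composition operator is the
    integral operator with kernel k_t(a, x) = P_(phi_t(zeta x))(zeta a), plus an
    atom at zeta a = 1 that carries sigma restricted to [0,t[.  Here k_0 = 1, so
    C_(phi_0) has rank one.  Away from t the function F_s is uniformly close to
    F_t for s near t and the kernels are comparable; near t their mass is small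
    uniformly in a because sigma has no atoms.  Comparing total masses
    (Scheffe's trick) gives sup_a |k_s(a, .) - k_t(a, .)|_1 -> 0, which controls
    all the operator norms.  For t = 1 the operator sends the normalised peak
    functions (1 - r)^(2 - 1/p) (1 - r w)^(-2) to functions that tend to 0
    uniformly on {|K| <= T}, but whose norms stay bounded below: by Poisson's
    formula for 1/(F + c), the integral of K^2/(L^2 + K^2) is s/(L + s) with
    s = sigma(E) = 1. *)

(** Since F_t = (1 + phi_t)/(1 - phi_t), the measure m + sigma restricted to E n [0,t[ is the
    Aleksandrov-Clark measure of phi_t at 1. Compactness of a composition operator is governed by
    the singular parts of these measures, which dictates the choice of a singular part that grows
    from 0, and does so continuously because sigma has no atoms. The summand 1 gives Re F_t >= 1.
    Hence 1/(F_t + c) with Re c >= 0 is bounded by 1 and obeys Poisson's formula with its a.e.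
    boundary values, whereas F_t itself loses the singular mass on the boundary. The kernel
    identities are instances of that formula. The obstacle is uniformity in a: as zeta a tends to 1
    the bound on k_t(a, .) degenerates and these functions tend weakly to the measure at 1.
    Perturbations of K are therefore compared multiplicatively, with a factor that does not depend
    on a. On M the integrals of the kernel in x control the norm directly. On L^p they enter Schur's
    test together with the integral in a, which is 1. For H^p only invariance remains to be
    shown. *)

Local Notation cRe := complex.Re.
Local Notation cIm := complex.Im.

(** * Real and imaginary parts, modulus and squared modulus *)

Section ComplexModulus.
Variable R : realType.
Implicit Types (z w : R[i]) (a b : R).

Lemma ReD z w : cRe (z + w) = cRe z + cRe w. Proof. by case: z; case: w. Qed.
Lemma ImD z w : cIm (z + w) = cIm z + cIm w. Proof. by case: z; case: w. Qed.
Lemma ReN z : cRe (- z) = - cRe z. Proof. by case: z. Qed.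
Lemma ImN z : cIm (- z) = - cIm z. Proof. by case: z. Qed.
Lemma ReB z w : cRe (z - w) = cRe z - cRe w. Proof. by case: z; case: w. Qed.
Lemma ImB z w : cIm (z - w) = cIm z - cIm w. Proof. by case: z; case: w. Qed.
Lemma ReM z w : cRe (z * w) = cRe z * cRe w - cIm z * cIm w.
Proof. by case: z; case: w. Qed.
Lemma ImM z w : cIm (z * w) = cRe z * cIm w + cIm z * cRe w.
Proof. by case: z; case: w. Qed.
Lemma ReV z : cRe (z^-1) = cRe z / csq z. Proof. by case: z. Qed.
Lemma ImV z : cIm (z^-1) = - cIm z / csq z.
Proof. by case: z => a b; rewrite /csq /= mulNr. Qed.
Lemma Re1 : cRe (1 : R[i]) = 1. Proof. by []. Qed.
Lemma Im1 : cIm (1 : R[i]) = 0. Proof. by []. Qed.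
Lemma Re0 : cRe (0 : R[i]) = 0. Proof. by []. Qed.
Lemma Im0 : cIm (0 : R[i]) = 0. Proof. by []. Qed.
Definition cReImE := (ReD, ImD, ReN, ImN, ReM, ImM, Re1, Im1, Re0, Im0).

Lemma ReMr a z : cRe (a%:C%C * z) = a * cRe z.
Proof. by rewrite ReM /= mul0r subr0. Qed.
Lemma ImMr a z : cIm (a%:C%C * z) = a * cIm z.
Proof. by rewrite ImM /= mul0r addr0. Qed.

Lemma eqC z w : cRe z = cRe w -> cIm z = cIm w -> z = w.
Proof. by case: z => a b; case: w => c d /= -> ->. Qed.

Lemma csq_ge0 z : 0 <= csq z.
Proof. by rewrite addr_ge0 ?sqr_ge0. Qed.
Hint Resolve csq_ge0 : core.

Lemma csqM z w : csq (z * w) = csq z * csq w.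
Proof. by case: z => a b; case: w => c d; rewrite /csq /=; ring. Qed.
Lemma csq0 : csq (0 : R[i]) = 0. Proof. by rewrite /csq /= !expr0n addr0. Qed.
Lemma csq1 : csq (1 : R[i]) = 1. Proof. by rewrite /csq /= expr1n expr0n addr0. Qed.
Lemma csqN z : csq (- z) = csq z.
Proof. by case: z => a b; rewrite /csq /= !sqrrN. Qed.
Lemma csqBC z w : csq (z - w) = csq (w - z). Proof. by rewrite -csqN opprB. Qed.

Lemma cabsE z : cabs z = ComplexField.Normc.normc z. Proof. by case: z. Qed.
Lemma cabs_ge0 z : 0 <= cabs z. Proof. exact: sqrtr_ge0. Qed.
Hint Resolve cabs_ge0 : core.
Lemma cabs_sqr z : cabs z ^+ 2 = csq z. Proof. exact: sqr_sqrtr. Qed.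
Lemma cabsM z w : cabs (z * w) = cabs z * cabs w.
Proof. by rewrite /cabs csqM sqrtrM. Qed.
Lemma cabs0 : cabs (0 : R[i]) = 0. Proof. by rewrite /cabs csq0 sqrtr0. Qed.
Lemma cabs1 : cabs (1 : R[i]) = 1. Proof. by rewrite /cabs csq1 sqrtr1. Qed.
Lemma cabsN z : cabs (- z) = cabs z. Proof. by rewrite /cabs csqN. Qed.
Lemma cabsBC z w : cabs (z - w) = cabs (w - z). Proof. by rewrite /cabs csqBC. Qed.
Lemma cabs0P z : cabs z = 0 -> z = 0.
Proof. by rewrite cabsE => /ComplexField.Normc.eq0_normc. Qed.
Lemma cabs_gt0 z : z != 0 -> 0 < cabs z.
Proof.
move=> z0; rewrite lt_neqAle cabs_ge0 andbT eq_sym.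
by apply: contra z0 => /eqP/cabs0P ->.
Qed.
Lemma csq_gt0 z : z != 0 -> 0 < csq z.
Proof. by move=> z0; rewrite -cabs_sqr exprn_gt0 ?cabs_gt0. Qed.
Lemma cabsV z : cabs (z^-1) = (cabs z)^-1.
Proof. by rewrite !cabsE ComplexField.Normc.normcV. Qed.
Lemma csqV z : csq (z^-1) = (csq z)^-1.
Proof. by rewrite -!cabs_sqr cabsV exprVn. Qed.
Lemma cabsX z n : cabs (z ^+ n) = cabs z ^+ n.
Proof. by elim: n => [|n IH]; rewrite ?expr0 ?cabs1// !exprS cabsM IH. Qed.
Lemma cabsr a : cabs (a%:C%C) = `|a|.
Proof. by rewrite /cabs /csq /= expr0n addr0 sqrtr_sqr. Qed.
Lemma ler_cabsD z w : cabs (z + w) <= cabs z + cabs w.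
Proof. by rewrite !cabsE; exact: le_normcD. Qed.
Lemma ler_cabsB z w : cabs (z - w) <= cabs z + cabs w.
Proof. by rewrite -(cabsN w); exact: ler_cabsD. Qed.
Lemma ler_cabs_sub z w : cabs z - cabs w <= cabs (z - w).
Proof. by rewrite lerBlDr -{1}(subrK w z); exact: ler_cabsD. Qed.
Lemma ler_cabsDB v z w : cabs (z - w) <= cabs (z - v) + cabs (v - w).
Proof. by rewrite (_ : z - w = (z - v) + (v - w)) ?ler_cabsD//; ring. Qed.
Lemma ler_Re_cabs z : `|cRe z| <= cabs z.
Proof.
rewrite -(@ler_pXn2r _ 2) ?nnegrE// cabs_sqr real_normK ?num_real//.
by rewrite /csq lerDl sqr_ge0.
Qed.
Lemma ler_Im_cabs z : `|cIm z| <= cabs z.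
Proof.
rewrite -(@ler_pXn2r _ 2) ?nnegrE// cabs_sqr real_normK ?num_real//.
by rewrite /csq lerDr sqr_ge0.
Qed.
Lemma ler_cabs_ReIm z : cabs z <= `|cRe z| + `|cIm z|.
Proof.
rewrite -(@ler_pXn2r _ 2) ?nnegrE// ?addr_ge0// cabs_sqr sqrrD !real_normK ?num_real//.
have := mulr_ge0 (normr_ge0 (cRe z)) (normr_ge0 (cIm z)); rewrite /csq; lra.
Qed.
Lemma inD_csq z : inD z -> csq z < 1.
Proof.
by rewrite /inD => h; rewrite -cabs_sqr expr_lt1.
Qed.
Lemma csq_inD z : csq z < 1 -> inD z.
Proof.
by rewrite /inD => h; rewrite -[ltRHS]sqrtr1 /cabs ltr_sqrt.
Qed.
Lemma inD0 : inD (0 : R[i]). Proof. by rewrite /inD cabs0. Qed.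
Lemma neq0_cabs z : 0 < cabs z -> z != 0.
Proof. by apply: contraTneq => ->; rewrite cabs0 ltxx. Qed.

End ComplexModulus.
#[global] Hint Extern 0 (is_true (0 <= cabs _)) => exact: cabs_ge0 : core.
#[global] Hint Extern 0 (is_true (0 <= csq _)) => exact: csq_ge0 : core.

(** * The parametrized circle and its chords *)

Section Circle.
Variable R : realType.
Implicit Types (x y : R).
Local Notation zeta := (@zeta R).

Lemma csq_zeta x : csq (zeta x) = 1.
Proof. by rewrite /csq /= cos2Dsin2. Qed.
Lemma cabs_zeta x : cabs (zeta x) = 1.
Proof. by rewrite /cabs csq_zeta sqrtr1. Qed.
Lemma zetaD x y : zeta (x + y) = zeta x * zeta y.
Proof.
by rewrite /zeta mulrDr cosD sinD; apply: eqC => //=; rewrite addrC mulrC [X in _ + X]mulrC.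
Qed.
Lemma zeta0 : zeta 0 = 1.
Proof. by rewrite /zeta mulr0 cos0 sin0. Qed.
Lemma zeta1 : zeta 1 = 1.
Proof. by rewrite /zeta mulr1 mulr_natl cos2pi sin2pi. Qed.
Lemma zetaD1 x : zeta (x + 1) = zeta x.
Proof. by rewrite zetaD zeta1 mulr1. Qed.
Lemma zeta_neq0 x : zeta x != 0.
Proof. by apply: neq0_cabs; rewrite cabs_zeta. Qed.
Lemma zetaN x : zeta (- x) = (zeta x)^-1.
Proof.
by apply: (mulfI (zeta_neq0 x)); rewrite -zetaD subrr zeta0 mulfV ?zeta_neq0.
Qed.
Lemma zetaNE x : zeta (- x) = Complex (cos (2 * pi * x)) (- sin (2 * pi * x)).
Proof. by rewrite /zeta mulrN cosN sinN. Qed.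

Lemma ler_sin_abs x : `|sin x| <= `|x|.
Proof.
wlog x0 : x / 0 <= x.
  move=> H; have [/H//|x0] := leP 0 x.
  by rewrite -normrN -sinN -[leRHS]normrN H// oppr_ge0 ltW.
rewrite (ger0_norm x0); have [->|xn0] := eqVneq x 0; first by rewrite sin0 normr0.
have xp : 0 < x by rewrite lt_neqAle eq_sym xn0.
have [c _] := @MVT R sin cos 0 x xp (fun y _ => is_derive_sin y)
  (@continuous_subspaceT _ _ _ _ (fun y => @continuous_sin R y)).
rewrite sin0 !subr0 => ->; rewrite normrM (ger0_norm x0) ler_piMl//.
by rewrite ler_norml cos_geN1 cos_le1.
Qed.

(** After a rotation one of the points is 1, and a chord subtending the angle [2 * pi * u] has
    length [2 * |sin (pi * u)|]; squaring avoids the absolute value. *)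
Lemma csq_zetaB x y : csq (zeta x - zeta y) = 4 * sin (pi * (x - y)) ^+ 2.
Proof.
rewrite (_ : zeta x - zeta y = zeta y * (zeta (x - y) - 1)); last first.
  by rewrite mulrBr mulr1 -zetaD; congr (zeta _ - _); ring.
rewrite csqM csq_zeta mul1r /csq/= subr0.
have -> : 2 * pi * (x - y) = (pi * (x - y)) *+ 2.
  by rewrite -mulrA mulr_natl.
rewrite cos_mulr2n sin_mulr2n.
have := cos2Dsin2 (pi * (x - y)); set c := cos _; set s := sin _ => h.
have c2 : c ^+ 2 = 1 - s ^+ 2 by rewrite -h addrK.
have -> : (c * s *+ 2) ^+ 2 = 4 * c ^+ 2 * s ^+ 2 by ring.
by rewrite c2; ring.
Qed.

Lemma zeta_lip x y : cabs (zeta x - zeta y) <= 2 * pi * `|x - y|.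
Proof.
have pi0 := @pi_ge0 R.
have p0 : 0 <= 2 * pi * `|x - y| by rewrite !mulr_ge0.
rewrite -(@ler_pXn2r _ 2) ?nnegrE// cabs_sqr csq_zetaB.
have -> : (2 * pi * `|x - y|) ^+ 2 = 4 * `|pi * (x - y)| ^+ 2.
  by rewrite normrM (ger0_norm pi0); ring.
rewrite ler_pM2l// -[X in X <= _]real_normK ?num_real//.
by rewrite ler_pXn2r ?nnegrE// ler_sin_abs.
Qed.

Lemma zeta_inj x y : 0 <= x < 1 -> 0 <= y < 1 -> zeta x = zeta y -> x = y.
Proof.
wlog xy : x y / y <= x.
  move=> H hx hy e; have [le|/ltW le] := leP y x; first exact: H.
  by apply/esym/H.
move=> /andP[x0 x1] /andP[y0 y1] e; apply/eqP; apply: contraT => nxy.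
have d0 : 0 < x - y by rewrite subr_gt0 lt_neqAle eq_sym nxy.
have : 0 < sin (pi * (x - y)).
  apply: sin_gt0_pi; rewrite mulr_gt0 ?pi_gt0//=.
  by rewrite gtr_pMr ?pi_gt0//; lra.
move=> /(exprn_gt0 2) s0; have := csq_zetaB x y; rewrite e subrr csq0 => h.
by exfalso; lra.
Qed.

Lemma zeta_eq1 x : 0 <= x < 1 -> zeta x = 1 -> x = 0.
Proof. by move=> hx h; apply: zeta_inj => //; rewrite ?lexx ?ltr01// h zeta0. Qed.

End Circle.

(** * Componentwise integration of complex functions *)

Section ComplexIntegral.
Context d (T : measurableType d) (R : realType).
Implicit Types (f g : T -> R[i]).

Definition cmeas f := measurable_fun setT (fun x => cRe (f x)) /\
                      measurable_fun setT (fun x => cIm (f x)).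

Lemma cmeas_cst c : cmeas (fun=> c). Proof. by split; exact: measurable_cst. Qed.
Lemma cmeas_real (h : T -> R) : measurable_fun setT h -> cmeas (fun x => (h x)%:C%C).
Proof. by move=> mh; split => //; exact: measurable_cst. Qed.
Lemma eq_cmeas f g : f =1 g -> cmeas f -> cmeas g.
Proof. by move=> /funext ->. Qed.
Lemma cmeasD f g : cmeas f -> cmeas g -> cmeas (fun x => f x + g x).
Proof.
move=> [f1 f2] [g1 g2]; split.
  by under eq_fun do rewrite ReD; exact: measurable_funD.
by under eq_fun do rewrite ImD; exact: measurable_funD.
Qed.
Lemma cmeasB f g : cmeas f -> cmeas g -> cmeas (fun x => f x - g x).
Proof.
move=> [f1 f2] [g1 g2]; split.
  by under eq_fun do rewrite ReB; exact: measurable_funB.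
by under eq_fun do rewrite ImB; exact: measurable_funB.
Qed.
Lemma cmeasM f g : cmeas f -> cmeas g -> cmeas (fun x => f x * g x).
Proof.
move=> [f1 f2] [g1 g2]; split.
  by under eq_fun do rewrite ReM; apply: measurable_funB; exact: measurable_funM.
by under eq_fun do rewrite ImM; apply: measurable_funD; exact: measurable_funM.
Qed.
(** [powR] behaves well only on nonnegative bases, so inversion is written as [h] times a power of
    [h ^+ 2]; both sides are 0 where [h] vanishes. *)
Lemma measurable_funV (h : T -> R) : measurable_fun setT h ->
  measurable_fun setT (fun x => (h x)^-1).
Proof.
move=> mh.
have -> : (fun x => (h x)^-1) = (fun x => h x * (h x ^+ 2) `^ (-1)).
  apply/funext => x; rewrite powR_inv1 ?sqr_ge0//.
  have [->|hx] := eqVneq (h x) 0; first by rewrite invr0 mul0r.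
  by rewrite expr2 invfM mulrA mulfV// mul1r.
apply: measurable_funM => //; apply: (measurableT_comp (@measurable_powR R _)).
exact: measurable_funX.
Qed.
Lemma measurable_csq f : cmeas f -> measurable_fun setT (fun x => csq (f x)).
Proof.
by move=> [f1 f2]; apply: measurable_funD; exact: measurable_funX.
Qed.
Lemma measurable_cabs f : cmeas f -> measurable_fun setT (fun x => cabs (f x)).
Proof.
move=> mf; have msqrt : measurable_fun setT (@Num.sqrt R).
  by apply: continuous_measurable_fun; exact: sqrt_continuous.
by apply: (measurableT_comp msqrt); exact: measurable_csq.
Qed.
Lemma cmeasV f : cmeas f -> cmeas (fun x => (f x)^-1).
Proof.
move=> mf; have mq := measurable_funV (measurable_csq mf); move: mf => [f1 f2].
split.
  by under eq_fun do rewrite ReV; exact: measurable_funM.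
under eq_fun do rewrite ImV; apply: measurable_funM => //.
exact: measurableT_comp.
Qed.
Lemma cmeasX f n : cmeas f -> cmeas (fun x => f x ^+ n).
Proof.
move=> mf; elim: n => [|n IH]; first exact: cmeas_cst.
by under eq_fun do rewrite exprS; exact: cmeasM.
Qed.

Variable mu : {measure set T -> \bar R}.

Definition cintegr f := mu.-integrable setT (fun x => (cRe (f x))%:E) /\
                        mu.-integrable setT (fun x => (cIm (f x))%:E).
Definition cint f : R[i] :=
  Complex (\int[mu]_x (cRe (f x))) (\int[mu]_x (cIm (f x))).

Lemma eq_cint f g : f =1 g -> cint f = cint g.
Proof. by move=> /funext ->. Qed.

Lemma cintegr_cmeas f : cintegr f -> cmeas f.
Proof. by move=> [/measurable_int/measurable_EFinP ? /measurable_int/measurable_EFinP ?]. Qed.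

Lemma cintegr_le f (g : T -> R) : cmeas f -> mu.-integrable setT (EFin \o g) ->
  (forall x, cabs (f x) <= g x) -> cintegr f.
Proof.
move=> [m1 m2] ig fg; split; apply: (le_integrable _ _ _ ig) => //.
- exact/measurable_EFinP.
- move=> x _; rewrite !abse_EFin lee_fin (le_trans (ler_Re_cabs _))//.
  by rewrite (le_trans (fg x))// ler_norm.
- exact/measurable_EFinP.
- move=> x _; rewrite !abse_EFin lee_fin (le_trans (ler_Im_cabs _))//.
  by rewrite (le_trans (fg x))// ler_norm.
Qed.

Lemma integrable_cst (c : R) : (mu setT < +oo)%E -> mu.-integrable setT (cst c%:E).
Proof.
move=> muoo; apply: measurable_bounded_integrable => //.
by exists `|c|; split; [exact: num_real|move=> y cy x _; exact: ltW].
Qed.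

Lemma cintegr_bounded f (B : R) : (mu setT < +oo)%E -> cmeas f ->
  (forall x, cabs (f x) <= B) -> cintegr f.
Proof. by move=> fin mf fB; apply: (@cintegr_le _ (cst B)) => //; exact: integrable_cst. Qed.

Lemma cintegr_cabs f : cintegr f -> mu.-integrable setT (fun x => (cabs (f x))%:E).
Proof.
move=> [i1 i2]; have [m1 m2] := cintegr_cmeas (conj i1 i2).
have i3 := integrableD measurableT (integrable_abse i1) (integrable_abse i2).
apply: (le_integrable _ _ _ i3) => //.
  by apply/measurable_EFinP; exact: measurable_cabs.
move=> x _ /=; rewrite lee_fin (ger0_norm (cabs_ge0 _)) [leRHS]ger0_norm ?addr_ge0//.
exact: ler_cabs_ReIm.
Qed.

Lemma cintegrB f g : cintegr f -> cintegr g -> cintegr (fun x => f x - g x).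
Proof.
move=> [f1 f2] [g1 g2]; split.
  under eq_fun do rewrite ReB EFinB; exact: integrableB.
under eq_fun do rewrite ImB EFinB; exact: integrableB.
Qed.
Lemma cintegrZ c f : cintegr f -> cintegr (fun x => c * f x).
Proof.
move=> [f1 f2]; split.
  under eq_fun do rewrite ReM EFinB !EFinM.
  by apply: integrableB => //; exact: integrableZl.
under eq_fun do rewrite ImM EFinD !EFinM.
by apply: integrableD => //; exact: integrableZl.
Qed.
Lemma cintegrM_bounded f g (B : R) : cintegr f -> cmeas g ->
  (forall x, cabs (g x) <= B) -> cintegr (fun x => f x * g x).
Proof.
move=> fi mg gB; have iB := integrableZl measurableT B (cintegr_cabs fi).
apply: (cintegr_le _ iB); first exact: cmeasM (cintegr_cmeas fi) mg.
by move=> x /=; rewrite cabsM mulrC ler_wpM2r.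
Qed.

Lemma cintD f g : cintegr f -> cintegr g ->
  cint (fun x => f x + g x) = cint f + cint g.
Proof.
move=> [f1 f2] [g1 g2]; rewrite /cint.
under [X in Complex X _]eq_Rintegral do rewrite ReD.
under [X in Complex _ X]eq_Rintegral do rewrite ImD.
by rewrite !RintegralD//.
Qed.
Lemma cintZ c f : cintegr f -> cint (fun x => c * f x) = c * cint f.
Proof.
move=> [f1 f2]; rewrite /cint.
under [X in Complex X _]eq_Rintegral do rewrite ReM.
under [X in Complex _ X]eq_Rintegral do rewrite ImM.
have iZ (r : R) (h : T -> R) : mu.-integrable setT (EFin \o h) ->
    mu.-integrable setT (EFin \o (fun x => r * h x)).
    by move=> ih; apply: eq_integrable (integrableZl measurableT r ih) => // x _ /=; rewrite EFinM.
rewrite RintegralB ?RintegralD//; do ?exact: iZ.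
rewrite !RintegralZl//.
by apply: eqC; rewrite ?ReM ?ImM.
Qed.
Lemma cintB f g : cintegr f -> cintegr g ->
  cint (fun x => f x - g x) = cint f - cint g.
Proof.
move=> fi gi.
rewrite (eq_cint (g := fun x => f x + -1 * g x)); last by move=> x; rewrite mulN1r.
by rewrite cintD ?cintZ ?mulN1r//; exact: cintegrZ.
Qed.
Lemma cint_cst c : cint (fun=> c) = c * (fine (mu setT))%:C%C.
Proof.
by rewrite /cint !Rintegral_cst//; apply: eqC; rewrite ?ReM ?ImM /= !mulr0 ?subr0 ?add0r.
Qed.
Lemma cint_real (h : T -> R) : cint (fun x => (h x)%:C%C) = (\int[mu]_x h x)%:C%C.
Proof. by rewrite /cint/= Rintegral_cst// mul0r. Qed.

(** Real and imaginary parts are estimated separately. The resulting factor 2, in place of 1,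
    reappears in later constants and is harmless. *)
Lemma cabs_cint f (g : T -> R) : cintegr f -> mu.-integrable setT (EFin \o g) ->
  (forall x, cabs (f x) <= g x) -> cabs (cint f) <= 2 * \int[mu]_x g x.
Proof.
move=> [f1 f2] ig fg; apply: (le_trans (ler_cabs_ReIm _)) => /=.
rewrite mulr_natl mulr2n lerD//.
  apply: (le_trans (le_normr_Rintegral measurableT f1)).
  apply: le_Rintegral => //; first exact: integrable_norm.
  by move=> x _; exact: le_trans (ler_Re_cabs _) (fg x).
apply: (le_trans (le_normr_Rintegral measurableT f2)).
apply: le_Rintegral => //; first exact: integrable_norm.
by move=> x _; exact: le_trans (ler_Im_cabs _) (fg x).
Qed.

Lemma cabs_cint_cst f (B : R) : (mu setT < +oo)%E -> cmeas f ->
  (forall x, cabs (f x) <= B) -> cabs (cint f) <= 2 * (B * fine (mu setT)).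
Proof.
move=> fin mf fB; rewrite -(Rintegral_cst mu measurableT B).
by apply: cabs_cint => //; [exact: cintegr_bounded fB|exact: integrable_cst].
Qed.

(** Convergence is componentwise, so that real limit theorems apply to each coordinate. *)
Definition ccvg (u : nat -> R[i]) (l : R[i]) :=
  (fun n => cRe (u n)) @ \oo --> cRe l /\ (fun n => cIm (u n)) @ \oo --> cIm l.

Lemma ccvg_unique u l l' : ccvg u l -> ccvg u l' -> l = l'.
Proof.
by move=> [a b] [a' b']; apply: eqC; [exact: (cvg_unique _ a a')|exact: (cvg_unique _ b b')].
Qed.

Lemma ccvg_le u l (v : nat -> R) : (forall n, cabs (u n - l) <= v n) ->
  v @ \oo --> 0 -> ccvg u l.
Proof.
move=> uv v0; split; apply/cvgrPdist_le => e e0.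
  move/cvgrPdist_le : v0 => /(_ _ e0); apply: filterS => n.
  rewrite sub0r normrN => h; rewrite -ReB (le_trans (ler_Re_cabs _))// cabsBC.
  by rewrite (le_trans (uv n))// (le_trans _ h)// ler_norm.
move/cvgrPdist_le : v0 => /(_ _ e0); apply: filterS => n.
rewrite sub0r normrN => h; rewrite -ImB (le_trans (ler_Im_cabs _))// cabsBC.
by rewrite (le_trans (uv n))// (le_trans _ h)// ler_norm.
Qed.

Lemma ccvg_dct (f_ : nat -> T -> R[i]) f (g : T -> R) :
  (forall n, cmeas (f_ n)) -> cmeas f ->
  {ae mu, forall x, ccvg (fun n => f_ n x) (f x)} ->
  mu.-integrable setT (EFin \o g) ->
  (forall n x, cabs (f_ n x) <= g x) ->
  ccvg (fun n => cint (f_ n)) (cint f).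
Proof.
move=> m_ [m1 m2] fl ig fg.
have aux (h : R[i] -> R) :
    (forall n, measurable_fun setT (fun x => h (f_ n x))) ->
    measurable_fun setT (fun x => h (f x)) ->
    {ae mu, forall x, (fun n => h (f_ n x)) @ \oo --> h (f x)} ->
    (forall z, `|h z| <= cabs z) ->
    (fun n => \int[mu]_x h (f_ n x)) @ \oo --> \int[mu]_x h (f x).
  move=> mh_ mh hl hle.
  have h1 : {ae mu, forall x, [set: T] x ->
      (fun n => (h (f_ n x))%:E) @ \oo --> (h (f x))%:E}.
    by move: hl; apply: filterS => x hx _; apply: cvg_EFin => //; exact: nearW.
  have h2 : {ae mu, forall x n, [set: T] x -> (`|(h (f_ n x))%:E| <= (g x)%:E)%E}.
    by apply: nearW => x n _ /=; rewrite lee_fin; exact: le_trans (hle _) (fg n x).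
  have [i1 _ c] := dominated_convergence measurableT
    (fun n => (measurable_EFinP _ _).2 (mh_ n)) ((measurable_EFinP _ _).2 mh)
    h1 ig h2.
  apply: fine_cvg; rewrite fineK; last exact: integrable_fin_num.
  exact: c.
split; apply: aux => //; try by move=> n; have [] := m_ n.
- by move: fl; apply: filterS => x [].
- exact: ler_Re_cabs.
- by move: fl; apply: filterS => x [].
- exact: ler_Im_cabs.
Qed.

End ComplexIntegral.

(** * Integrals against a restricted measure *)

Section Restriction.
Context d (T : measurableType d) (R : realType).
Variables (mu : {measure set T -> \bar R}) (D : set T) (mD : measurable D).

Lemma ge0_integral_mrestr (f : T -> \bar R) : measurable_fun setT f ->
  (forall x, 0 <= f x)%E ->
  (\int[mrestr mu mD]_x f x = \int[mu]_(x in D) f x)%E.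
Proof.
move=> mf f0; have mC := measurableC mD.
have N0 : mrestr mu mD (~` D) = 0%E by rewrite /mrestr setICl measure0.
rewrite [LHS](ge0_negligible_integral mC measurableT mf (fun x _ => f0 x) N0).
rewrite setTD setCK; apply: eq_measure_integral => A mA AD /=.
by rewrite /mrestr; congr (mu _); apply/setIidPl.
Qed.

Lemma integral_mrestr (f : T -> \bar R) : measurable_fun setT f ->
  (\int[mrestr mu mD]_x f x = \int[mu]_(x in D) f x)%E.
Proof.
move=> mf; rewrite [LHS]integralE [RHS]integralE.
by congr (_ - _)%E; apply: ge0_integral_mrestr => //;
  [exact: measurable_funepos|exact: measurable_funeneg].
Qed.

Lemma integrable_mrestr (f : T -> \bar R) : measurable_fun setT f ->
  (mrestr mu mD).-integrable setT f <-> mu.-integrable D f.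
Proof.
move=> mf; have := ge0_integral_mrestr (measurableT_comp (@abse_measurable R setT) mf)
  (fun x => abse_ge0 (f x)) => /= e.
split=> /integrableP[_ h]; apply/integrableP; split => //.
- exact: measurable_funTS.
- by rewrite -e.
- by rewrite e.
Qed.

End Restriction.

(** * Normalized Lebesgue measure on the circle and its rotation invariance *)

Section LebesgueCircle.
Variable R : realType.
Local Notation zeta := (@zeta R).

Lemma measurable_Icirc : measurable (Icirc R).
Proof. exact: measurable_itv. Qed.

(* The library's [lebesgue_measure] lives on a copy of [R] with another
   measurability display; [lebm] is the same measure on [R] itself. *)
Definition lebm (A : set R) : \bar R := @lebesgue_measure R A.
Let lebm0 : lebm set0 = 0%E. Proof. exact: (measure0 (@lebesgue_measure R)). Qed.
Let lebm_ge0 A : (0 <= lebm A)%E. Proof. exact: (measure_ge0 (@lebesgue_measure R)). Qed.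
Let lebm_sigma : semi_sigma_additive lebm.
Proof. exact: (@measure_semi_sigma_additive _ _ _ (@lebesgue_measure R)). Qed.
HB.instance Definition _ := isMeasure.Build default_measure_display R R lebm
  lebm0 lebm_ge0 lebm_sigma.

Let idR : measurableTypeR R -> R := idfun.
Let midR : measurable_fun setT idR. Proof. exact: measurable_id. Qed.

Lemma ge0_integral_lebm D (f : R -> \bar R) : measurable D -> measurable_fun D f ->
  (forall x, D x -> 0 <= f x)%E ->
  (\int[lebm]_(x in D) f x = \int[leb R]_(x in D) f x)%E.
Proof.
move=> mD mf f0.
have := @ge0_integral_pushforward _ _ _ _ _ _ midR (@lebesgue_measure R) D f mD mf.
by apply=> y; rewrite inE; exact: f0.
Qed.

Lemma integral_lebm D (f : R -> \bar R) : measurable D -> measurable_fun D f ->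
  (\int[lebm]_(x in D) f x = \int[leb R]_(x in D) f x)%E.
Proof.
move=> mD mf; rewrite [LHS]integralE [RHS]integralE.
by congr (_ - _)%E; apply: ge0_integral_lebm => //;
  [exact: measurable_funepos|exact: measurable_funeneg].
Qed.

Lemma integrable_lebm D (f : R -> \bar R) : measurable D ->
  lebm.-integrable D f <-> (leb R).-integrable D f.
Proof.
move=> mD; split=> /integrableP[mf h]; apply/integrableP; split => //.
- by rewrite -(@ge0_integral_lebm D (fun x => `|f x|)%E)//; exact: measurableT_comp.
- by rewrite (@ge0_integral_lebm D (fun x => `|f x|)%E)//; exact: measurableT_comp.
Qed.

Lemma leb_Icirc : lebm (Icirc R) = 1%E.
Proof. by rewrite /lebm /Icirc lebesgue_measure_itv/= lte_fin ltr01 oppr0 adde0. Qed.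

Lemma leb_Icirc_lty : (lebm (Icirc R) < +oo)%E.
Proof. by rewrite leb_Icirc ltry. Qed.

(** Normalized Lebesgue measure of the circle, kept as a measure on all of [R] that charges only
    [[0,1)]: integrals then run over the whole line and no domain has to be carried along. *)
Definition lam : {finite_measure set R -> \bar R} :=
  mfrestr measurable_Icirc leb_Icirc_lty.

Lemma lamE A : lam A = lebm (A `&` Icirc R). Proof. by []. Qed.
Lemma lamT : lam setT = 1%E. Proof. by rewrite lamE setTI leb_Icirc. Qed.
Lemma lamT_lty : (lam setT < +oo)%E. Proof. by rewrite lamT ltry. Qed.

Lemma ge0_integral_lam (f : R -> \bar R) : measurable_fun setT f ->
  (forall x, 0 <= f x)%E -> (\int[lam]_x f x = \int[leb R]_(x in Icirc R) f x)%E.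
Proof.
move=> mf f0; rewrite -ge0_integral_lebm//; last 2 first.
- exact: measurable_Icirc.
- exact: measurable_funTS.
exact: ge0_integral_mrestr.
Qed.

Lemma integral_lam (f : R -> \bar R) : measurable_fun setT f ->
  (\int[lam]_x f x = \int[leb R]_(x in Icirc R) f x)%E.
Proof.
move=> mf; rewrite -integral_lebm//; last 2 first.
- exact: measurable_Icirc.
- exact: measurable_funTS.
exact: integral_mrestr.
Qed.

Lemma integrable_lam (f : R -> \bar R) : measurable_fun setT f ->
  lam.-integrable setT f <-> (leb R).-integrable (Icirc R) f.
Proof.
move=> mf; rewrite -integrable_lebm; last exact: measurable_Icirc.
exact: integrable_mrestr.
Qed.

(** The translated measure gives every half-open interval its length, and this characterizes
    Lebesgue measure. *)
Lemma lebesgue_shift (e : R) (A : set R) : measurable A ->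
  lebm ((fun x => x + e) @^-1` A) = lebm A.
Proof.
move=> mA.
pose sh (x : measurableTypeR R) : measurableTypeR R := x + e.
have ms : measurable_fun setT sh by exact: measurable_funD.
pose P : {measure set (measurableTypeR R) -> \bar R} :=
  measure_function_pushforward__canonical__measure_function_Measure
    (@lebesgue_measure R) ms.
have h := @lebesgue_measure_unique R P.
apply/esym/h => // X [[a b]] _ <- /=.
rewrite /pushforward /sh /=.
rewrite (_ : (fun _ => _) @^-1` _ = `]a - e, b - e]%classic); last first.
  by apply/seteqP; split=> x /=; rewrite !in_itv/= ltrBlDr lerBrDr.
rewrite !lebesgue_measure_itv/= !lte_fin ltrD2r.
by case: ifP => // _; rewrite -!EFinD; congr (_%:E); ring.
Qed.

Lemma Rintegral_shift (g : R -> R) (e a b : R) : measurable_fun setT g ->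
  \int[lebm]_(x in `[a, b[) g (x + e) = \int[lebm]_(x in `[a + e, b + e[) g x.
Proof.
move=> mg.
have ms : measurable_fun setT (fun x : R => x + e) by exact: measurable_funD.
have aux (f : R -> \bar R) : measurable_fun setT f -> (forall x, 0 <= f x)%E ->
  (\int[lebm]_(x in `[a, b[) f (x + e)%R = \int[lebm]_(x in `[(a + e)%R, (b + e)%R[) f x)%E.
  move=> mf f0.
  rewrite [RHS](eq_measure_integral (pushforward (lebm) (fun x : R => x + e))); last first.
    by move=> A mA _; apply/esym; exact: lebesgue_shift.
  rewrite (ge0_integral_pushforward ms lebm _ (measurable_funTS mf)) //.
  rewrite (_ : (fun x => x + e) @^-1` _ = `[a, b[%classic)//.
  by apply/seteqP; split=> x /=; rewrite !in_itv/= lerD2r ltrD2r.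
rewrite /Rintegral [in LHS]integralE [in RHS]integralE;
 congr (fine (_ - _)).
  have := aux ((EFin \o g)^\+)%E (measurable_funepos ((measurable_EFinP _ _).2 mg))
    (fun x => funepos_ge0 _ x).
  have -> : (fun x => (g (x + e))%:E)^\+%E = (fun x => (EFin \o g)^\+ (x + e)%R)%E.
    by apply/funext => x; rewrite !funeposE.
  exact.
have := aux ((EFin \o g)^\-)%E (measurable_funeneg ((measurable_EFinP _ _).2 mg))
  (fun x => funeneg_ge0 _ x).
have -> : (fun x => (g (x + e))%:E)^\-%E = (fun x => (EFin \o g)^\- (x + e)%R)%E.
  by apply/funext => x; rewrite !funenegE.
exact.
Qed.

Lemma Rintegral_lam (g : R -> R) : measurable_fun setT g ->
  \int[lam]_x g x = \int[lebm]_(x in `[0, 1[) g x.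
Proof.
move=> mg; rewrite /Rintegral; congr fine.
by apply: integral_mrestr; exact/measurable_EFinP.
Qed.

Lemma lam_periodic_shift (g : R -> R) (e B : R) : measurable_fun setT g ->
  (forall x, `|g x| <= B) -> (forall x, g (x + 1) = g x) -> 0 <= e <= 1 ->
  \int[lam]_x g (x + e) = \int[lam]_x g x.
Proof.
move=> mg gB gper /andP[e0 e1].
have ms : measurable_fun setT (fun x : R => g (x + e)).
  by apply: (measurableT_comp mg); exact: measurable_funD.
have ig (a b : R) : (lebm).-integrable `[a, b[ (EFin \o g).
  apply: measurable_bounded_integrable => //.
  - by change (@lebesgue_measure R `[a, b[%classic < +oo)%E;
    rewrite lebesgue_measure_itv/= lte_fin; case: ifP => // _; rewrite -EFinB ltry.
  - exact: measurable_funTS.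
  - exists B; split; [exact: num_real|move=> y By x _; exact: le_trans (gB x) (ltW By)].
have cat a b c : a <= b -> b <= c -> \int[lebm]_(x in `[a, c[) g x =
    \int[lebm]_(x in `[a, b[) g x + \int[lebm]_(x in `[b, c[) g x.
  move=> ab bc; rewrite -Rintegral_setU//=.
  - by rewrite -(@itv_bndbnd_setU _ _ _ (BLeft b))// ?bnd_simp.
  - by rewrite -(@itv_bndbnd_setU _ _ _ (BLeft b))// ?bnd_simp.
  - apply/disj_setPS => y [/=]; rewrite !in_itv/= => /andP[_ h] /andP[h' _].
    by move: h; rewrite ltNge h'.
rewrite !Rintegral_lam// Rintegral_shift// add0r.
(* The translate covers [[e, 1[] and [[1, 1 + e[]; periodicity moves the second piece back to [[0,
   e[]. *)
rewrite (cat e 1 (1 + e))// ?lerDl// (cat 0 e 1)// addrC; congr (_ + _).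
have -> : \int[lebm]_(x in `[0, e[) g x = \int[lebm]_(x in `[0, e[) g (x + 1).
  by apply: eq_Rintegral => x _; rewrite gper.
by rewrite Rintegral_shift// add0r [e + 1]addrC.
Qed.

Lemma cint_lam_shift (g : R -> R[i]) (e B : R) : cmeas g ->
  (forall x, cabs (g x) <= B) -> (forall x, g (x + 1) = g x) -> 0 <= e <= 1 ->
  cint lam (fun x => g (x + e)) = cint lam g.
Proof.
move=> [m1 m2] gB gp he; rewrite /cint.
rewrite (lam_periodic_shift (B := B) m1)//; first last.
- by move=> x; rewrite gp.
- by move=> x; exact: le_trans (ler_Re_cabs _) (gB x).
rewrite (lam_periodic_shift (B := B) m2)//; first last.
- by move=> x; rewrite gp.
- by move=> x; exact: le_trans (ler_Im_cabs _) (gB x).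
Qed.

Lemma cint_lam_cst c : cint lam (fun=> c) = c.
Proof.
rewrite cint_cst (_ : fine _ = 1) ?mulr1//.
by have := lamT => /= ->.
Qed.

Lemma lipschitz_measurable (h : R -> R) (L : R) :
  (forall x y, `|h x - h y| <= L * `|x - y|) -> measurable_fun setT h.
Proof.
move=> hL; apply: continuous_measurable_fun => x.
apply/cvgrPdist_le => e e0.
have L1 : 0 < `|L| + 1 by rewrite ltr_wpDl.
exists (e / (`|L| + 1)); first by rewrite /= divr_gt0.
move=> y /=; rewrite ltr_pdivlMr// => hy.
apply: (le_trans (hL _ _)); apply: le_trans (ltW hy).
rewrite mulrC ler_wpM2l// (le_trans (ler_norm _))// lerDl//.
Qed.

Lemma cmeas_lipschitz (h : R -> R[i]) (L : R) :
  (forall x y, cabs (h x - h y) <= L * `|x - y|) -> cmeas h.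
Proof.
move=> hL; split; apply: (@lipschitz_measurable _ L) => x y.
  by rewrite -ReB (le_trans (ler_Re_cabs _)).
by rewrite -ImB (le_trans (ler_Im_cabs _)).
Qed.

Lemma cmeas_zeta : cmeas zeta.
Proof. exact: cmeas_lipschitz (@zeta_lip R). Qed.

End LebesgueCircle.

(** * A quantitative notion of holomorphy and its stability *)

Section Holomorphic.
Variable R : realType.
Implicit Types (f g : R[i] -> R[i]) (v w z : R[i]) (r : R).
Local Notation zeta := (@zeta R).

(* Complex differentiability with a remainder that is quadratic uniformly on
   the closed disc of radius [r]. *)
Definition hol r f := exists f' C, 0 <= C /\ forall v w, cabs v <= r -> cabs w <= r ->
  cabs (f w - f v - f' v * (w - v)) <= C * cabs (w - v) ^+ 2.

Lemma eq_hol r f g : (forall z, cabs z <= r -> f z = g z) -> hol r f -> hol r g.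
Proof.
move=> fg [f' [C [C0 h]]]; exists f', C; split => // v w hv hw.
by rewrite -!fg//; exact: h.
Qed.

(** The quadratic remainder already forces [f'] to be Lipschitz: adding the estimates based at [v]
    and at [w] isolates [(f' w - f' v) * (w - v)]. Bounds for [f'] and [f] and a Lipschitz bound for
    [f] follow on the disc, and [B], a sum of all the constants, serves every estimate. *)
Lemma holP r f : 0 <= r -> hol r f -> exists f' B, [/\ 0 <= B,
  forall v w, cabs v <= r -> cabs w <= r ->
    cabs (f w - f v - f' v * (w - v)) <= B * cabs (w - v) ^+ 2,
  (forall v, cabs v <= r -> cabs (f v) <= B /\ cabs (f' v) <= B) &
  forall v w, cabs v <= r -> cabs w <= r ->
    cabs (f w - f v) <= B * cabs (w - v) /\ cabs (f' w - f' v) <= B * cabs (w - v)].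
Proof.
move=> r0 [f' [C [C0 h]]].
have f'L v w : cabs v <= r -> cabs w <= r -> cabs (f' w - f' v) <= 2 * C * cabs (w - v).
  move=> hv hw; have [->|vw] := eqVneq w v; first by rewrite !subrr cabs0 mulr0.
  have wv : 0 < cabs (w - v) by rewrite cabs_gt0// subr_eq0.
  rewrite -(ler_pM2r wv) -cabsM.
  rewrite (_ : _ * (w - v) = (f w - f v - f' v * (w - v)) + (f v - f w - f' w * (v - w))); last by ring.
  apply: (le_trans (ler_cabsD _ _)).
  rewrite (_ : 2 * C * _ * _ = C * cabs (w - v) ^+ 2 + C * cabs (v - w) ^+ 2).
    by apply: lerD; exact: h.
  by rewrite (cabsBC v); ring.
have c0 : cabs (0 : R[i]) <= r by rewrite cabs0.
pose B1 := cabs (f' 0) + 2 * C * r.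
have B10 : 0 <= B1 by rewrite addr_ge0// !mulr_ge0.
have f'B v : cabs v <= r -> cabs (f' v) <= B1.
  move=> hv; rewrite -(subrK (f' 0) (f' v)) (le_trans (ler_cabsD _ _))// addrC lerD2l.
  by rewrite (le_trans (f'L _ _ c0 hv))// subr0 ler_wpM2l// mulr_ge0.
pose B2 := B1 + C * (2 * r).
have B20 : 0 <= B2 by rewrite addr_ge0// !mulr_ge0.
have fL v w : cabs v <= r -> cabs w <= r -> cabs (f w - f v) <= B2 * cabs (w - v).
  move=> hv hw; rewrite -(subrK (f' v * (w - v)) (f w - f v)).
  apply: (le_trans (ler_cabsD _ _)); rewrite mulrDl addrC lerD//.
    by rewrite cabsM ler_wpM2r// f'B.
  apply: (le_trans (h _ _ hv hw)); rewrite expr2 mulrA ler_wpM2r// ler_wpM2l//.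
  by rewrite (le_trans (ler_cabsB _ _))// mulr_natl mulr2n lerD.
pose B3 := cabs (f 0) + B2 * r.
have fB v : cabs v <= r -> cabs (f v) <= B3.
  move=> hv; rewrite -(subrK (f 0) (f v)) (le_trans (ler_cabsD _ _))// addrC lerD2l.
  by rewrite (le_trans (fL _ _ c0 hv))// subr0 ler_wpM2l.
have B30 : 0 <= B3 by rewrite addr_ge0// mulr_ge0.
have C20 : 0 <= 2 * C by rewrite mulr_ge0.
exists f', (C + 2 * C + B1 + B2 + B3); split.
- by lra.
- move=> v w hv hw; apply: (le_trans (h _ _ hv hw)).
  by apply: ler_wpM2r; [rewrite exprn_ge0|lra].
- by move=> v hv; split; [apply: (le_trans (fB _ hv))|apply: (le_trans (f'B _ hv))]; lra.
- move=> v w hv hw; split.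
    by apply: (le_trans (fL _ _ hv hw)); apply: ler_wpM2r => //; lra.
  by apply: (le_trans (f'L _ _ hv hw)); apply: ler_wpM2r => //; lra.
Qed.

Lemma hol_cst r c : hol r (fun=> c).
Proof.
exists (fun=> 0), 0; split => // v w _ _.
by rewrite subrr mul0r subr0 cabs0 mul0r.
Qed.

Lemma hol_id r : hol r id.
Proof.
exists (fun=> 1), 0; split => // v w _ _.
by rewrite mul1r subrr cabs0 mul0r.
Qed.

Lemma holD r f g : hol r f -> hol r g -> hol r (fun z => f z + g z).
Proof.
move=> [f' [C [C0 h]]] [g' [K [K0 k]]].
exists (fun z => f' z + g' z), (C + K); split; first exact: addr_ge0.
move=> v w hv hw.
rewrite (_ : _ - _ - _ = (f w - f v - f' v * (w - v)) + (g w - g v - g' v * (w - v))); last by ring.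
by rewrite mulrDl (le_trans (ler_cabsD _ _))// lerD ?h ?k.
Qed.

Lemma holM r f g : 0 <= r -> hol r f -> hol r g -> hol r (fun z => f z * g z).
Proof.
move=> r0 /(holP r0)[f' [B [B0 f1 f2 f3]]] /(holP r0)[g' [K [K0 g1 g2 g3]]].
exists (fun z => f' z * g z + f z * g' z), (3 * (B * K)); split.
  by rewrite !mulr_ge0.
move=> v w hv hw; set h := w - v.
rewrite (_ : _ - _ - _ = f w * (g w - g v - g' v * h) +
  ((f w - f v - f' v * h) * g v + (f w - f v) * (g' v * h))); last by ring.
have [f2v f2v'] := f2 _ hv; have [f2w _] := f2 _ hw.
have [g2v g2v'] := g2 _ hv; have [f3v _] := f3 _ _ hv hw.
have e1 : cabs (f w * (g w - g v - g' v * h)) <= B * K * cabs h ^+ 2.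
  by rewrite cabsM -mulrA ler_pM// g1.
have e2 : cabs ((f w - f v - f' v * h) * g v) <= B * K * cabs h ^+ 2.
  by rewrite cabsM mulrAC ler_pM// f1.
have e3 : cabs ((f w - f v) * (g' v * h)) <= B * K * cabs h ^+ 2.
  rewrite !cabsM (_ : B * K * _ = (B * cabs h) * (K * cabs h)); last by ring.
  by rewrite ler_pM// ?mulr_ge0// ler_wpM2r.
apply: (le_trans (ler_cabsD _ _)).
have := ler_cabsD ((f w - f v - f' v * h) * g v) ((f w - f v) * (g' v * h)).
by lra.
Qed.

Lemma holV r f (d : R) : 0 <= r -> 0 < d -> (forall z, cabs z <= r -> d <= cabs (f z)) ->
  hol r f -> hol r (fun z => (f z)^-1).
Proof.
move=> r0 d0 fd /(holP r0)[f' [B [B0 f1 f2 f3]]].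
exists (fun z => - f' z / f z ^+ 2), (2 * (B * B) / d ^+ 3); split.
  by apply: divr_ge0; [rewrite !mulr_ge0|rewrite exprn_ge0// ltW].
move=> v w hv hw; set h := w - v.
have nz z : cabs z <= r -> f z != 0.
  by move=> hz; apply: neq0_cabs; exact: lt_le_trans (fd _ hz).
have fv0 := nz _ hv; have fw0 := nz _ hw.
rewrite (_ : _ - _ - _ = (f'  v * h * (f w - f v) - (f w - f v - f' v * h) * f v) / (f w * f v ^+ 2)); last first.
  by field; rewrite fv0 fw0.
have [f2v f2v'] := f2 _ hv; have [f3v _] := f3 _ _ hv hw.
rewrite cabsM cabsV [leRHS]mulrAC ler_pM// ?invr_ge0//.
  apply: (le_trans (ler_cabsB _ _)); rewrite !cabsM.
  have e1 : cabs (f' v) * cabs h * cabs (f w - f v) <= B * cabs h * (B * cabs h).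
    by rewrite ler_pM// ?mulr_ge0// ler_wpM2r.
  have e2 : cabs (f w - f v - f' v * h) * cabs (f v) <= B * cabs h ^+ 2 * B.
    by rewrite ler_pM// f1.
  by lra.
rewrite cabsM cabsX lef_pV2 ?posrE ?exprn_gt0// ?mulr_gt0 ?exprn_gt0 ?cabs_gt0//.
by rewrite exprS ler_pM ?exprn_ge0 ?(ltW d0)//; [exact: fd|rewrite lerXn2r ?nnegrE ?(ltW d0) ?fd].
Qed.

Lemma hol_comp r r' u f : 0 <= r -> 0 <= r' -> (forall z, cabs z <= r -> cabs (f z) <= r') ->
  hol r f -> hol r' u -> hol r (fun z => u (f z)).
Proof.
move=> r0 r0' fr /(holP r0)[f' [B [B0 f1 f2 f3]]] /(holP r0')[u' [K [K0 u1 u2 u3]]].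
exists (fun z => u' (f z) * f' z), (K * B ^+ 2 + K * B); split.
  by rewrite addr_ge0// ?mulr_ge0// exprn_ge0.
move=> v w hv hw; set h := w - v.
rewrite (_ : _ - _ - _ = (u (f w) - u (f v) - u' (f v) * (f w - f v)) +
  u' (f v) * (f w - f v - f' v * h)); last by ring.
apply: (le_trans (ler_cabsD _ _)); rewrite mulrDl lerD//.
  apply: (le_trans (u1 _ _ (fr _ hv) (fr _ hw))).
  rewrite -mulrA ler_wpM2l// -exprMn lerXn2r ?nnegrE ?mulr_ge0//.
  by have [] := f3 _ _ hv hw.
by rewrite cabsM -mulrA ler_pM// ?f1//; have [] := u2 _ (fr _ hv).
Qed.

Lemma holX r f n : 0 <= r -> hol r f -> hol r (fun z => f z ^+ n).
Proof.
move=> r0 hf; elim: n => [|n IH]; first exact: hol_cst.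
by apply: eq_hol (holM r0 hf IH) => z _; rewrite exprS.
Qed.

Lemma hol_scale (r : R) f : 0 <= r -> hol r f -> hol 1 (fun z => f (r%:C%C * z)).
Proof.
move=> r0 hf; apply: (@hol_comp 1 r f (fun z => r%:C%C * z)) => //.
  by move=> z hz; rewrite cabsM cabsr ger0_norm// ler_piMr.
by apply: holM => //; [exact: hol_cst|exact: hol_id].
Qed.

Lemma circle_le (p : R[i]) (s r : R) : 0 <= s -> cabs p + s <= r ->
  forall x, cabs (p + s%:C%C * zeta x) <= r.
Proof.
move=> s0 h x; apply: le_trans h; apply: (le_trans (ler_cabsD _ _)).
by rewrite cabsM cabs_zeta cabsr mulr1 ger0_norm.
Qed.

Lemma cmeas_circle (h : R[i] -> R[i]) (B r : R) (p : R[i]) (s : R) : 0 <= B ->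
  (forall v w, cabs v <= r -> cabs w <= r -> cabs (h w - h v) <= B * cabs (w - v)) ->
  0 <= s -> cabs p + s <= r -> cmeas (fun x => h (p + s%:C%C * zeta x)).
Proof.
move=> B0 hB s0 psr; have cl := circle_le s0 psr.
apply: (@cmeas_lipschitz _ _ (B * (s * (2 * pi)))) => x y.
apply: (le_trans (hB _ _ (cl _) (cl _))).
rewrite (_ : _ - _ = s%:C%C * (zeta x - zeta y)); last by ring.
by rewrite cabsM cabsr ger0_norm// -!mulrA ler_wpM2l// ler_wpM2l// mulrA zeta_lip.
Qed.

Lemma small_eq0 (a C : R) : (forall e, 0 < e -> e < 1 -> a <= C * e) -> a <= 0.
Proof.
move=> h; apply/ler_addgt0Pr => e e0.
pose e1 := Num.min (1 / 2) (e / (`|C| + 1)).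
have C1 : 0 < `|C| + 1 by rewrite ltr_wpDl.
have e10 : 0 < e1 by rewrite lt_min divr_gt0//= divr_gt0.
have e11 : e1 < 1 by rewrite gt_min; apply/orP; left; lra.
rewrite add0r; apply: (le_trans (h _ e10 e11)).
have : e1 <= e / (`|C| + 1) by rewrite ge_min lexx orbT.
rewrite ler_pdivlMr// => h1; apply: le_trans h1; rewrite mulrC ler_wpM2l ?(ltW e10)//.
by rewrite (le_trans (ler_norm _))// lerDl.
Qed.

(* Rotating the circle does not change the integral of [f] over it; to first
   order in the rotation angle this is the vanishing of the integral below. *)
Lemma circle_deriv0 r f f' (B : R) (p : R[i]) (s : R) : 0 <= B -> 0 < s ->
  cabs p + s <= r ->
  (forall v w, cabs v <= r -> cabs w <= r ->
    cabs (f w - f v - f' v * (w - v)) <= B * cabs (w - v) ^+ 2) ->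
  (forall v, cabs v <= r -> cabs (f v) <= B /\ cabs (f' v) <= B) ->
  (forall v w, cabs v <= r -> cabs w <= r ->
    cabs (f w - f v) <= B * cabs (w - v) /\ cabs (f' w - f' v) <= B * cabs (w - v)) ->
  cint (lam R) (fun x => f' (p + s%:C%C * zeta x) * zeta x) = 0.
Proof.
move=> B0 s0 psr f1 f2 f3; have cl := circle_le (ltW s0) psr.
set J := cint _ _; apply: cabs0P; apply/eqP; rewrite eq_le cabs_ge0 andbT.
pose g x := f (p + s%:C%C * zeta x); pose g' x := f' (p + s%:C%C * zeta x) * zeta x.
have mg : cmeas g.
  by apply: (@cmeas_circle f B r) => //; [move=> v w hv hw; have [] := f3 _ _ hv hw|exact: ltW].
have mg' : cmeas g'.
  apply: cmeasM; last exact: cmeas_zeta.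
  by apply: (@cmeas_circle f' B r) => //; [move=> v w hv hw; have [] := f3 _ _ hv hw|exact: ltW].
have gB x : cabs (g x) <= B by have [] := f2 _ (cl x).
have g'B x : cabs (g' x) <= B.
  by rewrite cabsM cabs_zeta mulr1; have [] := f2 _ (cl x).
have fin := lamT_lty R.
have ig := cintegr_bounded fin mg gB; have ig' := cintegr_bounded fin mg' g'B.
apply: (@small_eq0 _ (2 * B * s * (2 * pi))) => e e0 e1.
have mge : cmeas (fun x : R => g (x + e)).
  have ms : measurable_fun setT (fun x : R => x + e) by exact: measurable_funD.
  by case: mg => m1 m2; split; [exact: (measurableT_comp m1)|exact: (measurableT_comp m2)].
have ige : cintegr (lam R) (fun x : R => g (x + e)).
  by apply: (cintegr_bounded (B := B) fin mge) => x.
(* Turning the circle by [e] moves the point [p + s * zeta x] by [k * zeta x]. *)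
pose k := s%:C%C * (zeta e - 1).
have shift : cint (lam R) (fun x : R => g (x + e)) = cint (lam R) g.
  apply: (@cint_lam_shift _ g e B) => //; first by move=> x; rewrite /g zetaD1.
  by rewrite !ltW.
have E : cint (lam R) (fun x : R => (g (x + e) - g x) - k * g' x) = - (k * J).
  rewrite cintB; first by rewrite cintB// shift subrr sub0r cintZ.
    exact: cintegrB.
  exact: cintegrZ.
have k0 : 0 < cabs k.
  rewrite cabs_gt0// mulf_neq0//.
    by rewrite neq0_cabs// cabsr gtr0_norm.
  rewrite subr_eq0; apply/eqP => /zeta_eq1 h.
  by have := e0; rewrite {1}h ?ltxx // (ltW e0).
(* By [E], a function bounded by [B * |k|^2] has integral [- (k * J)]. Hence [|J|] is at most
   [2 * B * |k|], and [|k|] is at most [2 * pi * s * e]. *)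
rewrite -(ler_pM2l k0) -cabsM -cabsN -E.
have bd x : cabs ((g (x + e) - g x) - k * g' x) <= B * cabs k ^+ 2.
  have h : p + s%:C%C * zeta (x + e) - (p + s%:C%C * zeta x) = k * zeta x.
    by rewrite zetaD /k; ring.
  have := f1 _ _ (cl x) (cl (x + e)); rewrite h cabsM cabs_zeta mulr1.
  by rewrite /g /g' (_ : k * (_ * _) = f' (p + s%:C%C * zeta x) * (k * zeta x)); [|ring].
have md : cmeas (fun x : R => (g (x + e) - g x) - k * g' x).
  by apply: cmeasB; [exact: cmeasB|apply: cmeasM => //; exact: cmeas_cst].
have := cabs_cint_cst fin md bd.
rewrite (_ : fine _ = 1); last by have := lamT R => /= ->.
rewrite mulr1 => /le_trans; apply.
have kle : cabs k <= s * (2 * pi * e).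
  rewrite cabsM cabsr gtr0_norm// ler_wpM2l ?(ltW s0)//.
  by have := zeta_lip e 0; rewrite zeta0 subr0 (gtr0_norm e0).
rewrite (_ : 2 * (B * _) = cabs k * (2 * B * cabs k)); last by ring.
by rewrite ler_wpM2l// -!mulrA ler_wpM2l// ler_wpM2l// (le_trans kle)// -!mulrA.
Qed.

(** Telescoping over [N] equal steps leaves an error of [N * C / N^2 = C / N]. The restriction
    [0 < t] reflects the intended use: the increment is expanded at [t] along a circle of radius
    [t], and [circle_deriv0] asks for a positive radius. *)
Lemma quad_const (g : R -> R[i]) (C : R) : 0 <= C ->
  (forall s t, 0 <= s <= 1 -> 0 < t <= 1 -> cabs (g s - g t) <= C * (s - t) ^+ 2) ->
  g 0 = g 1.
Proof.
move=> C0 h; apply/eqP; rewrite -subr_eq0; apply/eqP/cabs0P/eqP.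
rewrite eq_le cabs_ge0 andbT; apply/ler_addgt0Pr => e e0; rewrite add0r.
have [n hn] : exists n : nat, C / e < n.+1%:R.
  exists (Num.truncn (C / e)); exact: truncnS_gt.
pose N : R := n.+1%:R; have N0 : 0 < N by rewrite ltr0n.
have st k : (k <= n.+1)%N -> cabs (g 0 - g (k%:R / N)) <= k%:R * (C / N ^+ 2).
  elim: k => [|k IH] hk; first by rewrite !mul0r subrr cabs0.
  apply: (le_trans (ler_cabsDB (g (k%:R / N)) _ _)).
  rewrite -[in leRHS]natr1 [leRHS]mulrDl mul1r lerD ?IH// 1?ltnW//.
  have kN : k%:R / N <= 1 by rewrite ler_pdivrMr// mul1r ler_nat ltnW.
  have kN' : k.+1%:R / N <= 1 by rewrite ler_pdivrMr// mul1r ler_nat.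
  have := h (k%:R / N) (k.+1%:R / N).
  rewrite kN kN' divr_ge0 ?ler0n ?(ltW N0)// divr_gt0 ?ltr0n//= => /(_ isT isT).
  rewrite -natr1 => /le_trans; apply; rewrite ler_wpM2l//.
  rewrite (_ : _ - _ = - N^-1); last by field; rewrite gt_eqF.
  by rewrite sqrrN exprVn.
have := st n.+1 (leqnn _); rewrite -/N divff ?gt_eqF// => /le_trans; apply.
rewrite (_ : _ * _ = C / N); last by field; rewrite gt_eqF.
by rewrite ler_pdivrMr// -ler_pdivrMl// mulrC; exact: ltW.
Qed.

End Holomorphic.

(** * Cauchy's and Poisson's formulas on the closed disc *)

Section Cauchy.
Variable R : realType.
Implicit Types (f g : R[i] -> R[i]) (v w z : R[i]) (r : R).
Local Notation zeta := (@zeta R).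

Lemma zetaB_lb z x : 1 - cabs z <= cabs (zeta x - z).
Proof. by rewrite -(cabs_zeta x) ler_cabs_sub. Qed.

Lemma zetaB_neq0 z x : inD z -> zeta x - z != 0.
Proof.
move=> hz; apply: neq0_cabs; apply: lt_le_trans (zetaB_lb z x).
by rewrite subr_gt0.
Qed.

Lemma cauchy_kernel_le z x : inD z -> cabs (zeta x / (zeta x - z)) <= (1 - cabs z)^-1.
Proof.
move=> hz; rewrite cabsM cabs_zeta mul1r cabsV lef_pV2 ?posrE ?subr_gt0//.
  exact: zetaB_lb.
by rewrite cabs_gt0// zetaB_neq0.
Qed.

Lemma cmeas_cauchy_kernel z : cmeas (fun x => zeta x / (zeta x - z)).
Proof.
apply: cmeasM; first exact: cmeas_zeta.
by apply: cmeasV; apply: cmeasB; [exact: cmeas_zeta|exact: cmeas_cst].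
Qed.

(** The circle is shrunk linearly onto [z] along [gam s]. The derivative of the integral in [s]
    would be the integral of [f' (gam s x) * (zeta x - z) * q x = f' (gam s x) * zeta x], which is 0
    by [circle_deriv0]; quadratic increments and [quad_const] replace the differentiation. At
    [s = 0] the factor [f z] comes out. *)
Lemma cauchy_aux f z : hol 1 f -> inD z ->
  cint (lam R) (fun x => f (zeta x) * (zeta x / (zeta x - z))) =
  f z * cint (lam R) (fun x => zeta x / (zeta x - z)).
Proof.
move=> /(holP ler01)[f' [B [B0 f1 f2 f3]]] hz.
pose gam s x := (1 - s)%:C%C * z + s%:C%C * zeta x.
pose q x := zeta x / (zeta x - z).
pose Q := (1 - cabs z)^-1.
have z1 : cabs z <= 1 by exact: ltW.
have Q0 : 0 <= Q by rewrite invr_ge0 subr_ge0.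
have qQ x : cabs (q x) <= Q by exact: cauchy_kernel_le.
have mq : cmeas q by exact: cmeas_cauchy_kernel.
have fin := lamT_lty R.
have pos s : 0 <= s <= 1 -> cabs ((1 - s)%:C%C * z) + s <= 1.
  move=> /andP[s0 s1]; rewrite cabsM cabsr ger0_norm ?subr_ge0//.
  have : (1 - s) * cabs z <= (1 - s) * 1 by rewrite ler_wpM2l ?subr_ge0.
  by lra.
have gle s x : 0 <= s <= 1 -> cabs (gam s x) <= 1.
  by move=> hs; apply: circle_le; [case/andP: hs|exact: pos].
pose N s := cint (lam R) (fun x => f (gam s x) * q x).
have mf s : 0 <= s <= 1 -> cmeas (fun x => f (gam s x)).
  move=> hs; apply: (@cmeas_circle _ f B 1) => //.
  - by move=> v w hv hw; have [] := f3 _ _ hv hw.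
  - by case/andP: hs.
  - exact: pos.
have mf' s : 0 <= s <= 1 -> cmeas (fun x => f' (gam s x)).
  move=> hs; apply: (@cmeas_circle _ f' B 1) => //.
  - by move=> v w hv hw; have [] := f3 _ _ hv hw.
  - by case/andP: hs.
  - exact: pos.
have iN s : 0 <= s <= 1 -> cintegr (lam R) (fun x => f (gam s x) * q x).
  move=> hs; apply: (cintegr_bounded (B := B * Q)) => //.
    by apply: cmeasM => //; exact: mf.
  by move=> x; rewrite cabsM ler_pM//; have [] := f2 _ (gle _ x hs).
have iJ s : 0 <= s <= 1 -> cintegr (lam R) (fun x => f' (gam s x) * zeta x).
  move=> hs; apply: (cintegr_bounded (B := B)) => //.
    by apply: cmeasM; [exact: mf'|exact: cmeas_zeta].
  by move=> x; rewrite cabsM cabs_zeta mulr1; have [] := f2 _ (gle _ x hs).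
have N01 : N 0 = N 1.
  (* [|gam s x - gam t x|^2] is at most [4 * (s - t)^2], and [cabs_cint_cst] contributes the
     remaining factor 2. *)
  apply: (@quad_const _ _ (8 * B * Q)); first by rewrite !mulr_ge0.
  move=> s t hs /andP[t0 t1]; have ht : 0 <= t <= 1 by rewrite ltW.
  have E : N s - N t = cint (lam R) (fun x =>
      (f (gam s x) * q x - f (gam t x) * q x) - (s - t)%:C%C * (f' (gam t x) * zeta x)).
    rewrite cintB; last 2 first.
    - by apply: cintegrB; exact: iN.
    - by apply: cintegrZ; exact: iJ.
    rewrite cintB; [|exact: iN|exact: iN].
    rewrite cintZ; last exact: iJ.
    rewrite [X in _ * X](@circle_deriv0 _ 1 f f' B) ?mulr0 ?subr0//.
    exact: pos.
  rewrite E.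
  have bd x : cabs ((f (gam s x) * q x - f (gam t x) * q x) - (s - t)%:C%C * (f' (gam t x) * zeta x))
     <= 4 * B * Q * (s - t) ^+ 2.
    have zz := zetaB_neq0 x hz.
    have dg : gam s x - gam t x = (s - t)%:C%C * (zeta x - z).
      by rewrite /gam !rmorphB /=; ring.
    rewrite (_ : _ - _ = (f (gam s x) - f (gam t x) - f' (gam t x) * (gam s x - gam t x)) * q x); last first.
      by rewrite dg /q; field.
    have h2 : cabs (zeta x - z) <= 2.
      by rewrite (le_trans (ler_cabsB _ _))// cabs_zeta; lra.
    rewrite cabsM [leRHS](_ : _ = B * (4 * (s - t) ^+ 2) * Q); last by ring.
    rewrite ler_pM//; apply: (le_trans (f1 _ _ (gle _ x ht) (gle _ x hs))).
    rewrite ler_wpM2l// dg cabsM cabsr exprMn real_normK ?num_real// mulrC.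
    rewrite ler_wpM2r ?sqr_ge0// (_ : 4 = 2 ^+ 2); last by ring.
    by rewrite lerXn2r ?nnegrE.
  have md : cmeas (fun x => (f (gam s x) * q x - f (gam t x) * q x) -
      (s - t)%:C%C * (f' (gam t x) * zeta x)).
    apply: cmeasB; first by apply: cmeasB; apply: cmeasM => //; exact: mf.
    apply: cmeasM; first exact: cmeas_cst.
    by apply: cmeasM; [exact: mf'|exact: cmeas_zeta].
  apply: (le_trans (cabs_cint_cst fin md bd)).
  rewrite (_ : fine _ = 1); last by have := lamT R => /= ->.
  by rewrite mulr1; lra.
have e0 : N 0 = f z * cint (lam R) q.
  rewrite -cintZ; last exact: cintegr_bounded qQ.
  apply: eq_cint => x; congr (f _ * _).
  by rewrite /gam subr0 rmorph1 rmorph0 mul1r mul0r addr0.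
rewrite -[RHS]e0 N01; apply: eq_cint => x; congr (f _ * _).
by rewrite /gam subrr rmorph1 rmorph0 mul1r mul0r add0r.
Qed.

Lemma mean_value f : hol 1 f -> cint (lam R) (fun x => f (zeta x)) = f 0.
Proof.
move=> hf; have := cauchy_aux hf (inD0 R).
under [X in X = _]eq_cint do rewrite subr0 divff ?zeta_neq0// mulr1.
by under [X in _ = _ * X]eq_cint do rewrite subr0 divff ?zeta_neq0//; rewrite cint_lam_cst mulr1.
Qed.

Lemma mulcJ z : z * (conjc z) = (csq z)%:C%C.
Proof. by case: z => a b; apply: eqC; rewrite ?ReM ?ImM /csq/=; ring. Qed.

Lemma cabsJ z : cabs (conjc z) = cabs z.
Proof. by case: z => a b; rewrite /cabs /csq /= sqrrN. Qed.

Lemma zetaJ x : conjc (zeta x) = (zeta x)^-1.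
Proof. by rewrite -zetaN zetaNE. Qed.

Lemma conjcM z w : conjc (z * w) = conjc z * conjc w.
Proof. exact: rmorphM. Qed.
Lemma conjcB z w : conjc (z - w) = conjc z - conjc w.
Proof. exact: rmorphB. Qed.

Lemma conj_kernel z x : inD z ->
  conjc (zeta x / (zeta x - z)) = (1 - conjc z * zeta x)^-1.
Proof.
move=> hz; have nz := zetaB_neq0 x hz; have z0 := zeta_neq0 x.
rewrite conjcM conjc_inv conjcB zetaJ -invfM; congr (_^-1).
by rewrite mulrBr mulfV// mulrC.
Qed.

Lemma hol_szego (a : R[i]) : inD a -> hol 1 (fun w => (1 - a * w)^-1).
Proof.
move=> ha; apply: (@holV _ 1 _ (1 - cabs a)) => //; first by rewrite subr_gt0.
- move=> w hw; rewrite -{1}(cabs1 R) (le_trans _ (ler_cabs_sub _ _))// lerD2l lerN2.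
  by rewrite cabsM ler_piMr.
- apply: eq_hol (holD (hol_cst 1 1) (holM ler01 (hol_cst 1 (- a)) (hol_id 1))) => w _.
  by rewrite mulNr.
Qed.

Lemma inDJ z : inD z -> inD (conjc z).
Proof. by rewrite /inD cabsJ. Qed.

Lemma cint_conj d (T : measurableType d) (mu : {measure set T -> \bar R}) (h : T -> R[i]) :
  cintegr mu h -> cint mu (fun x => conjc (h x)) = conjc (cint mu h).
Proof.
move=> [h1 h2]; apply: eqC => /=; first by apply: eq_Rintegral => x _; case: (h x).
rewrite -mulN1r -RintegralZl//; apply: eq_Rintegral => x _.
by rewrite mulN1r; case: (h x).
Qed.

(** On the circle the conjugate of the Cauchy kernel is [1 / (1 - conjc z * zeta x)]. This is
    holomorphic on the closed disc with value 1 at the origin, so the mean value property applies to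
    it. *)
Lemma cauchy_kernel_int z : inD z -> cint (lam R) (fun x => zeta x / (zeta x - z)) = 1.
Proof.
move=> hz; apply: (can_inj (@conjcK R)); rewrite -cint_conj; last first.
  apply: (cintegr_bounded (lamT_lty R) (cmeas_cauchy_kernel z)) => x.
  exact: cauchy_kernel_le.
under eq_cint do rewrite conj_kernel//.
rewrite (mean_value (hol_szego (inDJ hz))) mulr0 subr0 invr1.
by apply: eqC; rewrite /= ?oppr0.
Qed.

Lemma cauchy f z : hol 1 f -> inD z ->
  cint (lam R) (fun x => f (zeta x) * (zeta x / (zeta x - z))) = f z.
Proof. by move=> hf hz; rewrite cauchy_aux// cauchy_kernel_int// mulr1. Qed.

(** The second summand is the boundary function of a holomorphic function vanishing at 0. It
    integrates to 0 against holomorphic or Hardy functions, which reduces Poisson's formula to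
    Cauchy's. *)
Lemma poissonE z x : inD z -> (poisson z x)%:C%C =
  zeta x / (zeta x - z) + conjc z * zeta x / (1 - conjc z * zeta x).
Proof.
move=> hz; have nz := zetaB_neq0 x hz; have z0 := zeta_neq0 x.
have nz' : 1 - conjc z * zeta x != 0.
  rewrite -invr_eq0 -conj_kernel// conjc_eq0 mulf_neq0// invr_neq0//.
have -> : (poisson z x)%:C%C = (1 - z * conjc z) / ((zeta x - z) * ((zeta x)^-1 - conjc z)).
  rewrite /poisson rmorphM /= rmorphB rmorph1 fmorphV /= -!mulcJ.
  by rewrite conjcB zetaJ.
have -> : (zeta x)^-1 - conjc z = (1 - conjc z * zeta x) / zeta x.
  by rewrite mulrBl mulfK// mul1r.
by field; apply/and3P; split.
Qed.

Lemma poisson_gt0 z x : inD z -> 0 < poisson z x.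
Proof.
by move=> hz; rewrite divr_gt0 ?subr_gt0 ?inD_csq// csq_gt0// zetaB_neq0.
Qed.

Lemma poisson_ge0 z x : inD z -> 0 <= poisson z x.
Proof. by move=> hz; rewrite ltW// poisson_gt0. Qed.

Lemma poisson_le z x : inD z -> poisson z x <= ((1 - cabs z) ^+ 2)^-1.
Proof.
move=> hz; have hq := inD_csq hz.
have c0 : 0 < 1 - cabs z by rewrite subr_gt0.
rewrite -[leRHS]mul1r ler_pM ?subr_ge0 ?(ltW hq)// ?invr_ge0//.
  by rewrite gerBl.
rewrite lef_pV2 ?posrE ?exprn_gt0 ?csq_gt0 ?zetaB_neq0// -cabs_sqr.
by rewrite lerXn2r ?nnegrE ?(ltW c0)// zetaB_lb.
Qed.

Lemma measurable_poisson z : measurable_fun setT (poisson z).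
Proof.
apply: measurable_funM => //; apply: measurable_funV; apply: measurable_csq.
by apply: cmeasB; [exact: cmeas_zeta|exact: cmeas_cst].
Qed.

Lemma circle_meas f : hol 1 f -> cmeas (fun x => f (zeta x)) /\
  exists B, forall x, cabs (f (zeta x)) <= B.
Proof.
move=> /(holP ler01)[f' [B [B0 f1 f2 f3]]]; split; last first.
  by exists B => x; have [] := f2 (zeta x); rewrite ?cabs_zeta.
apply: eq_cmeas (@cmeas_circle _ f B 1 0 1 _ _ _ _) => //.
- by move=> x; rewrite add0r mul1r.
- by move=> v w hv hw; have [] := f3 _ _ hv hw.
- by rewrite cabs0 add0r.
Qed.

Lemma poisson_formula f z : hol 1 f -> inD z ->
  cint (lam R) (fun x => f (zeta x) * (poisson z x)%:C%C) = f z.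
Proof.
move=> hf hz; pose h w := f w * (conjc z * w * (1 - conjc z * w)^-1).
have hh : hol 1 h.
  apply: holM => //; apply: holM => //; last exact: hol_szego (inDJ hz).
  by apply: holM => //; [exact: hol_cst|exact: hol_id].
under eq_cint do rewrite poissonE// mulrDr.
have [mf [B fB]] := circle_meas hf; have [mh [K hK]] := circle_meas hh.
have fin := lamT_lty R.
rewrite cintD; last 2 first.
- apply: (cintegrM_bounded (B := (1 - cabs z)^-1)).
  + exact: cintegr_bounded fB.
  + exact: cmeas_cauchy_kernel.
  + by move=> x; exact: cauchy_kernel_le.
- exact: cintegr_bounded hK.
by rewrite cauchy// [X in _ + X](mean_value hh) /h mulr0 mul0r mulr0 addr0.
Qed.

Lemma poisson_int1 z : inD z -> \int[lam R]_x poisson z x = 1.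
Proof.
move=> hz; have := poisson_formula (hol_cst 1 1) hz.
under eq_cint do rewrite mul1r.
by rewrite cint_real => /(congr1 (fun w : R[i] => cRe w)).
Qed.

(** The distance [|zeta y - r * zeta x|] depends only on the angle between the two points.
    Exchanging their roles is what makes Fubini useful for smoothing. *)
Lemma poisson_sym (r : R) x y :
  poisson (r%:C%C * zeta x) y = poisson (r%:C%C * zeta y) x.
Proof.
rewrite /poisson !csqM !csq_zeta; congr (_ / _).
rewrite /csq !ReB !ImB !ReMr !ImMr /=.
have := cos2Dsin2 (2 * pi * x); have := cos2Dsin2 (2 * pi * y).
set a := cos _; set b := sin _; set c := cos _; set d := sin _ => h1 h2.
have -> : (a - r * c) ^+ 2 + (b - r * d) ^+ 2 = (a ^+ 2 + b ^+ 2) + r ^+ 2 * (c ^+ 2 + d ^+ 2) - 2 * r * (a * c + b * d) by ring.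
have -> : (c - r * a) ^+ 2 + (d - r * b) ^+ 2 = (c ^+ 2 + d ^+ 2) + r ^+ 2 * (a ^+ 2 + b ^+ 2) - 2 * r * (a * c + b * d) by ring.
by rewrite h1 h2.
Qed.

End Cauchy.

(** * Measurability of integrals that depend on a parameter *)

Section ParametricIntegral.
Context d1 d2 (T1 : measurableType d1) (T2 : measurableType d2) (R : realType).
Variable m2 : {finite_measure set T2 -> \bar R}.

Lemma measurable_Rintegral_param (g : T1 * T2 -> R) : measurable_fun setT g ->
  measurable_fun setT (fun x => \int[m2]_y g (x, y)).
Proof.
move=> mg; have mE : measurable_fun setT (EFin \o g) by exact/measurable_EFinP.
have mp := measurable_fun_fubini_tonelli_F (m2 := m2) _ (measurable_funepos mE) (fun x => funepos_ge0 _ x).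
have mn := measurable_fun_fubini_tonelli_F (m2 := m2) _ (measurable_funeneg mE) (fun x => funeneg_ge0 _ x).
have -> : (fun x => \int[m2]_y g (x, y)) =
   fun x => fine (fubini_F m2 (EFin \o g)^\+%E x - fubini_F m2 (EFin \o g)^\-%E x)%E.
  apply/funext => x; rewrite /Rintegral integralE /fubini_F.
  congr (fine (_ - _)).
    by apply: eq_integral => y _; rewrite !funeposE.
  by apply: eq_integral => y _; rewrite !funenegE.
have mf : measurable_fun setT (@fine R) by exact: fine_measurable.
have mB := emeasurable_funB (mp : measurable_fun setT (fubini_F m2 (EFin \o g)^\+%E))
  (mn : measurable_fun setT (fubini_F m2 (EFin \o g)^\-%E)).
exact: (measurableT_comp mf mB).
Qed.

Lemma cmeas_cint_param (g : T1 * T2 -> R[i]) : cmeas g ->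
  cmeas (fun x => cint m2 (fun y => g (x, y))).
Proof.
by move=> [m n]; split; [exact: (measurable_Rintegral_param m)|exact: (measurable_Rintegral_param n)].
Qed.

End ParametricIntegral.

(** * Poisson's formula from radial boundary values *)

Section RadialLimits.
Variable R : realType.
Implicit Types (f g : R[i] -> R[i]) (v w z : R[i]) (r : R).
Local Notation zeta := (@zeta R).

Definition rad (n : nat) : R := 1 - n.+2%:R^-1.

Lemma rad_bound n : 0 <= rad n < 1.
Proof.
by rewrite /rad subr_ge0 invf_le1 ?ltr0n// ler1n/= gtrBl invr_gt0 ltr0n.
Qed.

Lemma cvg_inv_nat2 : (fun n => n.+2%:R^-1 : R) @ \oo --> 0.
Proof.
have := @cvg_harmonic R; rewrite -cvg_shiftS; exact.
Qed.

Lemma cvg_radB : (fun n => 1 - rad n) @ \oo --> (0 : R).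
Proof.
rewrite (_ : (fun n => _) = (fun n => n.+2%:R^-1 : R)); first exact: cvg_inv_nat2.
by apply/funext => n; rewrite /rad opprB addrC subrK.
Qed.

Lemma inD_rad r z : 0 <= r < 1 -> cabs z <= 1 -> inD (r%:C%C * z).
Proof.
move=> /andP[r0 r1] hz; rewrite /inD cabsM cabsr ger0_norm//.
by apply: le_lt_trans r1; rewrite ler_piMr.
Qed.

Definition holD1 f := forall r, 0 <= r -> r < 1 -> hol r f.

Lemma holD1_continuous f z : holD1 f -> inD z ->
  ccvg (fun n => f ((rad n)%:C%C * z)) (f z).
Proof.
move=> hf hz; have [f' [B [B0 _ _ f3]]] := holP (cabs_ge0 z) (hf _ (cabs_ge0 z) hz).
apply: (@ccvg_le _ _ _ (fun n => B * (1 - rad n))); last first.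
  rewrite -(mulr0 B); apply: cvgM; [exact: cvg_cst|exact: cvg_radB].
move=> n; have /andP[r0 r1] := rad_bound n.
have h : cabs ((rad n)%:C%C * z) <= cabs z.
  by rewrite cabsM cabsr ger0_norm// ler_piMl// ltW.
apply: (le_trans (f3 _ _ (lexx _) h).1); rewrite ler_wpM2l//.
rewrite (_ : _ - z = (rad n - 1)%:C%C * z); last by apply: eqC; rewrite !cReImE /=; ring.
rewrite cabsM cabsr distrC ger0_norm ?subr_ge0 ?ler_piMr ?subr_ge0 ?(ltW r1)//.
exact: ltW.
Qed.

(** Each dilate [f (rad n * w)] is holomorphic on the closed disc and satisfies Poisson's formula.
    Dominated convergence with the bound [B] passes to the boundary values, which have to be radial
    limits only almost everywhere. *)
Lemma poisson_boundary f B z : holD1 f -> (forall w, inD w -> cabs (f w) <= B) ->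
  cmeas (fun x => f (zeta x)) ->
  {ae lam R, forall x, ccvg (fun n => f ((rad n)%:C%C * zeta x)) (f (zeta x))} ->
  inD z -> cint (lam R) (fun x => f (zeta x) * (poisson z x)%:C%C) = f z.
Proof.
move=> hf fB mf fl hz.
have fin := lamT_lty R.
have B0 : 0 <= B by exact: le_trans (cabs_ge0 _) (fB 0 (inD0 R)).
pose f_ n x := f ((rad n)%:C%C * zeta x) * (poisson z x)%:C%C.
pose M := ((1 - cabs z) ^+ 2)^-1.
have hn n : hol 1 (fun w => f ((rad n)%:C%C * w)).
  have /andP[r0 r1] := rad_bound n; apply: hol_scale => //; exact: hf.
have mP : cmeas (fun x => (poisson z x)%:C%C) by apply: cmeas_real; exact: measurable_poisson.
have c1 : ccvg (fun n => cint (lam R) (f_ n))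
   (cint (lam R) (fun x => f (zeta x) * (poisson z x)%:C%C)).
  apply: (ccvg_dct (g := fun=> B * M)) => //.
  - by move=> n; apply: cmeasM => //; have [] := circle_meas (hn n).
  - exact: cmeasM.
  - move: fl; apply: filterS => x [h1 h2]; split => /=.
      rewrite (_ : (fun n => _) = (fun n => cRe (f ((rad n)%:C%C * zeta x)) * poisson z x)).
        by rewrite ReM/= mulr0 subr0; apply: cvgM => //; exact: cvg_cst.
      by apply/funext => n; rewrite /f_ ReM/= mulr0 subr0.
    rewrite (_ : (fun n => _) = (fun n => cIm (f ((rad n)%:C%C * zeta x)) * poisson z x)).
      by rewrite ImM/= mulr0 add0r; apply: cvgM => //; exact: cvg_cst.
    by apply/funext => n; rewrite /f_ ImM/= mulr0 add0r.
  - exact: integrable_cst.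
  - move=> n x; rewrite cabsM ler_pM//; first by apply: fB; apply: inD_rad;
      rewrite ?rad_bound ?cabs_zeta.
    by rewrite cabsr ger0_norm ?poisson_ge0// poisson_le.
apply: (ccvg_unique c1).
rewrite (_ : (fun n => _) = (fun n => f ((rad n)%:C%C * z))).
  exact: holD1_continuous.
by apply/funext => n; exact: (poisson_formula (hn n)).
Qed.

End RadialLimits.

(** * Cauchy transforms of complex densities *)

Section CauchyTransform.
Variable R : realType.
Local Notation zeta := (@zeta R).
Variables (mu : {measure set R -> \bar R}) (h : R -> R[i]).
Hypothesis ih : cintegr mu h.

Lemma cmeas_zetaN : cmeas (fun x : R => zeta (- x)).
Proof.
apply: eq_cmeas (cmeasV (@cmeas_zeta R)) => x; by rewrite zetaN.
Qed.

Lemma szego_lb (r : R) (w : R[i]) x : cabs w <= r -> 1 - r <= cabs (1 - zeta (- x) * w).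
Proof.
move=> hw; apply: le_trans (ler_cabs_sub _ _).
by rewrite cabs1 cabsM cabs_zeta mul1r lerD2l lerN2.
Qed.

(** Differentiation under the integral sign with explicit remainder: the second-order remainder of
    [1 / (1 - zeta (- x) * w)] carries three such inverse factors, each at most [d^-1] on the disc
    of radius [r < 1]. *)
Lemma hol_cauchy_transform :
  holD1 (fun w => cint mu (fun x : R => h x * (1 - zeta (- x) * w)^-1)).
Proof.
move=> r r0 r1; pose d := 1 - r; have d0 : 0 < d by rewrite subr_gt0.
have mk w : cmeas (fun x : R => (1 - zeta (- x) * w)^-1).
  apply: cmeasV; apply: cmeasB; first exact: cmeas_cst.
  by apply: cmeasM; [exact: cmeas_zetaN|exact: cmeas_cst].
have ki w : cabs w <= r -> forall x : R, cabs ((1 - zeta (- x) * w)^-1) <= d^-1.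
  move=> hw x; rewrite cabsV lef_pV2 ?posrE//; first exact: szego_lb.
  exact: lt_le_trans d0 (szego_lb _ hw).
have nz w : cabs w <= r -> forall x : R, 1 - zeta (- x) * w != 0.
  by move=> hw x; apply: neq0_cabs; exact: lt_le_trans d0 (szego_lb _ hw).
pose k' v (x : R) := zeta (- x) * (1 - zeta (- x) * v)^-1 ^+ 2.
have mk' v : cmeas (k' v).
  by apply: cmeasM; [exact: cmeas_zetaN|exact: cmeasX].
have ki' w : cabs w <= r -> forall x : R, cabs (k' w x) <= d^-1 ^+ 2.
  move=> hw x; rewrite cabsM cabs_zeta mul1r cabsX lerXn2r ?nnegrE ?invr_ge0 ?(ltW d0)//.
  exact: ki.
have ih1 w : cabs w <= r -> cintegr mu (fun x : R => h x * (1 - zeta (- x) * w)^-1).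
  by move=> hw; apply: cintegrM_bounded (ki _ hw).
have ih2 w : cabs w <= r -> cintegr mu (fun x : R => h x * k' w x).
  by move=> hw; apply: cintegrM_bounded (ki' _ hw).
exists (fun v => cint mu (fun x : R => h x * k' v x)), (2 * (d^-1 ^+ 3 * \int[mu]_x cabs (h x))).
split.
  by rewrite !mulr_ge0 ?exprn_ge0 ?invr_ge0 ?(ltW d0)// Rintegral_ge0.
move=> v w hv hw.
rewrite mulrC -cintZ; last exact: ih2.
rewrite -cintB; [|exact: ih1|exact: ih1].
rewrite -cintB; [|by apply: cintegrB; exact: ih1|by apply: cintegrZ; exact: ih2].
have ig : mu.-integrable setT (EFin \o (fun x => (d^-1 ^+ 3 * cabs (w - v) ^+ 2) * cabs (h x))).
  apply: eq_integrable (integrableZl measurableT (d^-1 ^+ 3 * cabs (w - v) ^+ 2) (cintegr_cabs ih)) => //.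
apply: le_trans (cabs_cint _ ig _) _.
- by apply: cintegrB; [apply: cintegrB; exact: ih1|apply: cintegrZ; exact: ih2].
- move=> x; have nv := nz _ hv x; have nw := nz _ hw x.
  rewrite (_ : _ - _ = h x * (zeta (- x) ^+ 2 * (w - v) ^+ 2 *
     ((1 - zeta (- x) * w)^-1 * (1 - zeta (- x) * v)^-1 ^+ 2))); last first.
    by rewrite /k'; field; rewrite nv nw.
  have A1 := ki _ hw x; have A2 := ki _ hv x.
  move: A1 A2; set a := (_ - _ * w)^-1; set b := (_ - _ * v)^-1 => A1 A2.
  have -> : cabs (h x * (zeta (- x) ^+ 2 * (w - v) ^+ 2 * (a * b ^+ 2))) =
      cabs a * cabs b ^+ 2 * cabs (w - v) ^+ 2 * cabs (h x).
    by rewrite !expr2 !cabsM cabs_zeta; ring.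
  rewrite ler_wpM2r// ler_wpM2r ?exprn_ge0// [d^-1 ^+ 3]exprS ler_pM ?exprn_ge0//.
  by rewrite lerXn2r ?nnegrE ?invr_ge0 ?(ltW d0).
- rewrite RintegralZl//; last exact: cintegr_cabs.
  by rewrite (_ : 2 * (_ * _ * _) = 2 * (d^-1 ^+ 3 * \int[mu]_x cabs (h x)) * cabs (w - v) ^+ 2)//; ring.
Qed.

End CauchyTransform.

(** * The symbols, their boundary values and the kernel *)

Section Symbol.
Variable R : realType.
Local Notation zeta := (@zeta R).
Variable sg : {finite_measure set R -> \bar R}.
Implicit Types (A : set R) (z w : R[i]).

Lemma sg_lty : (sg setT < +oo)%E.
Proof. by rewrite ltey_eq fin_num_measure. Qed.

Definition herglotz (x : R) z := (zeta x + z) / (zeta x - z).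
(** The summand 1 is the Herglotz integral of Lebesgue measure, so [Fh A] is the Herglotz integral
    of [m] plus [sg] restricted to [A]. The same formula is read at points of the circle, where it
    supplies the boundary values. *)
Definition Fh A z : R[i] := 1 + cint sg (fun x : R => (\1_A x)%:C%C * herglotz x z).
Definition phih A z : R[i] := (Fh A z - 1) / (Fh A z + 1).

Lemma Re_herglotz x z : cRe (herglotz x z) = poisson z x.
Proof.
rewrite /herglotz ReM ReV ImV /poisson -(csq_zeta x) /csq !ReB !ImB !ReD !ImD.
by rewrite mulrCA mulrA mulNr -[X in _ = X]mulrC; ring.
Qed.

Lemma cmeas_herglotz z : cmeas (fun x : R => herglotz x z).
Proof.
apply: cmeasM; first by apply: cmeasD; [exact: cmeas_zeta|exact: cmeas_cst].
by apply: cmeasV; apply: cmeasB; [exact: cmeas_zeta|exact: cmeas_cst].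
Qed.

Lemma cmeas_fst (h : R -> R[i]) : cmeas h -> cmeas (fun xy : R * R => h xy.1).
Proof. by move=> [m n]; split; [exact: measurableT_comp m _|exact: measurableT_comp n _]. Qed.
Lemma cmeas_snd (h : R -> R[i]) : cmeas h -> cmeas (fun xy : R * R => h xy.2).
Proof. by move=> [m n]; split; [exact: measurableT_comp m _|exact: measurableT_comp n _]. Qed.

Lemma cmeas_indic A : measurable A -> cmeas (fun x : R => (\1_A x)%:C%C : R[i]).
Proof. by move=> mA; apply: cmeas_real; exact: measurable_indic. Qed.

Lemma indic_le1 A (x : R) : 0 <= (\1_A x : R) <= 1.
Proof. by rewrite indicE; case: (x \in A); rewrite /= ?lexx ?ler01. Qed.

(** Under this condition the Herglotz kernels over [A] are bounded by [2 / c] at [z]. It is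
    automatic inside the disc; on the circle it is the condition for a radial limit to exist. *)
Definition away A z (c : R) := 0 < c /\ forall x, A x -> c <= cabs (zeta x - z).

Lemma away_inD A z : inD z -> away A z (1 - cabs z).
Proof. by move=> hz; split; [rewrite subr_gt0|move=> x _; exact: zetaB_lb]. Qed.

Lemma herglotz_le A z c x : cabs z <= 1 -> away A z c ->
  cabs ((\1_A x)%:C%C * herglotz x z) <= 2 / c.
Proof.
move=> hz [c0 hc]; rewrite indicE; have [/set_mem Ax|nAx] := boolP (x \in A); last first.
  by rewrite /= rmorph0 mul0r cabs0 divr_ge0// ltW.
rewrite /= rmorph1 mul1r cabsM cabsV ler_pM ?invr_ge0//.
  by rewrite (le_trans (ler_cabsD _ _))// cabs_zeta -[2]/(1 + 1) lerD2l.
have h := hc _ Ax; rewrite lef_pV2 ?posrE//; exact: lt_le_trans c0 h.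
Qed.

Lemma cintegr_herglotz A z c : measurable A -> cabs z <= 1 -> away A z c ->
  cintegr sg (fun x : R => (\1_A x)%:C%C * herglotz x z).
Proof.
move=> mA hz hc; apply: (cintegr_bounded (B := 2 / c) sg_lty).
  by apply: cmeasM; [exact: cmeas_indic|exact: cmeas_herglotz].
by move=> x; exact: herglotz_le.
Qed.

Lemma Re_Fh A z : cRe (Fh A z) = 1 + \int[sg]_x (\1_A x * poisson z x).
Proof.
rewrite /Fh ReD /=; congr (_ + _); apply: eq_Rintegral => x _.
by rewrite ReMr Re_herglotz.
Qed.

Lemma poisson_circle t x : poisson (zeta t) x = 0.
Proof. by rewrite /poisson csq_zeta subrr mul0r. Qed.

(** The formula for the Poisson kernel vanishes identically on the circle, also at [x = t], where it
    reads [0 / 0 = 0]. Singularity of the measure enters through [arcA_good], which makes these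
    values radial limits almost everywhere. *)
Lemma Re_Fh_circle A t : cRe (Fh A (zeta t)) = 1.
Proof.
rewrite Re_Fh; under eq_Rintegral do rewrite poisson_circle mulr0.
by rewrite Rintegral_cst// mul0r addr0.
Qed.

Lemma Re_Fh_ge1 A z : cabs z <= 1 -> 1 <= cRe (Fh A z).
Proof.
move=> hz; rewrite Re_Fh lerDl Rintegral_ge0// => x _.
have /andP[i0 _] := indic_le1 A x; rewrite mulr_ge0// divr_ge0// subr_ge0.
by rewrite -cabs_sqr expr_le1.
Qed.

Lemma holD1_Fh A : measurable A -> holD1 (Fh A).
Proof.
move=> mA r r0 r1.
have i1 : cintegr sg (fun x : R => (\1_A x)%:C%C : R[i]).
  apply: (cintegr_bounded (B := 1) sg_lty); first exact: cmeas_indic.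
  by move=> x; rewrite cabsr; have /andP[a b] := indic_le1 A x; rewrite ger0_norm.
have h1 := hol_cauchy_transform i1 r0 r1.
(* [(zeta x + z) / (zeta x - z) = 2 / (1 - z / zeta x) - 1], so the Herglotz integral is twice a
   Cauchy transform minus a constant. *)
have h2 := holD (hol_cst r (1 - cint sg (fun x : R => (\1_A x)%:C%C)))
   (holM r0 (hol_cst r 2) h1).
apply: eq_hol h2 => z hz; rewrite /Fh -addrA; congr (1 + _).
have zD : inD z by exact: le_lt_trans r1.
have i2 : cintegr sg (fun x : R => (\1_A x)%:C%C * (1 - zeta (- x) * z)^-1 : R[i]).
  apply: (cintegrM_bounded (B := (1 - r)^-1) i1).
    apply: cmeasV; apply: cmeasB; first exact: cmeas_cst.
    by apply: cmeasM; [exact: cmeas_zetaN|exact: cmeas_cst].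
  have d0 : 0 < 1 - r by rewrite subr_gt0.
  move=> x; rewrite cabsV lef_pV2 ?posrE//; first exact: szego_lb.
  exact: lt_le_trans d0 (szego_lb _ hz).
rewrite -[X in _ + X]cintZ// addrC -cintB//; last exact: cintegrZ.
apply: eq_cint => x; rewrite /herglotz zetaN.
have nz := zetaB_neq0 x zD; have z0 := zeta_neq0 x.
by field; rewrite nz z0.
Qed.

Lemma cmeas_herglotz_circle A : measurable A ->
  cmeas (fun tx : R * R => (\1_A tx.2)%:C%C * herglotz tx.2 (zeta tx.1) : R[i]).
Proof.
move=> mA; have m1 := cmeas_fst (@cmeas_zeta R); have m2 := cmeas_snd (@cmeas_zeta R).
apply: cmeasM; first exact: (cmeas_snd (cmeas_indic mA)).
by apply: cmeasM; [exact: cmeasD|apply: cmeasV; exact: cmeasB].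
Qed.

Lemma cmeas_Fh_circle A : measurable A -> cmeas (fun t : R => Fh A (zeta t)).
Proof.
move=> mA; apply: cmeasD; first exact: cmeas_cst.
exact: cmeas_cint_param (cmeas_herglotz_circle mA).
Qed.

Lemma Fh_radial A t c : measurable A -> away A (zeta t) c ->
  ccvg (fun n => Fh A ((rad R n)%:C%C * zeta t)) (Fh A (zeta t)).
Proof.
move=> mA hc; have [c0 hc'] := hc; set S := fine (sg setT).
apply: (@ccvg_le _ _ _ (fun n => 2 * (4 / c ^+ 2 * S) * (1 - rad R n))); last first.
  by rewrite -(mulr0 (2 * (4 / c ^+ 2 * S))); apply: cvgM; [exact: cvg_cst|exact: cvg_radB].
move=> n; have /andP[r0 r1] := rad_bound R n; set r := rad R n in r0 r1 *.
have rD : inD (r%:C%C * zeta t) by apply: inD_rad; rewrite ?r0 ?cabs_zeta.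
have i1 := cintegr_herglotz mA (ltW rD) (away_inD A rD).
have z1 : cabs (zeta t) <= 1 by rewrite cabs_zeta.
have i2 := cintegr_herglotz mA z1 hc.
rewrite /Fh (_ : 1 + _ - _ = cint sg (fun x : R => (\1_A x)%:C%C * herglotz x (r%:C%C * zeta t)) -
   cint sg (fun x : R => (\1_A x)%:C%C * herglotz x (zeta t))); last by ring.
rewrite -cintB//.
have bd (x : R) : cabs ((\1_A x)%:C%C * herglotz x (r%:C%C * zeta t) -
    (\1_A x)%:C%C * herglotz x (zeta t)) <= 4 / c ^+ 2 * (1 - r).
  rewrite indicE; have [/set_mem Ax|nAx] := boolP (x \in A); last first.
    by rewrite /= rmorph0 !mul0r subr0 cabs0 mulr_ge0 ?subr_ge0 ?divr_ge0 ?exprn_ge0 ?(ltW r1) ?(ltW c0).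
  have h := hc' _ Ax; rewrite /= rmorph1 !mul1r.
  have n1 := zetaB_neq0 x rD.
  have n2 : zeta x - zeta t != 0 by apply: neq0_cabs; exact: lt_le_trans h.
  (* The distance to [zeta t] exceeds the distance to [r * zeta t] by at most [1 - r], which is
     itself at most the latter distance. *)
  have h2 : c / 2 <= cabs (zeta x - r%:C%C * zeta t).
    have k1 : 1 - r <= cabs (zeta x - r%:C%C * zeta t).
      apply: le_trans (zetaB_lb _ _); rewrite cabsM cabs_zeta cabsr mulr1 ger0_norm//.
    have := ler_cabsDB (r%:C%C * zeta t) (zeta x) (zeta t).
    have -> : r%:C%C * zeta t - zeta t = (r - 1)%:C%C * zeta t.
      by apply: eqC; rewrite !cReImE /=; ring.
    rewrite cabsM cabs_zeta cabsr mulr1 distrC ger0_norm ?subr_ge0 ?(ltW r1)//.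
    by move=> k2; rewrite ler_pdivrMr//; lra.
  rewrite (_ : _ - _ = 2 * zeta x * ((r - 1)%:C%C * zeta t) *
      ((zeta x - r%:C%C * zeta t)^-1 * (zeta x - zeta t)^-1)); last first.
    have -> : (r - 1)%:C%C = r%:C%C - 1 :> R[i] by apply: eqC; rewrite !cReImE /=; ring.
    by rewrite /herglotz; field; rewrite n1 n2.
  rewrite !cabsM !cabsV !cabs_zeta mulr1 !mulr1 cabsr distrC ger0_norm ?subr_ge0 ?(ltW r1)//.
  have -> : cabs (2 : R[i]) = 2 by rewrite (_ : 2 = (2:R)%:C%C) ?cabsr ?ger0_norm// rmorph_nat.
  have -> : 4 / c ^+ 2 * (1 - r) = 2 * (1 - r) * ((c / 2)^-1 * c^-1).
    by field; rewrite gt_eqF.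
  have c20 : 0 < c / 2 by rewrite divr_gt0.
  rewrite ler_wpM2l ?mulr_ge0 ?subr_ge0 ?(ltW r1)// ler_pM ?invr_ge0//.
    by rewrite lef_pV2 ?posrE//; exact: lt_le_trans h2.
  by rewrite lef_pV2 ?posrE//; exact: lt_le_trans h.
apply: (le_trans (cabs_cint_cst sg_lty (cintegr_cmeas (cintegrB i1 i2)) bd)).
by rewrite -/S; lra.
Qed.

Lemma Fh_add_lb A z (c : R[i]) : cabs z <= 1 -> 0 <= cRe c -> 1 <= cabs (Fh A z + c).
Proof.
move=> hz hc; apply: le_trans (ler_Re_cabs _); apply: le_trans (ler_norm _).
by rewrite ReD; have := Re_Fh_ge1 A hz; lra.
Qed.

Lemma cabs_invB_le (p q : R[i]) : 1 <= cabs p -> 1 <= cabs q ->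
  cabs (p^-1 - q^-1) <= cabs (p - q).
Proof.
move=> p1 q1; have p0 := lt_le_trans ltr01 p1; have q0 := lt_le_trans ltr01 q1.
have np := neq0_cabs p0; have nq := neq0_cabs q0.
rewrite (_ : _ - _ = - (p - q) * (p^-1 * q^-1)); last by field; rewrite np nq.
rewrite cabsM cabsN ler_piMr// cabsM !cabsV mulr_ile1 ?invr_ge0 ?invf_le1//.
Qed.

Section Boundary.
Variable A : set R.
Hypothesis mA : measurable A.
Hypothesis gd : {ae lam R, forall t, exists c, away A (zeta t) c}.

(** When [A] has positive mass, [Fh A] itself violates Poisson's formula: its boundary real part is
    1 and has lost that mass. The inverse is bounded by 1 because the real part of [Fh A + c] is at
    least 1, so almost everywhere radial limits suffice. *)
Lemma poisson_Fh_inv (c : R[i]) z : 0 <= cRe c -> inD z ->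
  cint (lam R) (fun t => (Fh A (zeta t) + c)^-1 * (poisson z t)%:C%C) = (Fh A z + c)^-1.
Proof.
move=> c0 hz; apply: (@poisson_boundary _ (fun w => (Fh A w + c)^-1) 1) => //.
- move=> r r0 r1; apply: (@holV _ _ _ 1) => //.
    by move=> w hw; apply: Fh_add_lb => //; rewrite (le_trans hw)// ltW.
  by apply: holD; [exact: holD1_Fh|exact: hol_cst].
- move=> w hw; rewrite cabsV invf_le1; first exact/Fh_add_lb/c0/ltW.
  exact: lt_le_trans ltr01 (Fh_add_lb _ (ltW hw) c0).
- by apply: cmeasV; apply: cmeasD; [exact: cmeas_Fh_circle|exact: cmeas_cst].
move: gd; apply: filterS => t [d hd]; have [u1 u2] := Fh_radial mA hd.
apply: (@ccvg_le _ _ _ (fun n => `|cRe (Fh A ((rad R n)%:C%C * zeta t)) - cRe (Fh A (zeta t))| +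
   `|cIm (Fh A ((rad R n)%:C%C * zeta t)) - cIm (Fh A (zeta t))|)).
  move=> n; have rD : inD ((rad R n)%:C%C * zeta t).
    by apply: inD_rad; rewrite ?rad_bound ?cabs_zeta.
  have z1 : cabs (zeta t) <= 1 by rewrite cabs_zeta.
  have l1 := Fh_add_lb A (ltW rD) c0; have l2 := Fh_add_lb A z1 c0.
  apply: le_trans (cabs_invB_le l1 l2) _; rewrite -ReB -ImB.
  by rewrite opprD addrACA subrr addr0; exact: ler_cabs_ReIm.
have aux (u : nat -> R) l : u @ \oo --> l -> (fun n => `|u n - l|) @ \oo --> (0 : R).
  move=> ul; rewrite -(normr0 R); apply: cvg_norm; rewrite -(subrr l).
  by apply: cvgB => //; exact: cvg_cst.
by rewrite -(addr0 0); apply: cvgD; exact: aux.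
Qed.

End Boundary.

Lemma csq_phih A z : 0 < cRe (Fh A z) ->
  csq (phih A z) = 1 - 4 * cRe (Fh A z) / csq (Fh A z + 1).
Proof.
rewrite /phih; case: (Fh A z) => a b /= a0; rewrite csqM csqV.
have : 0 < csq ((Complex a b : R[i]) + 1).
  by rewrite /csq /= addr0 ltr_pwDl ?sqr_ge0// exprn_gt0 ?addr_gt0.
rewrite /csq /= !addr0 oppr0 addr0 => h; field; exact: lt0r_neq0.
Qed.

Lemma phih_inD A z : cabs z <= 1 -> inD (phih A z).
Proof.
move=> hz; have h := Re_Fh_ge1 A hz; apply: csq_inD; rewrite csq_phih; last first.
  exact: lt_le_trans h.
rewrite gtrBl divr_gt0 ?mulr_gt0//; first exact: lt_le_trans h.
apply: csq_gt0; apply: neq0_cabs; apply: lt_le_trans ltr01 _.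
by apply: Fh_add_lb.
Qed.

Lemma poisson_phih A z a : cabs z <= 1 -> poisson (phih A z) a =
  4 * cRe (Fh A z) / csq ((zeta a - 1) * Fh A z + (zeta a + 1)).
Proof.
move=> hz; have h := Re_Fh_ge1 A hz; have h0 := lt_le_trans ltr01 h.
have nz : Fh A z + 1 != 0.
  by apply: neq0_cabs; apply: lt_le_trans ltr01 _; exact: Fh_add_lb.
rewrite /poisson csq_phih// opprB addrC subrK.
have -> : zeta a - phih A z = ((zeta a - 1) * Fh A z + (zeta a + 1)) / (Fh A z + 1).
  by rewrite /phih; field.
have q0 := csq_gt0 nz.
rewrite csqM csqV invfM invrK mulrA -mulrA [X in _ * X]mulrC mulrA divfK//.
exact: lt0r_neq0.
Qed.

Definition kk A a t := poisson (phih A (zeta t)) a.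

Lemma zeta_le1 t : cabs (zeta t) <= 1. Proof. by rewrite cabs_zeta. Qed.

Lemma phih_circle_inD A t : inD (phih A (zeta t)).
Proof. exact/phih_inD/zeta_le1. Qed.

Lemma kk_ge0 A a t : 0 <= kk A a t.
Proof. exact/poisson_ge0/phih_circle_inD. Qed.

Lemma cmeas_phih_circle A : measurable A -> cmeas (fun t : R => phih A (zeta t)).
Proof.
move=> mA; have m1 := cmeas_Fh_circle mA; apply: cmeasM.
  by apply: cmeasB => //; exact: cmeas_cst.
by apply: cmeasV; apply: cmeasD => //; exact: cmeas_cst.
Qed.

Lemma measurable_kk A : measurable A -> measurable_fun setT (fun at_ : R * R => kk A at_.1 at_.2).
Proof.
move=> mA; have m1 := cmeas_fst (@cmeas_zeta R); have m2 := cmeas_snd (cmeas_phih_circle mA).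
apply: measurable_funM.
  by apply: measurable_funB => //; exact: measurable_csq.
by apply: measurable_funV; apply: measurable_csq; exact: cmeasB.
Qed.

Lemma measurable_kkr A a : measurable A -> measurable_fun setT (kk A a).
Proof.
move=> /measurable_kk mk; have := measurableT_comp mk (@pair1_measurable _ _ R R a).
exact.
Qed.

(** With real part 1 on the circle, the kernel depends on [t] only through [K = Im F], by the
    inverse of a positive quadratic polynomial in [K]. Stability under perturbations of [K] is read
    off from this form. *)
Lemma kkE A a t : kk A a t =
  2 / (2 - 2 * cIm (Fh A (zeta t)) * cIm (zeta a) + cIm (Fh A (zeta t)) ^+ 2 * (1 - cRe (zeta a))).
Proof.
rewrite /kk poisson_phih ?zeta_le1// Re_Fh_circle mulr1; have := Re_Fh_circle A t.
case: (Fh A (zeta t)) => u K /= ->; have := csq_zeta a; rewrite /csq /=.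
set c := cos _; set s := sin _ => h.
(* [c ^+ 2 + s ^+ 2] is left unsimplified so that the identity is polynomial in [K], [c] and [s];
   only afterwards is it replaced by 1. *)
rewrite (_ : (_ ^+ 2 + _) = 2 * (2 * (c ^+ 2 + s ^+ 2) - 2 * K * s +
  K ^+ 2 * ((1 + (c ^+ 2 + s ^+ 2)) / 2 - c))); last by field.
rewrite h (_ : (1 + 1) / 2 = 1 :> R); last by field.
by rewrite mulr1 invfM mulrA; congr (_ / _); field.
Qed.

End Symbol.

(** * The Poisson identity of the kernel and its marginals *)

Section Kernel.
Variable R : realType.
Local Notation zeta := (@zeta R).
Variable sg : {finite_measure set R -> \bar R}.
Implicit Types (A : set R) (z w : R[i]).
Local Notation Fh := (Fh sg).
Local Notation phih := (phih sg).
Local Notation kk := (kk sg).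

Lemma csq_two : csq (1 + 1 : R[i]) = 4.
Proof. by rewrite /csq /= addr0 expr0n addr0; ring. Qed.

Lemma kk_one A a t : zeta a = 1 -> kk A a t = 1.
Proof.
move=> ha; rewrite /kk poisson_phih ?zeta_le1// Re_Fh_circle ha subrr mul0r add0r.
by rewrite mulr1 csq_two divff.
Qed.

(** A Cayley transform, imaginary on the circle, chosen so that [(al - 1) * F + (al + 1) = (al - 1)
    * (F + cay al)]. It brings the kernel to the form [1 / (F + c)] handled by [poisson_Fh_inv]. *)
Definition cay (al : R[i]) : R[i] := (al + 1) / (al - 1).

Lemma Re_cay a : cRe (cay (zeta a)) = 0.
Proof.
rewrite /cay ReM ReV ImV !(ReD, ImD, ReN, ImN, Re1, Im1) oppr0 addr0.
set q := csq _; rewrite (_ : _ - _ = (csq (zeta a) - 1) / q).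
  by rewrite csq_zeta subrr mul0r.
by rewrite /csq; ring.
Qed.

Lemma csq_cay A z a : zeta a != 1 -> csq ((zeta a - 1) * Fh A z + (zeta a + 1)) =
  csq (zeta a - 1) * csq (Fh A z + cay (zeta a)).
Proof.
move=> ha; rewrite -csqM; congr csq; rewrite /cay; field.
by rewrite subr_eq0.
Qed.

Lemma poisson_phih_inv A z a : cabs z <= 1 -> zeta a != 1 ->
  poisson (phih A z) a = 4 / csq (zeta a - 1) * cRe (Fh A z + cay (zeta a))^-1.
Proof.
move=> hz ha; rewrite poisson_phih// csq_cay// ReV (ReD (Fh A z)) Re_cay addr0.
by rewrite invfM; ring.
Qed.

(** The bound degenerates as [zeta a] approaches 1, which is what makes estimates uniform in [a]
    delicate. *)
Lemma kk_le A a t : zeta a != 1 -> kk A a t <= 4 / csq (zeta a - 1).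
Proof.
move=> ha; have q0 : 0 < csq (zeta a - 1) by apply: csq_gt0; rewrite subr_eq0.
rewrite /kk poisson_phih_inv ?zeta_le1//.
rewrite ler_piMr ?divr_ge0 ?(ltW q0)// ReV (ReD (Fh A (zeta t))) Re_Fh_circle Re_cay addr0.
have h : 1 <= cabs (Fh A (zeta t) + cay (zeta a)).
  by apply: Fh_add_lb; rewrite ?zeta_le1// Re_cay.
rewrite mul1r invf_le1 -cabs_sqr ?exprn_ege1//.
by rewrite exprn_gt0//; exact: lt_le_trans h.
Qed.

Lemma kk_bounded A a : exists B, forall t, kk A a t <= B.
Proof.
have [ha|ha] := eqVneq (zeta a) 1.
  by exists 1 => t; rewrite kk_one.
by exists (4 / csq (zeta a - 1)) => t; exact: kk_le.
Qed.

Lemma integrable_poisson (mu : {measure set R -> \bar R}) z : (mu setT < +oo)%E ->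
  inD z -> mu.-integrable setT (EFin \o poisson z).
Proof.
move=> fin hz; apply: measurable_bounded_integrable => //.
  exact: measurable_poisson.
exists (((1 - cabs z) ^+ 2)^-1); split; first exact: num_real.
move=> y hy x _ /=; rewrite ger0_norm ?poisson_ge0//.
exact: le_trans (poisson_le x hz) (ltW hy).
Qed.

Lemma integrable_kkr A a (mu : {measure set R -> \bar R}) : (mu setT < +oo)%E ->
  measurable A -> mu.-integrable setT (EFin \o kk A a).
Proof.
move=> fin mA; apply: measurable_bounded_integrable => //.
  exact: measurable_kkr.
have [B hB] := kk_bounded A a; exists B; split; first exact: num_real.
move=> y hy x _ /=; rewrite ger0_norm ?kk_ge0//.
exact: le_trans (hB x) (ltW hy).
Qed.

(** For [zeta a != 1] this is the real part of Poisson's formula for [1 / (F + cay (zeta a))]. At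
    [zeta a = 1] the kernel is identically 1 and the left side is the real part of [F] at [z], whose
    singular part is the second term. In other words, the Aleksandrov-Clark measures of the symbol
    are absolutely continuous except possibly the one at 1. *)
Lemma kernel_poisson A z a : measurable A ->
  {ae lam R, forall t, exists c, away A (zeta t) c} -> inD z ->
  poisson (phih A z) a = \int[lam R]_t (poisson z t * kk A a t) +
    (zeta a == 1)%:R * \int[sg]_x (\1_A x * poisson z x).
Proof.
move=> mA gd hz; have z1 := ltW hz; have [ha|ha] := eqVneq (zeta a) 1.
  rewrite mul1r; under eq_Rintegral do rewrite kk_one// mulr1.
  rewrite poisson_int1// poisson_phih// ha subrr mul0r add0r -Re_Fh.
  by rewrite csq_two [4 * _]mulrC mulfK.
rewrite mul0r addr0 poisson_phih_inv//.
have c0 : 0 <= cRe (cay (zeta a)) by rewrite Re_cay.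
have E := congr1 (fun w => cRe w) (poisson_Fh_inv sg mA gd c0 hz).
have [I _] : cintegr (lam R) (fun t => (Fh A (zeta t) + cay (zeta a))^-1 * (poisson z t)%:C%C).
  apply: (cintegr_bounded (B := ((1 - cabs z) ^+ 2)^-1) (lamT_lty R)).
    apply: cmeasM; last by apply: cmeas_real; exact: measurable_poisson.
    by apply: cmeasV; apply: cmeasD; [exact: cmeas_Fh_circle|exact: cmeas_cst].
  move=> t; have l1 := Fh_add_lb sg A (zeta_le1 t) c0.
  rewrite cabsM cabsr ger0_norm ?poisson_ge0// -[leRHS]mul1r ler_pM ?poisson_ge0 ?poisson_le//.
  by rewrite cabsV invf_le1//; exact: lt_le_trans l1.
rewrite -[X in _ * X = _]E -(RintegralZl _ measurableT I); apply: eq_Rintegral => t _.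
by rewrite /kk poisson_phih_inv ?zeta_le1// ReM /= mulr0 subr0; ring.
Qed.

Lemma holD1_phih A : measurable A -> holD1 (phih A).
Proof.
move=> mA r r0 r1; apply: holM => //.
  by apply: holD; [exact: holD1_Fh|exact: hol_cst].
apply: (@holV _ _ _ 1) => //.
  by move=> w hw; apply: Fh_add_lb => //; rewrite (le_trans hw)// ltW.
by apply: holD; [exact: holD1_Fh|exact: hol_cst].
Qed.

Lemma analytic_phih A : measurable A -> analytic_self_map (phih A).
Proof.
move=> mA; split=> [z /ltW|z hz]; first exact: phih_inD.
(* Midway between [|z|] and 1, so that small increments stay in a closed disc on which the symbol
   has a quadratic remainder. *)
pose r := (1 + cabs z) / 2; have r0 : 0 <= r by rewrite divr_ge0 ?addr_ge0.
have r1 : r < 1 by rewrite /r ltr_pdivrMr// mul1r; have := hz; rewrite /inD; lra.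
have [f' [C [C0 h]]] := holD1_phih mA r0 r1.
exists (f' z) => e e0; pose d := Num.min ((1 - cabs z) / 2) (e / (C + 1)).
have C1 : 0 < C + 1 by rewrite ltr_wpDl.
exists d; split.
  by rewrite lt_min divr_gt0 ?subr_gt0//= divr_gt0.
move=> k k0; rewrite lt_min => /andP[k1 k2]; have kp := cabs_gt0 k0.
have zr : cabs z <= r by rewrite /r; have := hz; rewrite /inD; lra.
have zkr : cabs (z + k) <= r by apply: (le_trans (ler_cabsD _ _)); rewrite /r; lra.
have := h _ _ zr zkr; rewrite (_ : z + k - z = k) => [H|]; last by rewrite addrC addKr.
rewrite (_ : _ - _ = (phih A (z + k) - phih A z - f' z * k) * k^-1); last by field.
rewrite cabsM cabsV ltr_pdivrMr// (le_lt_trans H)// expr2 mulrA ltr_pM2r//.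
move: k2; rewrite ltr_pdivlMr// mulrC => k2; apply: le_lt_trans k2.
by rewrite ler_wpM2r// lerDl.
Qed.

Definition mass A : R := fine (sg A).

Lemma Rintegral_indic (mu : {finite_measure set R -> \bar R}) A : measurable A ->
  \int[mu]_x (\1_A x) = fine (mu A).
Proof. by move=> mA; rewrite /Rintegral integral_indic// setIT. Qed.

Lemma Fh0 A : measurable A -> Fh A 0 = (1 + mass A)%:C%C.
Proof.
move=> mA; rewrite /Fh.
rewrite (_ : cint sg _ = cint sg (fun x : R => (\1_A x)%:C%C)).
  by rewrite cint_real Rintegral_indic// rmorphD.
by apply: eq_cint => x; rewrite /herglotz addr0 subr0 divff ?mulr1// zeta_neq0.
Qed.

Lemma mass_ge0 A : 0 <= mass A. Proof. exact: fine_ge0. Qed.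

Lemma poisson_phih0 A a : measurable A -> poisson (phih A 0) a =
  2 * (1 + mass A) / (2 + mass A * (2 + mass A) * (1 - cRe (zeta a))).
Proof.
move=> mA; rewrite poisson_phih ?cabs0// Fh0//=.
have := csq_zeta a; rewrite /csq /=; set c := cos _; set s := sin _ => h.
set m := mass A.
rewrite (_ : (_ ^+ 2 + _) = 2 * (1 + (c ^+ 2 + s ^+ 2) + m * (2 + m) * ((1 + (c ^+ 2 + s ^+ 2)) / 2 - c) + (c ^+ 2 + s ^+ 2 - 1) * (1 + m)));
  last by field.
rewrite h subrr mul0r addr0 (_ : (1 + 1) / 2 = 1 :> R); last by field.
by rewrite invfM mulrA; congr (_ / _); field.
Qed.

Lemma poisson0 t : poisson 0 t = 1 :> R.
Proof. by rewrite /poisson csq0 !subr0 csq_zeta divr1. Qed.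

Lemma Re_zeta_le1 a : cRe (zeta a) <= 1.
Proof. exact: le_trans (ler_norm _) (le_trans (ler_Re_cabs _) (zeta_le1 _)). Qed.

Lemma poisson_phih0_le A a : measurable A -> poisson (phih A 0) a <= 1 + mass A.
Proof.
move=> mA; rewrite poisson_phih0//; have m0 := mass_ge0 A.
have c0 : 0 <= 1 - cRe (zeta a) by rewrite subr_ge0 Re_zeta_le1.
have d0 : 0 <= mass A * (2 + mass A) * (1 - cRe (zeta a)).
  by rewrite !mulr_ge0// addr_ge0.
rewrite ler_pdivrMr ?ltr_wpDr// mulrC ler_wpM2l ?addr_ge0//.
by rewrite lerDl.
Qed.

(** The case [z = 0] of [kernel_poisson]. The right side depends on [A] only through [mass sg A],
    which is what makes Scheffe's trick work. *)
Lemma kk_mass A a : measurable A ->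
  {ae lam R, forall t, exists c, away A (zeta t) c} ->
  \int[lam R]_t kk A a t + (zeta a == 1)%:R * mass A = poisson (phih A 0) a.
Proof.
move=> mA gd; rewrite (kernel_poisson a mA gd (inD0 R)); congr (_ + _ * _).
  by apply: eq_Rintegral => t _; rewrite poisson0 mul1r.
by rewrite /mass -Rintegral_indic//; apply: eq_Rintegral => t _; rewrite poisson0 mulr1.
Qed.

Lemma kk_mass_le A a : measurable A ->
  {ae lam R, forall t, exists c, away A (zeta t) c} ->
  \int[lam R]_t kk A a t <= 1 + mass A.
Proof.
move=> mA gd; apply: le_trans (poisson_phih0_le a mA); rewrite -kk_mass// lerDl.
by rewrite mulr_ge0// mass_ge0.
Qed.

(** With [kk_mass_le] this forms the pair of marginal bounds for Schur's test. *)
Lemma kk_int_dual A t : \int[lam R]_a kk A a t = 1.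
Proof. exact/poisson_int1/phih_circle_inD. Qed.

End Kernel.

(** * Poisson integrals determine integrals of Lipschitz functions *)

Section PoissonUniqueness.
Variable R : realType.
Local Notation zeta := (@zeta R).

Lemma integrable_bounded_real d (T : measurableType d) (mu : {measure set T -> \bar R})
  (h : T -> R) (M : R) : (mu setT < +oo)%E -> measurable_fun setT h ->
  (forall x, `|h x| <= M) -> mu.-integrable setT (EFin \o h).
Proof.
move=> fin mh hM; apply: measurable_bounded_integrable => //.
exists M; split; [exact: num_real|move=> y hy x _; exact: le_trans (hM x) (ltW hy)].
Qed.

Lemma zeta_lipschitz_measurable (h : R -> R) (L : R) : 0 <= L ->
  (forall x y, `|h x - h y| <= L * cabs (zeta x - zeta y)) -> measurable_fun setT h.
Proof.
move=> L0 hL; apply: (@lipschitz_measurable _ _ (L * (2 * pi))) => x y.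
apply: (le_trans (hL x y)); rewrite -mulrA ler_wpM2l//; exact: zeta_lip.
Qed.

(* With e^2 = 1 - r^2 and q = |zeta t - r zeta x|, the kernel is P = e^2/q^2 and
   P |zeta t - zeta x| <= 2 e^2/q = 2 e sqrt P <= e (1 + P). *)
Lemma poisson_approx (h : R -> R) (L M e : R) x : 0 <= L -> 0 < e -> e < 1 ->
  (forall x y, `|h x - h y| <= L * cabs (zeta x - zeta y)) ->
  (forall x, `|h x| <= M) ->
  `|\int[lam R]_t (poisson ((Num.sqrt (1 - e ^+ 2))%:C%C * zeta t) x * h t) - h x| <= 2 * L * e.
Proof.
move=> L0 e0 e1 hL hM; set r := Num.sqrt _.
have fin := lamT_lty R.
have er : r ^+ 2 = 1 - e ^+ 2.
  by rewrite sqr_sqrtr// subr_ge0 expr_le1// ltW.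
have r0 : 0 <= r by exact: sqrtr_ge0.
have r1 : r < 1 by rewrite -(@expr_lt1 _ 2)// er gtrBl exprn_gt0.
have rD : inD (r%:C%C * zeta x) by apply: inD_rad; rewrite ?r0 ?cabs_zeta.
have mh := zeta_lipschitz_measurable L0 hL.
have iP := integrable_poisson fin rD.
have P0 t := poisson_ge0 t rD.
have M0 : 0 <= M by exact: le_trans (hM 0).
have iPh : (lam R).-integrable setT (EFin \o (fun t => poisson (r%:C%C * zeta x) t * h t)).
  apply: (@integrable_bounded_real _ _ _ _ (((1 - cabs (r%:C%C * zeta x)) ^+ 2)^-1 * M)) => //.
    by apply: measurable_funM => //; exact: measurable_poisson.
  by move=> t; rewrite normrM ler_pM// ger0_norm// poisson_le.
under eq_Rintegral do rewrite poisson_sym.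
have iPc : (lam R).-integrable setT (EFin \o (fun t => poisson (r%:C%C * zeta x) t * h x)).
  by apply: eq_integrable (integrableZr measurableT (h x) iP) => // t _.
rewrite -[X in _ - X]mul1r -(poisson_int1 rD) -RintegralZr// -RintegralB//.
apply: (le_trans (le_normr_Rintegral _ _)) => //.
  by apply: eq_integrable (integrableB measurableT iPh iPc) => // t _.
have i1 := integrable_cst 1 fin.
have iD : (lam R).-integrable setT (EFin \o (fun t => L * e * (1 + poisson (r%:C%C * zeta x) t))).
  apply: eq_integrable (integrableZl measurableT (L * e) (integrableD measurableT i1 iP)) => //.
apply: (@le_trans _ _ (\int[lam R]_t (L * e * (1 + poisson (r%:C%C * zeta x) t)))).
  apply: le_Rintegral => //.
    apply: integrable_norm.
    by apply: eq_integrable (integrableB measurableT iPh iPc) => // t _.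
  move=> t _; rewrite -mulrBr normrM ger0_norm//.
  apply: (@le_trans _ _ (poisson (r%:C%C * zeta x) t * (L * cabs (zeta t - zeta x)))).
    by rewrite ler_wpM2l.
  rewrite mulrCA -mulrA ler_wpM2l//.
  have nz := zetaB_neq0 t rD; have q0 := cabs_gt0 nz.
  have -> : poisson (r%:C%C * zeta x) t = e ^+ 2 / cabs (zeta t - r%:C%C * zeta x) ^+ 2.
    rewrite /poisson cabs_sqr csqM csq_zeta mulr1; congr (_ / _).
    by rewrite /csq /= expr0n addr0 er opprB addrC subrK.
  move: q0 nz; set q := cabs _ => q0 _.
  have h2 : cabs (zeta t - zeta x) <= 2 * q.
    have k1 : 1 - r <= q.
      by apply: le_trans (zetaB_lb _ _); rewrite cabsM cabs_zeta cabsr mulr1 ger0_norm.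
    have := ler_cabsDB (r%:C%C * zeta x) (zeta t) (zeta x); rewrite -/q.
    have -> : r%:C%C * zeta x - zeta x = (r - 1)%:C%C * zeta x.
      by apply: eqC; rewrite !cReImE /=; ring.
    rewrite cabsM cabs_zeta cabsr mulr1 distrC ger0_norm ?subr_ge0 ?(ltW r1)//.
    by lra.
  apply: (@le_trans _ _ (e ^+ 2 / q ^+ 2 * (2 * q))).
    by rewrite ler_wpM2l// divr_ge0// exprn_ge0// ltW.
  rewrite -subr_ge0 (_ : _ - _ = e * (1 - e / q) ^+ 2); last first.
    by field; rewrite gt_eqF.
  by rewrite mulr_ge0 ?sqr_ge0// ltW.
have i1R : (lam R).-integrable setT (EFin \o cst 1) by [].
rewrite RintegralZl//; last first.
  by apply: eq_integrable (integrableD measurableT i1 iP) => // t _.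
rewrite RintegralD// poisson_int1// Rintegral_cst//.
rewrite (_ : fine _ = 1); last by have := lamT R => /= ->.
by rewrite mulr1 -(natrD _ 1 1) mulrC mulrA.
Qed.

Lemma RFubini d1 d2 (T1 : measurableType d1) (T2 : measurableType d2)
  (m1 : {finite_measure set T1 -> \bar R}) (m2 : {finite_measure set T2 -> \bar R})
  (f : T1 * T2 -> R) :
  (m1 \x m2)%E.-integrable setT (EFin \o f) ->
  (forall x, m2.-integrable setT (fun y => (f (x, y))%:E)) ->
  (forall y, m1.-integrable setT (fun x => (f (x, y))%:E)) ->
  \int[m1]_x \int[m2]_y f (x, y) = \int[m2]_y \int[m1]_x f (x, y).
Proof.
move=> fi f1 f2; have := Fubini fi; rewrite /Rintegral => E; congr fine.
transitivity (\int[m1]_x \int[m2]_y (EFin \o f) (x, y))%E.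
  by apply: eq_integral => x _; rewrite fineK//; exact: integrable_fin_num.
by rewrite E; apply: eq_integral => y _; rewrite fineK//; exact: integrable_fin_num.
Qed.

Lemma prod_lty d1 d2 (T1 : measurableType d1) (T2 : measurableType d2)
  (m1 : {finite_measure set T1 -> \bar R}) (m2 : {finite_measure set T2 -> \bar R}) :
  ((m1 \x m2)%E setT < +oo)%E.
Proof.
rewrite -setXTT product_measure1E// -ge0_fin_numE ?mule_ge0//.
by rewrite fin_numM// fin_num_measure.
Qed.

Lemma RFubini_bounded d1 d2 (T1 : measurableType d1) (T2 : measurableType d2)
  (m1 : {finite_measure set T1 -> \bar R}) (m2 : {finite_measure set T2 -> \bar R})
  (f : T1 * T2 -> R) (M : R) : measurable_fun setT f -> (forall xy, `|f xy| <= M) ->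
  \int[m1]_x \int[m2]_y f (x, y) = \int[m2]_y \int[m1]_x f (x, y).
Proof.
move=> mf fM; apply: RFubini.
- by apply: integrable_bounded_real fM => //; exact: prod_lty.
- move=> x; apply: (@integrable_bounded_real _ _ _ (fun y => f (x, y)) M) => //.
    by rewrite ltey_eq fin_num_measure.
  exact: (measurableT_comp mf (pair1_measurable x)).
- move=> y; apply: (@integrable_bounded_real _ _ _ (fun x => f (x, y)) M) => //.
    by rewrite ltey_eq fin_num_measure.
  exact: (measurableT_comp mf (pair2_measurable y)).
Qed.

Lemma measurable_poisson_joint (r : R) :
  measurable_fun setT (fun tx : R * R => poisson (r%:C%C * zeta tx.1) tx.2).
Proof.
have m1 := cmeas_fst (@cmeas_zeta R); have m2 := cmeas_snd (@cmeas_zeta R).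
have m3 : cmeas (fun tx : R * R => r%:C%C * zeta tx.1).
  by apply: cmeasM => //; exact: cmeas_cst.
apply: measurable_funM.
  by apply: measurable_funB => //; exact: measurable_csq.
by apply: measurable_funV; apply: measurable_csq; exact: cmeasB.
Qed.

Variables mu nu : {finite_measure set R -> \bar R}.
Hypothesis mn : forall z, inD z -> \int[mu]_x poisson z x = \int[nu]_x poisson z x.

(** By Fubini, the integral of the Poisson means of [h] against a measure involves only the Poisson
    integral of that measure, which is common to [mu] and [nu]. [poisson_approx] passes from [h] to
    its means at the price of [2 * L * e]. *)
Lemma eq_Rintegral_lipschitz (h : R -> R) (L M : R) : 0 <= L ->
  (forall x y, `|h x - h y| <= L * cabs (zeta x - zeta y)) ->
  (forall x, `|h x| <= M) -> \int[mu]_x h x = \int[nu]_x h x.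
Proof.
move=> L0 hL hM; have mh := zeta_lipschitz_measurable L0 hL.
have M0 : 0 <= M by exact: le_trans (hM 0).
pose hr e x := \int[lam R]_t (poisson ((Num.sqrt (1 - e ^+ 2))%:C%C * zeta t) x * h t).
have ih (m : {finite_measure set R -> \bar R}) : m.-integrable setT (EFin \o h).
  by apply: integrable_bounded_real hM => //; exact: sg_lty.
have key (m : {finite_measure set R -> \bar R}) e : 0 < e -> e < 1 ->
  `|\int[m]_x h x - \int[lam R]_t (h t * \int[m]_x poisson ((Num.sqrt (1 - e ^+ 2))%:C%C * zeta t) x)|
   <= 2 * L * e * fine (m setT).
  move=> e0 e1; set r := Num.sqrt _.
  have er : r ^+ 2 = 1 - e ^+ 2 by rewrite sqr_sqrtr// subr_ge0 expr_le1// ltW.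
  have r0 : 0 <= r by exact: sqrtr_ge0.
  have r1 : r < 1 by rewrite -(@expr_lt1 _ 2)// er gtrBl exprn_gt0.
  have rD t : inD (r%:C%C * zeta t) by apply: inD_rad; rewrite ?r0 ?cabs_zeta.
  pose B := ((1 - r) ^+ 2)^-1.
  have PB t x : poisson (r%:C%C * zeta t) x <= B.
    by apply: (le_trans (poisson_le x (rD t))); rewrite cabsM cabs_zeta cabsr mulr1 ger0_norm.
  have mj : measurable_fun setT (fun tx : R * R => poisson (r%:C%C * zeta tx.1) tx.2 * h tx.1).
    apply: measurable_funM; first exact: measurable_poisson_joint.
    exact: measurableT_comp mh _.
  have bj tx : `|poisson (r%:C%C * zeta tx.1) tx.2 * h tx.1| <= B * M.
    by rewrite normrM ler_pM// ger0_norm ?poisson_ge0.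
  have -> : \int[lam R]_t (h t * \int[m]_x poisson (r%:C%C * zeta t) x) = \int[m]_x hr e x.
    rewrite /hr -/r -(@RFubini_bounded _ _ _ _ (lam R) m
      (fun tx : R * R => poisson (r%:C%C * zeta tx.1) tx.2 * h tx.1) (B * M) mj bj) /=.
    apply: eq_Rintegral => t _; rewrite mulrC RintegralZr//.
    exact: integrable_poisson (sg_lty m) (rD t).
  have ihr : m.-integrable setT (EFin \o hr e).
    apply: (@integrable_bounded_real _ _ _ _ (2 * L * e + M)).
    - exact: sg_lty.
    - pose g xt := poisson (r%:C%C * zeta xt.2) xt.1 * h xt.2.
      have mg : measurable_fun setT (g : R * R -> R).
        exact: measurableT_comp mj (@measurable_swap _ _ R R).
      exact: (measurable_Rintegral_param (lam R) mg).
    - move=> x; rewrite -(subrK (h x) (hr e x)) (le_trans (ler_normD _ _))// lerD//.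
      exact: poisson_approx hM.
  rewrite -(RintegralB measurableT (ih m) ihr) (_ : _ * fine _ = \int[m]_x (2 * L * e)); last by rewrite Rintegral_cst.
  apply: (le_trans (le_normr_Rintegral _ _)) => //.
    by apply: eq_integrable (integrableB measurableT (ih m) ihr) => // t _.
  apply: le_Rintegral => //.
  - apply: integrable_norm.
    by apply: eq_integrable (integrableB measurableT (ih m) ihr) => // t _.
  - by apply: integrable_cst; exact: sg_lty.
  - by move=> x _; rewrite distrC; exact: poisson_approx hM.
apply/eqP; rewrite -subr_eq0 -normr_eq0 eq_le normr_ge0 andbT.
apply: (@small_eq0 _ _ (2 * L * (fine (mu setT) + fine (nu setT)))) => e e0 e1.
have k1 := key mu e e0 e1; have k2 := key nu e e0 e1.
have E : \int[lam R]_t (h t * \int[mu]_x poisson ((Num.sqrt (1 - e ^+ 2))%:C%C * zeta t) x) =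
  \int[lam R]_t (h t * \int[nu]_x poisson ((Num.sqrt (1 - e ^+ 2))%:C%C * zeta t) x).
  apply: eq_Rintegral => t _; rewrite mn//; apply: inD_rad; rewrite ?cabs_zeta// sqrtr_ge0/=.
  rewrite -[ltRHS]sqrtr1 ltr_sqrt// gtrBl exprn_gt0//.
rewrite E in k1; move: k1 k2; set X := \int[lam R]_t _ => k1 k2.
have := ler_normB (\int[mu]_x h x - X) (\int[nu]_x h x - X).
rewrite (_ : _ - _ - _ = \int[mu]_x h x - \int[nu]_x h x); last by ring.
by lra.
Qed.

End PoissonUniqueness.

(** * Poisson integrals determine measures on the circle *)

Section ArcsDetermine.
Variable R : realType.
Local Notation zeta := (@zeta R).

Definition clamp (u : R) : R := if u <= 0 then 0 else if u <= 1 then u else 1.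

Lemma clamp_lip u v : `|clamp u - clamp v| <= `|u - v|.
Proof.
have h (w : R) := ler_norm w; have h' (w : R) : - w <= `|w| by rewrite -normrN ler_norm.
have := h (u - v); have := h' (u - v); rewrite ler_norml /clamp.
by move: (`|u - v|) => d; case: (leP u 0); case: (leP v 0); case: (leP u 1); case: (leP v 1);
  move=> *; apply/andP; split; lra.
Qed.

Lemma clamp_le1 u : `|clamp u| <= 1.
Proof.
rewrite ler_norml /clamp.
by case: (leP u 0); case: (leP u 1) => *; apply/andP; split; lra.
Qed.

Lemma clamp_cvg (g : R) :
  (fun n : nat => clamp (n%:R * g)) @ \oo --> (((0 < g)%R)%:R : R).
Proof.
have [g0|g0] := ltP 0 g; last first.
  rewrite (_ : (fun n => _) = fun=> 0); first exact: cvg_cst.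
  by apply/funext => n; rewrite /clamp ifT// mulr_ge0_le0.
apply/cvgrPdist_le => e e0; near=> n.
have h : g^-1 < n%:R by near: n; exact: nbhs_infty_gtr.
have ng : 1 < n%:R * g by rewrite -ltr_pdivrMr// div1r.
have -> : clamp (n%:R * g) = 1 by rewrite /clamp !leNgt ng (lt_trans ltr01 ng).
by rewrite subrr normr0 ltW.
Unshelve. all: by end_near. Qed.

Lemma ccvg_real (u : nat -> R) (l : R) : u @ \oo --> l -> ccvg (fun n => (u n)%:C%C) (l%:C%C).
Proof. by move=> h; split => //; exact: cvg_cst. Qed.

Lemma Rdct d (T : measurableType d) (mu : {measure set T -> \bar R})
  (f_ : nat -> T -> R) (f g : T -> R) :
  (forall n, measurable_fun setT (f_ n)) -> measurable_fun setT f ->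
  {ae mu, forall x, (fun n => f_ n x) @ \oo --> f x} ->
  mu.-integrable setT (EFin \o g) -> (forall n x, `|f_ n x| <= g x) ->
  (fun n => \int[mu]_x f_ n x) @ \oo --> \int[mu]_x f x.
Proof.
move=> mf_ mf fl ig fg.
have [] := @ccvg_dct _ _ _ mu (fun n x => (f_ n x)%:C%C) (fun x => (f x)%:C%C) g _ _ _ ig.
- by move=> n; exact: cmeas_real.
- exact: cmeas_real.
- by move: fl; apply: filterS => x; exact: ccvg_real.
- by move=> n x; rewrite cabsr.
- by [].
Qed.

(** Positive on the open arc with centre [m] and half-width [w], and Lipschitz in [zeta x]; the
    truncations [clamp (n * arcG m w x)] approximate the indicator of the arc. *)
Definition arcG (m w x : R) := cos (2 * pi * (x - m)) - cos (2 * pi * w).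

Lemma arcGE m w x : arcG m w x = 2 * (sin (pi * (`|x - m| + w)) * sin (pi * (w - `|x - m|))).
Proof.
rewrite /arcG; set u := x - m.
have -> : cos (2 * pi * u) = cos (2 * pi * `|u|).
  have [u0|u0] := ger0P u => //.
  by rewrite mulrN cosN.
have -> : 2 * pi * `|u| = pi * (`|u| + w) - pi * (w - `|u|) by ring.
have -> : 2 * pi * w = pi * (`|u| + w) + pi * (w - `|u|) by ring.
by rewrite cosB cosD; ring.
Qed.

Lemma arcG_lip m w x y : `|arcG m w x - arcG m w y| <= cabs (zeta x - zeta y).
Proof.
have -> : arcG m w x - arcG m w y = cRe ((zeta x - zeta y) * zeta (- m)).
  by rewrite mulrBl -!zetaD /arcG /=; ring.
by rewrite (le_trans (ler_Re_cabs _))// cabsM cabs_zeta mulr1.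
Qed.

(** In the product of [arcGE] the first sine is nonnegative because [|x - m| + w <= 1], so the
    second one decides the sign. *)
Lemma arcG_gt0 a b x : 0 <= a -> a < b -> b <= 1 -> 0 <= x < 1 ->
  (0 < arcG ((a + b) / 2) ((b - a) / 2) x) = (a < x < b).
Proof.
move=> a0 ab b1 /andP[x0 x1]; rewrite arcGE; set w := (b - a) / 2; set m := (a + b) / 2.
have p0 := @pi_gt0 R.
have E : (a < x < b) = (`|x - m| < w).
  rewrite ltr_norml /w /m; apply/idP/idP => /andP[h1 h2]; apply/andP; split; lra.
have w0 : 0 < w by rewrite /w; lra.
have uw : `|x - m| + w <= 1.
  have : `|x - m| <= 1 - w by rewrite ler_norml /w /m; apply/andP; split; lra.
  by lra.
rewrite E; move: uw; have := normr_ge0 (x - m); move: (`|x - m|) => u u0 uw.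
rewrite pmulr_rgt0//; have [h|h] := ltP u w.
  rewrite mulr_gt0// sin_gt0_pi//.
    rewrite mulr_gt0 ?gtr_pMr//=; [by rewrite /w in h uw w0 *; lra|by lra].
  rewrite mulr_gt0 ?gtr_pMr//= ?subr_gt0//.
  by rewrite /w in h uw w0 *; lra.
apply/negbTE; rewrite -leNgt mulr_ge0_le0//.
  by apply: sin_ge0_pi; rewrite mulr_ge0 ?ger_pMr//= ?(ltW p0)// addr_ge0// ltW.
rewrite -oppr_ge0 -sinN -mulrN; apply: sin_ge0_pi.
by rewrite opprB mulr_ge0 ?subr_ge0 ?(ltW p0)//= ger_pMr//; lra.
Qed.

Lemma measurable_arcG m w : measurable_fun setT (arcG m w).
Proof.
apply: (@zeta_lipschitz_measurable _ _ 1) => // x y; rewrite mul1r; exact: arcG_lip.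
Qed.

Section Unique.
Variables mu nu : {finite_measure set R -> \bar R}.
Hypothesis mn : forall z, inD z -> \int[mu]_x poisson z x = \int[nu]_x poisson z x.
Hypothesis muI : forall A, measurable A -> mu A = mu (A `&` Icirc R).
Hypothesis nuI : forall A, measurable A -> nu A = nu (A `&` Icirc R).

Let pos m w := [set x | 0 < arcG m w x].

Let mpos m w : measurable (pos m w).
Proof.
have := @measurable_arcG m w measurableT _ (@measurable_itv R `]0, +oo[).
rewrite setTI; congr measurable; apply/seteqP; split => x /=; rewrite in_itv/= ?andbT//.
Qed.

Let cvg_pos (la : {finite_measure set R -> \bar R}) m w :
  (fun n : nat => \int[la]_x clamp (n%:R * arcG m w x)) @ \oo --> fine (la (pos m w)).
Proof.
rewrite -Rintegral_indic//; apply: (@Rdct _ _ _ _ _ (cst 1)) => //.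
- move=> n; apply: (@zeta_lipschitz_measurable _ _ n%:R) => // x y.
  rewrite (le_trans (clamp_lip _ _))// -mulrBr normrM ger0_norm// ler_wpM2l//.
  exact: arcG_lip.
- apply: nearW => x; have := @clamp_cvg (arcG m w x).
  rewrite indicE (_ : (x \in pos m w) = (0 < arcG m w x))//.
  by apply/idP/idP => [/set_mem|h]//; apply/mem_set.
- exact: integrable_cst (sg_lty la).
- by move=> n x; exact: clamp_le1.
Qed.

Let eq_pos m w : mu (pos m w) = nu (pos m w).
Proof.
rewrite -[LHS]fineK ?fin_num_measure// -[RHS]fineK ?fin_num_measure//; congr EFin.
apply: (cvg_unique _ (cvg_pos (la := mu) (m := m) (w := w))) => //.
rewrite (_ : (fun n => _) = (fun n : nat => \int[nu]_x clamp (n%:R * arcG m w x))).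
  exact: cvg_pos.
apply/funext => n; apply: (@eq_Rintegral_lipschitz _ _ _ mn _ n%:R 1) => //.
- move=> x y; rewrite (le_trans (clamp_lip _ _))// -mulrBr normrM ger0_norm// ler_wpM2l//.
  exact: arcG_lip.
- by move=> x; exact: clamp_le1.
Qed.

Let eq_itv a b : 0 <= a -> a < b -> b <= 1 -> mu `]a, b[%classic = nu `]a, b[%classic.
Proof.
move=> a0 ab b1; have := eq_pos ((a + b) / 2) ((b - a) / 2).
rewrite muI// nuI// (_ : _ `&` _ = `]a, b[%classic)//.
apply/seteqP; split=> x; rewrite /Icirc /= !in_itv/=.
  by move=> [h xI]; rewrite -arcG_gt0.
move=> /andP[x0 x1]; have xI : 0 <= x < 1.
  by rewrite (ltW (le_lt_trans a0 x0)) (lt_le_trans x1 b1).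
by split => //; rewrite /pos /= arcG_gt0// x0 x1.
Qed.

Let eq_setT : mu setT = nu setT.
Proof.
have := mn (inD0 R).
under eq_Rintegral do rewrite poisson0; under [X in _ = X]eq_Rintegral do rewrite poisson0.
rewrite !Rintegral_cst// !mul1r => h.
by rewrite -[LHS]fineK ?fin_num_measure// -[RHS]fineK ?fin_num_measure// h.
Qed.

(** Open rays generate the Borel sets and are stable under intersection. Both measures live on
    [[0,1)], so a ray counts as the whole line, as the arc []x, 1[], or as the empty set. *)
Lemma poisson_unique A : measurable A -> mu A = nu A.
Proof.
apply: (@measure_unique _ R R (@RGenOInfty.G R)
  (fun k : nat => `](- k%:R : R), +oo[%classic) _ _ _ _ mu nu).
- exact: RGenOInfty.measurableE.
- move=> B C [x ->] [y ->]; exists (Num.max x y).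
  by apply/seteqP; split=> t /=; rewrite !in_itv/= !andbT gt_max;
    [move=> [-> ->]|move=> /andP[]].
- by move=> k; exists (- k%:R).
- apply/seteqP; split => // x _; exists (Num.truncn `|x|).+1 => //=.
  rewrite in_itv/= andbT ltrNl (le_lt_trans _ (truncnS_gt _))//.
  by rewrite -normrN ler_norm.
- move=> B [x ->]; change (mu `]x, +oo[%classic = nu `]x, +oo[%classic).
  have [x0|x0] := ltP x 0.
    rewrite muI// nuI// (_ : _ `&` _ = setT `&` Icirc R); last first.
      rewrite setTI; apply/setIidPr => t; rewrite /Icirc /= !in_itv/= andbT => /andP[t0 _].
      exact: lt_le_trans t0.
    by rewrite -muI// -nuI.
  have [x1|x1] := ltP x 1.
    rewrite muI// nuI// (_ : _ `&` _ = `]x, 1[%classic); first exact: eq_itv.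
    apply/seteqP; split=> t; rewrite /Icirc /= !in_itv/= andbT.
      by move=> [-> /andP[_ ->]].
    by move=> /andP[h ->]; rewrite h andbT; split => //; exact: ltW (le_lt_trans x0 h).
  rewrite muI// nuI// (_ : _ `&` _ = set0) ?measure0//.
  apply/seteqP; split=> t //; rewrite /Icirc /= !in_itv/= andbT => -[h /andP[_]].
  by rewrite ltNge (le_trans x1 (ltW h)).
- by move=> k; rewrite ltey_eq fin_num_measure.
Qed.

End Unique.
End ArcsDetermine.

(** * The Cantor set, its digit map and the Cantor measure *)

Section CantorMeasure.
Variable R : realType.
Implicit Types x y : R.

(** [bit] and [dbl] read off the first binary digit and the remainder; [cantorS] rewrites the binary
    digits as ternary digits 0 and 2. The digits are 0 or 1 for every real argument, so the limit
    lies in the Cantor set even for [x] outside [[0,1)]. *)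
Definition bit x : R := if 1 / 2 <= x then 1 else 0.
Definition dbl x : R := 2 * x - bit x.
Fixpoint cantorS n x : R := if n is m.+1 then (2 * bit x + cantorS m (dbl x)) / 3 else 0.

Lemma bitP x : bit x = 0 \/ bit x = 1.
Proof. by rewrite /bit; case: ifP; [right|left]. Qed.

Lemma cantorS_ge0 n x : 0 <= cantorS n x.
Proof.
elim: n x => [//|n IH] x /=; rewrite divr_ge0// addr_ge0// mulr_ge0//.
by case: (bitP x) => ->.
Qed.

Lemma cantorS_le1 n x : cantorS n x <= 1.
Proof.
elim: n x => [//|n IH] x /=; have := IH (dbl x).
by case: (bitP x) => ->; rewrite ler_pdivrMr//; lra.
Qed.

Lemma cantorS_nd x : nondecreasing_seq (cantorS ^~ x).
Proof.
apply/nondecreasing_seqP => n; elim: n x => [|n IH] x; first exact: cantorS_ge0.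
have := IH (dbl x) => h.
change ((2 * bit x + cantorS n (dbl x)) / 3 <= (2 * bit x + cantorS n.+1 (dbl x)) / 3).
by rewrite ler_pM2r ?invr_gt0// lerD2l.
Qed.

Definition cantorf x : R := limn (cantorS ^~ x).

Lemma cantorS_cvg x : cantorS ^~ x @ \oo --> cantorf x.
Proof.
apply: nondecreasing_is_cvgn; first exact: cantorS_nd.
by exists 1 => _ [n _ <-]; exact: cantorS_le1.
Qed.

Lemma cantorfE x : cantorf x = (2 * bit x + cantorf (dbl x)) / 3.
Proof.
have h := @cantorS_cvg x; rewrite -cvg_shiftS in h.
apply: (cvg_unique _ h) => //=; apply: cvgM; last exact: cvg_cst.
by apply: cvgD; [exact: cvg_cst|exact: cantorS_cvg].
Qed.

Lemma cantorf_ge0 x : 0 <= cantorf x.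
Proof.
apply: limr_ge; first by apply/cvg_ex; exists (cantorf x); exact: cantorS_cvg.
by apply: nearW => n; exact: cantorS_ge0.
Qed.

Lemma cantorf_le1 x : cantorf x <= 1.
Proof.
apply: limr_le; first by apply/cvg_ex; exists (cantorf x); exact: cantorS_cvg.
by apply: nearW => n; exact: cantorS_le1.
Qed.

Lemma measurable_bit : measurable_fun setT bit.
Proof.
rewrite (_ : bit = \1_(`[1 / 2, +oo[%classic)); first exact: measurable_indic.
apply/funext => x; rewrite indicE /bit.
have -> : (x \in `[1 / 2, +oo[%classic) = (1 / 2 <= x).
  by apply/idP/idP => [/set_mem|h]; [|apply/mem_set]; rewrite /= in_itv/= andbT.
by case: ifP.
Qed.

Lemma measurable_dbl : measurable_fun setT dbl.
Proof. by apply: measurable_funB; [exact: measurable_funM|exact: measurable_bit]. Qed.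

Lemma measurable_cantorS n : measurable_fun setT (cantorS n).
Proof.
elim: n => [|n IH] /=; first exact: measurable_cst.
apply: measurable_funM => //; apply: measurable_funD.
  by apply: measurable_funM => //; exact: measurable_bit.
exact: (measurableT_comp IH measurable_dbl).
Qed.

Lemma measurable_cantorf : measurable_fun setT cantorf.
Proof.
by apply: (measurable_fun_cvg measurable_cantorS) => x _; exact: cantorS_cvg.
Qed.

(** Left endpoints of the intervals of length [3^-n] at stage [n] of the middle-thirds
    construction. *)
Fixpoint cantorL n : seq R :=
  if n is m.+1 then [seq v / 3 | v <- cantorL m] ++ [seq (2 + v) / 3 | v <- cantorL m]
  else [:: 0].

Definition cantor_level n : set R := \bigcup_(v in [set` cantorL n]) `[v, v + 3^-1 ^+ n]%classic.
Definition cantor_compact : set R := \bigcap_n cantor_level n.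

Lemma cantorf_level n x : cantor_level n (cantorf x).
Proof.
elim: n x => [|n IH] x.
  exists 0; first by rewrite /= inE.
  by rewrite /= in_itv/= add0r expr0 cantorf_ge0 cantorf_le1.
have [v /= vL] := IH (dbl x); rewrite in_itv/= => /andP[h1 h2].
rewrite cantorfE; exists ((2 * bit x + v) / 3).
  rewrite /= mem_cat; case: (bitP x) => ->; apply/orP; [left|right].
    by apply/mapP; exists v => //; rewrite mulr0 add0r.
  by apply/mapP; exists v => //; rewrite mulr1.
rewrite /= in_itv/= ler_pM2r ?invr_gt0// lerD2l h1 /= exprS [3^-1 * _]mulrC -mulrDl.
by rewrite ler_pM2r ?invr_gt0//; lra.
Qed.

Lemma size_cantorL n : size (cantorL n) = (2 ^ n)%N.
Proof. by elim: n => //= n IH; rewrite size_cat !size_map IH addnn expnS mul2n. Qed.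

Lemma cantor_levelE n : cantor_level n =
  \big[setU/set0]_(v <- cantorL n) `[v, v + 3^-1 ^+ n]%classic.
Proof. by rewrite /cantor_level bigcup_seq. Qed.

Lemma closed_cantor : closed cantor_compact.
Proof.
apply: closed_bigI => n _; rewrite cantor_levelE.
elim: (cantorL n) => [|v s IH]; first by rewrite big_nil; exact: closed0.
by rewrite big_cons; apply: closedU => //; exact: itv_closed.
Qed.

Lemma cantor_sub01 : cantor_compact `<=` `[0, 1]%classic.
Proof.
move=> x /(_ 0%N I) [v /=]; rewrite inE => /eqP ->.
by rewrite add0r expr0.
Qed.

Lemma measurable_cantor_level n : measurable (cantor_level n).
Proof. by rewrite cantor_levelE; apply: bigsetU_measurable => v _; exact: measurable_itv. Qed.

Lemma lebm_cantor_level n : (lebm (cantor_level n) <= ((2 / 3 : R) ^+ n)%:E)%E.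
Proof.
have -> : (2 / 3 : R) ^+ n = (size (cantorL n))%:R * 3^-1 ^+ n.
  by rewrite size_cantorL exprMn natrX.
rewrite cantor_levelE; elim: (cantorL n) => [|v s IH].
  by rewrite big_nil measure0 mul0r.
rewrite big_cons /= [(size s).+1%:R]mulrS mulrDl mul1r EFinD.
have mv : measurable (`[v, v + 3^-1 ^+ n]%classic : set R) by exact: measurable_itv.
have ms : measurable (\big[setU/set0]_(w <- s) `[w, w + 3^-1 ^+ n]%classic : set R).
  by apply: bigsetU_measurable => w _; exact: measurable_itv.
apply: (le_trans (measureU2 (@lebm R) mv ms)); apply: leeD => //.
have := @lebesgue_measure_itv R `[v, (v + 3^-1 ^+ n)].
rewrite /= lte_fin ltrDl exprn_gt0// -EFinB [v + _]addrC addrK => h.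
by rewrite /lebm h.
Qed.

Lemma measurable_cantor : measurable cantor_compact.
Proof. by apply: closed_measurable; exact: closed_cantor. Qed.

Lemma lebm_cantor : lebm cantor_compact = 0%E.
Proof.
apply/eqP; rewrite eq_le measure_ge0 andbT; apply/lee_addgt0Pr => e e0; rewrite add0e.
have : (fun n => (2 / 3 : R) ^+ n) @ \oo --> 0.
  by apply: cvg_expr; rewrite ger0_norm ?divr_ge0//; lra.
move=> /cvgrPdist_lt /(_ _ e0) [n _ /(_ n (leqnn n))] /=.
rewrite sub0r normrN ger0_norm ?exprn_ge0 ?divr_ge0// => h.
apply: le_trans (le_trans (lebm_cantor_level n) _); last by rewrite lee_fin ltW.
apply: le_measure; rewrite ?inE//.
- exact: measurable_cantor.
- exact: measurable_cantor_level.
- by move=> x; exact.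
Qed.

(** Images with first digit 0 are at most 1/3 and those with first digit 1 at least 2/3, so equal
    images have equal first digits and remainders with equal images; after [n] digits the arguments
    differ by at most [2^-n]. *)
Lemma cantorf_inj x y : 0 <= x < 1 -> 0 <= y < 1 -> cantorf x = cantorf y -> x = y.
Proof.
move=> hx hy e; apply/eqP; rewrite -subr_eq0 -normr_eq0 eq_le normr_ge0 andbT.
have key n u v : 0 <= u < 1 -> 0 <= v < 1 -> cantorf u = cantorf v -> `|u - v| <= 2^-1 ^+ n.
  elim: n u v => [|n IH] u v hu hv euv.
    by rewrite expr0 ler_norml; apply/andP; split; lra.
  have hd w : 0 <= w < 1 -> 0 <= dbl w < 1.
    by rewrite /dbl /bit; case: (leP (1 / 2) w) => *; apply/andP; split; lra.
  have eb : bit u = bit v.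
    have := cantorf_ge0 (dbl u); have := cantorf_le1 (dbl u).
    have := cantorf_ge0 (dbl v); have := cantorf_le1 (dbl v).
    move: euv; rewrite (cantorfE u) (cantorfE v).
    by case: (bitP u) => ->; case: (bitP v) => -> //; lra.
  have ed : cantorf (dbl u) = cantorf (dbl v).
    by move: euv; rewrite (cantorfE u) (cantorfE v) eb; lra.
  have := IH _ _ (hd _ hu) (hd _ hv) ed.
  rewrite /dbl eb (_ : _ - _ = 2 * (u - v)); last by ring.
  by rewrite normrM ger0_norm// exprS => h; lra.
apply/ler_addgt0Pr => d d0; rewrite add0r.
have : (fun n => (2^-1 : R) ^+ n) @ \oo --> 0.
  by apply: cvg_expr; rewrite ger0_norm ?invr_ge0//; lra.
move=> /cvgrPdist_lt /(_ _ d0) [n _ /(_ n (leqnn n))] /=.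
rewrite sub0r normrN ger0_norm ?exprn_ge0 ?invr_ge0// => h.
exact: le_trans (key n _ _ hx hy e) (ltW h).
Qed.

(** As an image of Lebesgue measure under the digit map it has no atoms, by injectivity, and it is
    singular because the map takes its values in a null set. *)
Definition cantorm (A : set R) : \bar R := lam R (cantorf @^-1` A).
Let P := measure_function_pushforward__canonical__measure_function_Measure (lam R) measurable_cantorf.
Let cantorm0 : cantorm set0 = 0%E. Proof. exact: (measure0 P). Qed.
Let cantorm_ge0 A : (0 <= cantorm A)%E. Proof. exact: (measure_ge0 (lam R)). Qed.
Let cantorm_sigma : semi_sigma_additive cantorm.
Proof. exact: (@measure_semi_sigma_additive _ _ _ P). Qed.
HB.instance Definition _ := isMeasure.Build default_measure_display R R cantorm
  cantorm0 cantorm_ge0 cantorm_sigma.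
Let cantorm_fin : fin_num_fun cantorm.
Proof.
move=> A mA; apply: fin_num_measure.
by rewrite -[X in measurable X]setTI; exact: measurable_cantorf.
Qed.
HB.instance Definition _ := Measure_isFinite.Build _ _ _ cantorm cantorm_fin.

Lemma cantorm_set1 x : cantorm [set x] = 0%E.
Proof.
rewrite /cantorm lamE.
have [->|/set0P[y [/= yx yI]]] := eqVneq (cantorf @^-1` [set x] `&` Icirc R) set0.
  exact: measure0.
apply/eqP; rewrite eq_le measure_ge0 andbT.
apply: (@le_trans _ _ (lebm [set y])); last first.
  by change (@lebesgue_measure R [set y] <= 0)%E; rewrite lebesgue_measure_set1.
apply: le_measure; rewrite ?inE//.
  apply: measurableI; last exact: measurable_Icirc.
  by rewrite -[X in measurable X]setTI; exact: measurable_cantorf.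
move=> z [/= zx zI]; apply: cantorf_inj; last by rewrite zx yx.
  by move: zI; rewrite /Icirc /= in_itv.
by move: yI; rewrite /Icirc /= in_itv.
Qed.

Lemma cantorm_Icirc : cantorm (cantor_compact `&` Icirc R) = 1%E.
Proof.
have h : cantorm cantor_compact = 1%E.
  rewrite /cantorm (_ : _ @^-1` _ = setT) ?lamT//.
  by apply/seteqP; split => // x _ n _; exact: cantorf_level.
have mI := @measurable_Icirc R; have mC := measurable_cantor.
rewrite -h; apply/eqP; rewrite eq_le; apply/andP; split.
  by apply: le_measure; rewrite ?inE//; exact: measurableI.
(* The point 1 of [[0,1]] lies outside [[0,1)]; having mass 0, it is added at no cost. *)
have -> : cantorm (cantor_compact `&` Icirc R) =
    (cantorm (cantor_compact `&` Icirc R) + cantorm [set (1%R : R)])%E.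
  by rewrite cantorm_set1 adde0.
apply: le_trans (measureU2 _ (measurableI _ _ mC mI) (measurable_set1 _)).
apply: le_measure; rewrite ?inE//; first by apply: measurableU => //; exact: measurableI.
move=> x Cx; have := cantor_sub01 Cx; rewrite /= in_itv/= => /andP[x0 x1].
have [->|xn] := eqVneq x 1; first by right.
by left; split => //; rewrite /Icirc /= in_itv/= x0 lt_neqAle xn.
Qed.

End CantorMeasure.

(** * The kernel does not concentrate at a point *)

Section NearMass.
Variable R : realType.
Local Notation zeta := (@zeta R).
Variable sg : {finite_measure set R -> \bar R}.
Variables (A : set R) (t0 : R).
Hypothesis mA : measurable A.
Hypothesis gd : {ae lam R, forall t, exists c, away A (zeta t) c}.
Hypothesis na : {ae sg, forall x, A x -> zeta x != zeta t0}.
Local Notation kk := (kk sg A).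
Local Notation phih := (phih sg A).

Definition nearset (eta : R) : set R := [set t | cabs (zeta t - zeta t0) < eta].

Lemma measurable_nearset eta : measurable (nearset eta).
Proof.
have mf : measurable_fun setT (fun t => cabs (zeta t - zeta t0)).
  by apply: measurable_cabs; apply: cmeasB; [exact: cmeas_zeta|exact: cmeas_cst].
have := mf measurableT _ (@measurable_itv R `]-oo, eta[).
rewrite setTI; congr measurable; apply/seteqP; split => x /=; rewrite in_itv//.
Qed.

(** The Poisson kernels at these points act as bump functions for the arc of chord radius [eta n]
    about [zeta t0]. *)
Let z n := (rad R n)%:C%C * zeta t0.
Let eta n : R := 1 - rad R n.

Let zD n : inD (z n).
Proof. by apply: inD_rad; rewrite ?rad_bound ?cabs_zeta. Qed.

Let eta_gt0 n : 0 < eta n.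
Proof. by have /andP[_ h] := rad_bound R n; rewrite subr_gt0. Qed.

Let csqz n : 1 - csq (z n) = eta n * (2 - eta n).
Proof.
by rewrite /z csqM csq_zeta mulr1 /csq /= expr0n addr0 /eta; ring.
Qed.

Let eta_le1 n : eta n <= 1.
Proof. by rewrite /eta gerBl; have /andP[] := rad_bound R n. Qed.

Let zt n : cabs (z n - zeta t0) = eta n.
Proof.
rewrite (_ : _ - _ = (- eta n)%:C%C * zeta t0); last first.
  by apply: eqC; rewrite /z /eta !cReImE /=; ring.
by rewrite cabsM cabs_zeta mulr1 cabsr normrN ger0_norm// ltW.
Qed.

Let etaP n x : eta n * poisson (z n) x <= 2.
Proof.
have h := zetaB_lb (z n) x; have e0 := eta_gt0 n; have e1 := eta_le1 n.
have cz : 1 - cabs (z n) = eta n.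
  rewrite /z cabsM cabs_zeta mulr1 cabsr ger0_norm//.
  by have /andP[] := rad_bound R n.
rewrite cz in h; have nz := zetaB_neq0 x (zD n).
rewrite /poisson csqz -cabs_sqr mulrA ler_pdivrMr ?exprn_gt0 ?cabs_gt0//.
have : eta n ^+ 2 <= cabs (zeta x - z n) ^+ 2 by rewrite lerXn2r ?nnegrE ?(ltW e0).
have : eta n * (eta n * (2 - eta n)) <= 2 * eta n ^+ 2.
  rewrite (_ : _ * _ = eta n ^+ 2 * (2 - eta n)); last by ring.
  by rewrite mulrC ler_wpM2r ?sqr_ge0//; lra.
by lra.
Qed.

(** Within [eta n] of [zeta t0] the distance to [z n] is at most [2 * eta n], so the Poisson kernel
    is at least [1 / (4 * eta n)] and majorizes the indicator of the arc up to that scale. *)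
Let near_le n x : nearset (eta n) x -> 1 <= 4 * eta n * poisson (z n) x.
Proof.
rewrite /nearset /= => h; have e0 := eta_gt0 n; have e1 := eta_le1 n.
have nz := zetaB_neq0 x (zD n); have q0 := cabs_gt0 nz.
have h2 : cabs (zeta x - z n) <= 2 * eta n.
  have := ler_cabsDB (zeta t0) (zeta x) (z n); rewrite (cabsBC (zeta t0)) zt; lra.
rewrite /poisson csqz -cabs_sqr mulrA ler_pdivlMr ?exprn_gt0// mul1r.
have : cabs (zeta x - z n) ^+ 2 <= (2 * eta n) ^+ 2.
  by rewrite lerXn2r ?nnegrE ?mulr_ge0// ltW.
rewrite (_ : (2 * eta n) ^+ 2 = 4 * eta n * eta n); last by ring.
move=> /le_trans; apply; rewrite -subr_ge0.
rewrite (_ : _ - _ = 4 * eta n ^+ 2 * (1 - eta n)); last by ring.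
by apply: mulr_ge0; [rewrite mulr_ge0// sqr_ge0|rewrite subr_ge0].
Qed.

Let far_le n x : zeta x != zeta t0 ->
  eta n * poisson (z n) x <= 8 / cabs (zeta x - zeta t0) ^+ 2 * eta n.
Proof.
move=> hx; have d0 : 0 < cabs (zeta x - zeta t0) by rewrite cabs_gt0// subr_eq0.
have e0 := eta_gt0 n; have e1 := eta_le1 n.
have h := zetaB_lb (z n) x.
have cz : 1 - cabs (z n) = eta n.
  rewrite /z cabsM cabs_zeta mulr1 cabsr ger0_norm//.
  by have /andP[] := rad_bound R n.
rewrite cz in h.
have h2 : cabs (zeta x - zeta t0) <= 2 * cabs (zeta x - z n).
  by have := ler_cabsDB (z n) (zeta x) (zeta t0); rewrite zt; lra.
have q0 : 0 < cabs (zeta x - z n) by rewrite cabs_gt0// zetaB_neq0.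
rewrite mulrC ler_wpM2r ?(ltW e0)// /poisson csqz -cabs_sqr.
rewrite ler_pdivrMr ?exprn_gt0// mulrAC ler_pdivlMr ?exprn_gt0//.
have : cabs (zeta x - zeta t0) ^+ 2 <= (2 * cabs (zeta x - z n)) ^+ 2.
  by rewrite lerXn2r ?nnegrE ?mulr_ge0.
rewrite (_ : (2 * _) ^+ 2 = 4 * cabs (zeta x - z n) ^+ 2); last by ring.
move: (cabs_ge0 (zeta x - zeta t0)) (sqr_ge0 (cabs (zeta x - zeta t0))).
move: (cabs _ ^+ 2) (cabs _ ^+ 2) => X Y _ Y0 XY.
have E : eta n * (2 - eta n) <= 2.
  have : eta n * (2 - eta n) <= 1 * 2 by rewrite ler_pM ?(ltW e0)//; lra.
  by rewrite mul1r.
apply: (@le_trans _ _ (2 * Y)); last by lra.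
by rewrite ler_wpM2r.
Qed.

(** The absence of atoms enters here: the integrand stays below 2 and tends to 0 off [zeta t0] by
    [far_le], while [na] makes the remaining point negligible. *)
Let cvg_mass : (fun n => eta n * (1 + \int[sg]_x (\1_A x * poisson (z n) x))) @ \oo --> 0.
Proof.
have fin := sg_lty sg.
have mP n : measurable_fun setT (fun x => eta n * (\1_A x * poisson (z n) x)).
  apply: measurable_funM => //; apply: measurable_funM; first exact: measurable_indic.
  exact: measurable_poisson.
have bd n x : `|eta n * (\1_A x * poisson (z n) x)| <= 2.
  have /andP[i0 i1] := indic_le1 A x; have P0 := poisson_ge0 x (zD n).
  have e0 := ltW (eta_gt0 n).
  have nn : 0 <= eta n * (\1_A x * poisson (z n) x).
    by apply: mulr_ge0 => //; apply: mulr_ge0.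
  rewrite ger0_norm//; apply: le_trans (etaP n x); rewrite ler_wpM2l//.
  by rewrite ler_piMl.
have : (fun n => \int[sg]_x (eta n * (\1_A x * poisson (z n) x))) @ \oo --> \int[sg]_x (cst 0 x).
  apply: (Rdct (g := cst 2)) => //; last exact: integrable_cst.
  move: na; apply: filterS => x hx; rewrite /cst.
  rewrite indicE; have [/set_mem Ax|nAx] := boolP (x \in A); last first.
    by rewrite (_ : (fun n => _) = fun=> 0); [exact: cvg_cst|apply/funext => n; rewrite mul0r mulr0].
  have u0 : (fun n => 8 / cabs (zeta x - zeta t0) ^+ 2 * eta n) @ \oo --> 0.
    by rewrite -(mulr0 (8 / cabs (zeta x - zeta t0) ^+ 2)); apply: cvgM; [exact: cvg_cst|exact: cvg_radB].
  apply: (squeeze_cvgr _ (cvg_cst 0) u0); apply: nearW => n; rewrite mul1r.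
  by rewrite mulr_ge0 ?(ltW (eta_gt0 n)) ?poisson_ge0//= far_le// hx.
rewrite Rintegral_cst// mul0r => h.
rewrite (_ : (fun n => _) = (fun n => eta n + \int[sg]_x (eta n * (\1_A x * poisson (z n) x)))).
  by rewrite -[X in _ --> X](addr0 0); apply: cvgD => //; exact: cvg_radB.
apply/funext => n; rewrite RintegralZl// ?mulrDr ?mulr1//.
apply: (@integrable_bounded_real _ _ _ _ _ (2 / eta n)) => //.
  by apply: measurable_funM; [exact: measurable_indic|exact: measurable_poisson].
move=> x; have := bd n x; rewrite normrM (gtr0_norm (eta_gt0 n)) => hb.
by rewrite ler_pdivlMr ?eta_gt0// mulrC.
Qed.

(** The indicator is majorized by [4 * eta n] times the Poisson kernel at [z n], and
    [kernel_poisson] evaluates the integral of the latter against the kernel. *)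
Let int_near n a : \int[lam R]_t (\1_(nearset (eta n)) t * kk a t) <=
  4 * eta n * poisson (phih (z n)) a.
Proof.
have fin := lamT_lty R; have mN := measurable_nearset (eta n).
have [B hB] := kk_bounded sg A a.
have B0 : 0 <= B by exact: le_trans (kk_ge0 sg A a 0) (hB 0).
have mk := measurable_kkr sg a mA.
have k0 t : 0 <= kk a t by exact: kk_ge0.
have p0 t : 0 <= poisson (z n) t by exact: poisson_ge0.
have iP : (lam R).-integrable setT (EFin \o (fun t => poisson (z n) t * kk a t)).
  apply: (@integrable_bounded_real _ _ _ _ _ (((1 - cabs (z n)) ^+ 2)^-1 * B)) => //.
    by apply: measurable_funM => //; exact: measurable_poisson.
  move=> t; rewrite normrM (ger0_norm (p0 t)) (ger0_norm (k0 t)) ler_pM//.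
  exact: poisson_le.
apply: (@le_trans _ _ (4 * eta n * \int[lam R]_t (poisson (z n) t * kk a t))); last first.
  rewrite ler_wpM2l ?mulr_ge0 ?(ltW (eta_gt0 n))// (kernel_poisson sg a mA gd (zD n)) lerDl.
  by rewrite mulr_ge0// Rintegral_ge0// => x _; rewrite mulr_ge0 ?(poisson_ge0 _ (zD n)).
rewrite -RintegralZl//; apply: le_Rintegral => //.
- apply: (@integrable_bounded_real _ _ _ _ _ B) => //.
    by apply: measurable_funM => //; exact: measurable_indic.
  move=> t; have /andP[i0 i1] := indic_le1 (nearset (eta n)) t.
  rewrite ger0_norm ?(mulr_ge0 i0 (k0 t))//; apply: le_trans (hB t).
  by rewrite ler_piMl.
- by apply: eq_integrable (integrableZl measurableT (4 * eta n) iP) => // t _.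
- move=> t _; rewrite indicE.
  have [/set_mem ht|_] := boolP (t \in nearset (eta n)).
    by rewrite mulrA ler_wpM2r// near_le.
  by rewrite mul0r; apply: mulr_ge0; [rewrite mulr_ge0// ltW|rewrite mulr_ge0].
Qed.

Let int_near1 n : \int[lam R]_t (\1_(nearset (eta n)) t) <= 4 * eta n.
Proof.
have fin := lamT_lty R; have iP := integrable_poisson fin (zD n).
have -> : 4 * eta n = \int[lam R]_t (4 * eta n * poisson (z n) t).
  by rewrite RintegralZl// poisson_int1// mulr1.
apply: le_Rintegral => //.
- apply: (@integrable_bounded_real _ _ _ _ _ 1) => //.
    by apply: measurable_indic; exact: measurable_nearset.
  by move=> t; have /andP[i0 i1] := indic_le1 (nearset (eta n)) t; rewrite ger0_norm.
- by apply: eq_integrable (integrableZl measurableT (4 * eta n) iP) => // t _.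
- move=> t _; rewrite indicE.
  have [/set_mem ht|_] := boolP (t \in nearset (eta n)); first exact: near_le.
  by apply: mulr_ge0; [rewrite mulr_ge0// ltW|exact: poisson_ge0].
Qed.

(** The distances of [zeta a] and of 1 to [w] lie between [1 - |w|] and 2. The bound is crude but is
    applied with [w] fixed before [a], so the size of its constant is immaterial. *)
Lemma poisson_lip1 (w : R[i]) a : inD w ->
  poisson w a <= poisson w 0 + 4 / (1 - cabs w) ^+ 4 * cabs (zeta a - 1).
Proof.
move=> hw; have c0 : 0 < 1 - cabs w by rewrite subr_gt0.
have h1 := zetaB_lb w a; have h2 := zetaB_lb w 0; have hq := inD_csq hw.
have p1 := lt_le_trans c0 h1; have p2 := lt_le_trans c0 h2.
rewrite -lerBlDl /poisson -!cabs_sqr zeta0 in h2 p2 *; rewrite cabs_sqr.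
move: h1 h2 p1 p2; set u := cabs (zeta a - w); set v := cabs (1 - w) => h1 h2 p1 p2.
have uv : v - u <= cabs (zeta a - 1).
  by have := ler_cabsDB (zeta a) 1 w; rewrite -/u -/v (cabsBC 1); lra.
have w1 : cabs w <= 1 by exact: ltW.
have u2 : u <= 2 by rewrite (le_trans (ler_cabsB _ _))// cabs_zeta; lra.
have v2 : v <= 2 by rewrite (le_trans (ler_cabsB _ _))// cabs1; lra.
have -> : (1 - csq w) / u ^+ 2 - (1 - csq w) / v ^+ 2 =
   (1 - csq w) * ((v - u) * ((v + u) * ((u ^+ 2)^-1 * (v ^+ 2)^-1))).
  by field; rewrite !gt_eqF.
set X := (u ^+ 2)^-1 * _.
have X0 : 0 <= X by rewrite mulr_ge0// invr_ge0 exprn_ge0// ltW.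
have XB : X <= (1 - cabs w) ^- 4.
  have -> : (1 - cabs w) ^- 4 = (1 - cabs w) ^- 2 * (1 - cabs w) ^- 2.
    by rewrite -invfM -exprD.
  rewrite ler_pM ?invr_ge0 ?exprn_ge0 ?(ltW p1) ?(ltW p2)//.
    by rewrite lef_pV2 ?posrE ?exprn_gt0// lerXn2r ?nnegrE ?(ltW c0) ?(ltW p1).
  by rewrite lef_pV2 ?posrE ?exprn_gt0// lerXn2r ?nnegrE ?(ltW c0) ?(ltW p2).
have vuX : (v + u) * X <= 4 * (1 - cabs w) ^- 4.
  by rewrite ler_pM// ?addr_ge0 ?(ltW p1) ?(ltW p2)//; lra.
have vuX0 : 0 <= (v + u) * X by rewrite mulr_ge0// addr_ge0 ?(ltW p1) ?(ltW p2).
apply: (@le_trans _ _ (1 * (cabs (zeta a - 1) * ((v + u) * X)))).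
  apply: (@le_trans _ _ ((1 - csq w) * (cabs (zeta a - 1) * ((v + u) * X)))).
    by rewrite ler_wpM2l ?subr_ge0 ?(ltW hq)// ler_wpM2r.
  by apply: ler_wpM2r; [exact: mulr_ge0|rewrite gerBl].
by rewrite mul1r mulrC ler_wpM2r.
Qed.

(* Away from [zeta a = 1] the kernel is bounded; near it, it is compared with
   its weak limit, which has no atom at [t0]. *)
Lemma near_mass e : 0 < e -> exists2 d, 0 < d &
  forall a, zeta a != 1 -> \int[lam R]_t (\1_(nearset d) t * kk a t) <= e.
Proof.
move=> e0; have fin := lamT_lty R.
(* [n] fixes a coarse arc and the point [w]. The Poisson kernel of [w] at 1 is the real part of [F]
   at [z n], and [eta n] times it is small. *)
have [n hn] : exists n, eta n * (1 + \int[sg]_x (\1_A x * poisson (z n) x)) < e / 8.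
  have e8 : 0 < e / 8 by rewrite divr_gt0.
  move/cvgrPdist_lt : cvg_mass => /(_ _ e8) [n _ /(_ n (leqnn n))] /=.
  by rewrite sub0r normrN => h; exists n; exact: le_lt_trans (ler_norm _) h.
pose w := phih (z n); have wD : inD w by apply: phih_inD; exact: ltW (zD n).
have P0 : poisson w 0 = 1 + \int[sg]_x (\1_A x * poisson (z n) x).
  rewrite poisson_phih ?(ltW (zD n))// zeta0 subrr mul0r add0r csq_two Re_Fh.
  by rewrite [4 * _]mulrC mulfK.
pose C := 4 / (1 - cabs w) ^+ 4.
have C0 : 0 <= C by rewrite divr_ge0// exprn_ge0// subr_ge0 ltW.
have C1 : 0 < C + 1 by rewrite ltr_wpDl.
(* For [zeta a] within [dl] of 1 the Poisson kernel of [w] grows by at most [e / 8]; with the factor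
   4 of [int_near] this gives [4 * (e / 8 + e / 8) = e]. *)
pose dl := e / (8 * (C + 1)); have dl0 : 0 < dl by rewrite divr_gt0 ?mulr_gt0.
have en1 := eta_le1 n; have en0 := eta_gt0 n.
(* The final arc is chosen last: for [zeta a] at distance at least [dl] from 1 the kernel is at most
   [4 / dl ^+ 2], and the arc has measure at most [4 * eta m]. *)
have [m hm] : exists m, (n <= m)%N /\ 16 * eta m <= e * dl ^+ 2.
  have u0 : (fun k => 16 * eta k) @ \oo --> 0.
    by rewrite -(mulr0 16); apply: cvgM; [exact: cvg_cst|exact: cvg_radB].
  have ed : 0 < e * dl ^+ 2 by rewrite mulr_gt0// exprn_gt0.
  move/cvgrPdist_lt : u0 => /(_ _ ed) [k _ hk].
  exists (maxn n k); split; first exact: leq_maxl.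
  have := hk (maxn n k) (leq_maxr _ _); rewrite /= sub0r normrN => h.
  exact: ltW (le_lt_trans (ler_norm _) h).
have em0 := eta_gt0 m.
have emn : eta m <= eta n.
  rewrite /eta /rad !opprB !addrA !(addrC 1) !addrK.
  by rewrite lef_pV2 ?posrE ?ltr0n// ler_nat !ltnS; case: hm.
exists (eta m) => // a ha.
have sub t : nearset (eta m) t -> nearset (eta n) t.
  by rewrite /nearset /= => h; exact: lt_le_trans emn.
have [B hB] := kk_bounded sg A a; have mk := measurable_kkr sg a mA.
have k0 t : 0 <= kk a t by exact: kk_ge0.
have ik d : (lam R).-integrable setT (EFin \o (fun t => \1_(nearset d) t * kk a t)).
  apply: (@integrable_bounded_real _ _ _ _ _ B) => //.
    by apply: measurable_funM => //; apply: measurable_indic; exact: measurable_nearset.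
  move=> t; have /andP[i0 i1] := indic_le1 (nearset d) t.
  rewrite ger0_norm ?(mulr_ge0 i0 (k0 t))//; apply: le_trans (hB t).
  by rewrite ler_piMl.
have [near|far] := ltP (cabs (zeta a - 1)) dl.
  apply: (@le_trans _ _ (\int[lam R]_t (\1_(nearset (eta n)) t * kk a t))).
    apply: le_Rintegral => // t _; rewrite ler_wpM2r// !indicE.
    have [/set_mem/sub h|_] := boolP (t \in nearset (eta m)); last by rewrite ler0n.
    by rewrite (mem_set h).
  apply: (le_trans (int_near n a)); have := poisson_lip1 a wD; rewrite P0 -/C => hP.
  have hC : C * cabs (zeta a - 1) <= e / 8.
    apply: (@le_trans _ _ ((C + 1) * dl)).
      by apply: ler_pM => //; [rewrite lerDl|exact: ltW].
    by rewrite /dl invfM mulrCA (mulrCA (C + 1)) mulfV ?gt_eqF// mulr1.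
  have : eta n * poisson (phih (z n)) a <= e / 8 + e / 8.
    apply: (@le_trans _ _ (eta n * (1 + \int[sg]_x (\1_A x * poisson (z n) x) + e / 8))).
      by rewrite ler_wpM2l ?(ltW en0)//; lra.
    by rewrite mulrDr lerD ?(ltW hn)// ler_piMl// divr_ge0// ltW.
  by lra.
have q0 : 0 < csq (zeta a - 1) by apply: csq_gt0; rewrite subr_eq0.
have kB t : kk a t <= 4 / dl ^+ 2.
  apply: (le_trans (kk_le sg A t ha)); rewrite ler_wpM2l// lef_pV2 ?posrE ?exprn_gt0//.
  by rewrite -cabs_sqr lerXn2r ?nnegrE ?(ltW dl0).
have d20 : 0 < dl ^+ 2 by rewrite exprn_gt0.
have i1 : (lam R).-integrable setT (EFin \o (\1_(nearset (eta m)) : R -> R)).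
  apply: (@integrable_bounded_real _ _ _ _ _ 1) => //.
    by apply: measurable_indic; exact: measurable_nearset.
  by move=> t; have /andP[i0 i1] := indic_le1 (nearset (eta m)) t; rewrite ger0_norm.
apply: (@le_trans _ _ (\int[lam R]_t (4 / dl ^+ 2 * \1_(nearset (eta m)) t))).
  apply: le_Rintegral => //.
    by apply: eq_integrable (integrableZl measurableT (4 / dl ^+ 2) i1) => // t _.
  by move=> t _; rewrite mulrC ler_wpM2r.
rewrite RintegralZl//.
apply: (@le_trans _ _ (4 / dl ^+ 2 * (4 * eta m))).
  by rewrite ler_wpM2l ?int_near1// divr_ge0// ltW.
rewrite mulrAC ler_pdivrMr// (_ : 4 * (4 * eta m) = 16 * eta m); last by ring.
by case: hm.
Qed.

End NearMass.

(** * Comparison of kernels and of their masses *)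

Section KernelStability.
Variable R : realType.

Lemma qform_gt0 (K c s : R) : c ^+ 2 + s ^+ 2 = 1 -> 0 < 2 - 2 * K * s + K ^+ 2 * (1 - c) /\
  `|K * (1 - c) - s| <= 2 - 2 * K * s + K ^+ 2 * (1 - c) /\
  0 <= 1 - c <= 2 - 2 * K * s + K ^+ 2 * (1 - c).
Proof.
move=> h; set q := 2 - _ + _; set u := 1 - c.
have c1 : `|c| <= 1.
  rewrite -(@expr_le1 _ 2)// real_normK ?num_real//.
  by have := sqr_ge0 s; lra.
have u0 : 0 <= u by rewrite /u subr_ge0 (le_trans (ler_norm _) c1).
have E : (K * u - s) ^+ 2 = u * (q - u).
  have s2 : s ^+ 2 = u * (2 - u) by have := h; rewrite /u => h'; rewrite (_ : s ^+ 2 = 1 - c ^+ 2); [ring|lra].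
  have -> : (K * u - s) ^+ 2 = K ^+ 2 * u ^+ 2 - 2 * K * u * s + s ^+ 2 by ring.
  by rewrite s2 /q -/u; ring.
have [u0'|un] := eqVneq u 0.
  have s0 : s = 0.
    by apply/eqP; rewrite -sqrf_eq0; move/eqP: E; rewrite u0' mulr0 mul0r sub0r sqrrN.
  have q2 : q = 2 by rewrite /q -/u u0' s0 !mulr0 subr0 addr0.
  by rewrite s0 subr0 u0' q2 mulr0 normr0 ltr0n ler0n lexx.
have up : 0 < u by rewrite lt_neqAle eq_sym un.
have qu : u <= q by have := sqr_ge0 (K * u - s); rewrite E pmulr_rge0// subr_ge0.
have qp := lt_le_trans up qu.
split=> //; rewrite u0 qu; split => //.
rewrite -(@ler_pXn2r _ 2) ?nnegrE ?(ltW qp)// real_normK ?num_real// E expr2.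
by apply: ler_pM => //; rewrite ?subr_ge0// gerBl.
Qed.

(** The expansion [q + 2 * (k * (K * (1 - c) - s)) + k ^+ 2 * (1 - c)] is exact, and [qform_gt0]
    bounds both coefficients by [q] itself. The resulting factor involves [d] alone. *)
Lemma qform_stable (K k c s d : R) : c ^+ 2 + s ^+ 2 = 1 -> `|k| <= d ->
  2 - 2 * (K + k) * s + (K + k) ^+ 2 * (1 - c) <=
  (1 + d) ^+ 2 * (2 - 2 * K * s + K ^+ 2 * (1 - c)).
Proof.
move=> h kd; have [q0 [h1 /andP[u0 uq]]] := qform_gt0 K h.
have d0 : 0 <= d by exact: le_trans (normr_ge0 _) kd.
move: q0 h1 uq; set q := 2 - 2 * K * s + _ => q0 h1 uq.
have -> : 2 - 2 * (K + k) * s + (K + k) ^+ 2 * (1 - c) =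
  q + 2 * (k * (K * (1 - c) - s)) + k ^+ 2 * (1 - c) by rewrite /q; ring.
have e1 : k * (K * (1 - c) - s) <= d * q.
  by apply: (le_trans (ler_norm _)); rewrite normrM ler_pM.
have e2 : k ^+ 2 * (1 - c) <= d ^+ 2 * q.
  rewrite ler_pM// ?sqr_ge0//.
  by rewrite -[leLHS]real_normK ?num_real// lerXn2r ?nnegrE.
have -> : (1 + d) ^+ 2 * q = q + 2 * (d * q) + d ^+ 2 * q by ring.
by lra.
Qed.

Variable sg : {finite_measure set R -> \bar R}.
Local Notation zeta := (@zeta R).

(** The ratio of two kernels stays under control as [zeta a] tends to 1, although the kernels
    themselves have no uniform bound there. *)
Lemma kk_stable (A B : set R) a t d :
  `|cIm (Fh sg B (zeta t)) - cIm (Fh sg A (zeta t))| <= d ->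
  kk sg A a t <= (1 + d) ^+ 2 * kk sg B a t.
Proof.
move=> hd; rewrite !kkE.
have h := csq_zeta a; rewrite /csq in h.
have d0 : 0 <= d by exact: le_trans (normr_ge0 _) hd.
have d1 : 0 < (1 + d) ^+ 2 by rewrite exprn_gt0// ltr_pwDl.
have := qform_stable (cIm (Fh sg A (zeta t))) h hd.
rewrite (_ : cIm (Fh sg A (zeta t)) + _ = cIm (Fh sg B (zeta t))); last by ring.
have [qA _] := qform_gt0 (cIm (Fh sg A (zeta t))) h.
have [qB _] := qform_gt0 (cIm (Fh sg B (zeta t))) h.
move: qA qB; set x := 2 - _ + _; set y := 2 - _ + _ => x0 y0 xy.
rewrite mulrCA ler_wpM2l// ler_pdivlMr// mulrC.
by rewrite ler_pdivrMr// mulrC.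
Qed.

Lemma poisson_phih0_lip A B a : measurable A -> measurable B ->
  mass sg A <= 1 -> mass sg B <= 1 ->
  `|poisson (phih sg A 0) a - poisson (phih sg B 0) a| <= 5 * `|mass sg A - mass sg B|.
Proof.
move=> mA mB hA hB; rewrite !poisson_phih0//.
have := mass_ge0 sg A; have := mass_ge0 sg B; move: hA hB.
move: (mass sg A) (mass sg B) => m k m1 k1 k0 m0.
have u0 : 0 <= 1 - cRe (zeta a) by rewrite subr_ge0 Re_zeta_le1.
have u2 : 1 - cRe (zeta a) <= 2.
  have : `|cRe (zeta a)| <= 1 by rewrite (le_trans (ler_Re_cabs _))// cabs_zeta.
  by rewrite ler_norml => /andP[]; lra.
move: (1 - _) u0 u2 => u u0 u2.
set Dm := 2 + m * _ * u; set Dk := 2 + k * _ * u.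
have Dm2 : 2 <= Dm by rewrite lerDl mulr_ge0// mulr_ge0// addr_ge0.
have Dk2 : 2 <= Dk by rewrite lerDl mulr_ge0// mulr_ge0// addr_ge0.
have Dm0 : 0 < Dm by exact: lt_le_trans Dm2.
have Dk0 : 0 < Dk by exact: lt_le_trans Dk2.
(* Once [m - k] is factored out, the numerator is at most [2 * 10] and both inverses are at most
   1/2, whence the constant 5. *)
have -> : 2 * (1 + m) / Dm - 2 * (1 + k) / Dk =
   (m - k) * (2 * ((2 - u) - (1 + m) * (1 + k) * u) * (Dm^-1 * Dk^-1)).
  by rewrite /Dm /Dk; field; rewrite !gt_eqF.
rewrite normrM mulrC ler_wpM2r// !normrM [`|2|]ger0_norm//.
have i1 : `|Dm^-1| <= 1 / 2.
  by rewrite ger0_norm ?invr_ge0 ?(ltW Dm0)// div1r lef_pV2 ?posrE.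
have i2 : `|Dk^-1| <= 1 / 2.
  by rewrite ger0_norm ?invr_ge0 ?(ltW Dk0)// div1r lef_pV2 ?posrE.
have i3 : `|(2 - u) - (1 + m) * (1 + k) * u| <= 10.
  have p0 : 0 <= (1 + m) * (1 + k) * u by rewrite !mulr_ge0// addr_ge0.
  have p1 : (1 + m) * (1 + k) * u <= 2 * 2 * 2.
    by rewrite ler_pM// ?mulr_ge0 ?addr_ge0// ler_pM ?addr_ge0//; lra.
  by rewrite ler_norml; apply/andP; split; lra.
have i4 : `|Dm^-1| * `|Dk^-1| <= 1 / 2 * (1 / 2) by rewrite ler_pM.
have : `|(2 - u) - (1 + m) * (1 + k) * u| * (`|Dm^-1| * `|Dk^-1|) <= 10 * (1 / 2 * (1 / 2)).
  by rewrite ler_pM// mulr_ge0.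
by lra.
Qed.

Hypothesis sg0 : forall x, sg [set x] = 0%E.

Lemma small_itv (t0 e : R) : 0 < e -> exists2 d, 0 < d & fine (sg `[t0 - d, t0 + d]%classic) <= e.
Proof.
move=> e0; pose I n := `[t0 - n.+1%:R^-1, t0 + n.+1%:R^-1]%classic : set R.
have cI : \bigcap_n I n = [set t0].
  apply/seteqP; split => [x h|x -> n _]; last first.
    by rewrite /I /= in_itv/= gerBl lerDl invr_ge0 ler0n.
  apply/eqP; rewrite -subr_eq0 -normr_eq0 eq_le normr_ge0 andbT.
  suff H : forall d : R, 0 < d -> `|x - t0| <= d by apply/ler_addgt0Pr => d d0; rewrite add0r H.
  move=> d d0.
  have := @cvg_harmonic R => /cvgrPdist_lt /(_ _ d0) [n _ /(_ n (leqnn n))] /=.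
  rewrite sub0r normrN ger0_norm ?invr_ge0 ?ler0n// => hn.
  have := h n (Logic.I); rewrite /I /= in_itv/= => /andP[h1 h2].
  apply: le_trans (ltW hn); move: (n.+1%:R^-1) h1 h2 => u h1 h2.
  by rewrite ler_norml; apply/andP; split; lra.
have mI n : measurable (I n) by exact: measurable_itv.
have c : sg \o I @ \oo --> sg (\bigcap_n I n).
  apply: nonincreasing_cvg_mu => //.
  - by rewrite ltey_eq fin_num_measure.
  - exact: bigcapT_measurable.
  - apply/nonincreasing_seqP => n; apply/subsetPset => x; rewrite /I /= !in_itv/= => /andP[h1 h2].
    have h3 : (n.+2%:R^-1 : R) <= n.+1%:R^-1 by rewrite lef_pV2 ?posrE ?ltr0n// ler_nat.
    by apply/andP; split; [apply: le_trans h1|apply: le_trans h2 _]; rewrite ?lerD2l ?lerN2.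
rewrite cI sg0 in c.
have c' : (fun n => fine (sg (I n))) @ \oo --> (0 : R).
  by apply: (@fine_cvg _ _ _ _ (sg \o I) 0).
move/cvgrPdist_lt : c' => /(_ _ e0) [n _ /(_ n (leqnn n))] /=.
rewrite sub0r normrN ger0_norm ?fine_ge0// => hn.
by exists n.+1%:R^-1; [rewrite invr_gt0 ltr0n|exact: ltW].
Qed.

End KernelStability.

(** * The truncated Cantor sets and their exceptional null set *)

Section Family.
Variable R : realType.
Local Notation zeta := (@zeta R).
Local Notation E := (@cantor_compact R).

Definition sgC : {finite_measure set R -> \bar R} := @cantorm R.
(** Half-open on the right: [arcA 0] is empty, which makes the first symbol constant, and [arcA 1]
    omits the point 1, hence stays in [[0,1)]. *)
Definition arcA (s : R) : set R := E `&` `[0, s[%classic.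

Lemma measurable_arcA s : measurable (arcA s).
Proof. by apply: measurableI; [exact: measurable_cantor|exact: measurable_itv]. Qed.

Lemma cantor0 : E 0.
Proof.
have c0 : cantorf (0 : R) = 0.
  have := cantorfE (0 : R); rewrite /dbl /bit mulr0 ifF ?subr0 ?mulr0 ?add0r; first by lra.
  by apply/negbTE; rewrite -ltNge divr_gt0.
by move=> n _; rewrite -c0; exact: cantorf_level.
Qed.

(** The Cantor set is closed, so [|x - t|] stays away from 0, and also from 1 since [0 < t < 1]. The
    chord is [2 * sin (pi * |x - t|)], bounded below by the minimum of the sine over
    [[d', 1 - d']]. *)
Lemma cantor_away t : Icirc R t -> ~ E t -> exists c, away E (zeta t) c.
Proof.
rewrite /Icirc /= in_itv/= => /andP[t0 t1] nE.
have tn0 : t != 0 by apply/eqP => h; apply: nE; rewrite h; exact: cantor0.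
have tp : 0 < t by rewrite lt_neqAle eq_sym tn0.
have oE : open (~` E) by apply: closed_openC; exact: closed_cantor.
have [d /= d0 hd] : \forall x \near t, (~` E) x by exact: open_nbhs_nbhs.
pose d' := Num.min (d / 2) (Num.min (t / 2) ((1 - t) / 2)).
have d'0 : 0 < d'.
  by rewrite !lt_min !divr_gt0// subr_gt0.
have d'1 : d' <= d / 2 by rewrite ge_min lexx.
have d'2 : d' <= t / 2 by rewrite !ge_min lexx orbT.
have d'3 : d' <= (1 - t) / 2 by rewrite !ge_min lexx !orbT.
have far x : E x -> d' <= `|x - t| <= 1 - d'.
  move=> Ex; have := cantor_sub01 Ex; rewrite /= in_itv/= => /andP[x0 x1].
  apply/andP; split; last by rewrite ler_norml; apply/andP; split; lra.
  rewrite leNgt; apply/negP => h; apply: (hd x _ Ex) => /=.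
  by rewrite distrC; lra.
have ab : d' <= 1 - d' by lra.
pose g (u : R) := sin (pi * u).
have cg : {within `[d', 1 - d'], continuous g}.
  apply: continuous_subspaceT => x.
  apply: (@continuous_comp _ _ _ ( *%R pi) sin); first exact: mulrl_continuous.
  exact: continuous_sin.
have [c hc1 hc2] := EVT_min ab cg.
have p0 := @pi_gt0 R.
have g0 : 0 < g c.
  move: hc1; rewrite in_itv/= => /andP[h1 h2]; apply: sin_gt0_pi.
  rewrite mulr_gt0//= ?(lt_le_trans d'0 h1)//.
  have c1 : c < 1 by lra.
  by rewrite gtr_pMr.
exists (2 * g c); split; [by rewrite mulr_gt0|].
move=> x Ex; rewrite -(@ler_pXn2r _ 2) ?nnegrE ?mulr_ge0 ?(ltW g0)// cabs_sqr csq_zetaB.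
have -> : sin (pi * (x - t)) ^+ 2 = g `|x - t| ^+ 2.
  by rewrite /g; have [h|h] := ger0P (x - t) => //; rewrite mulrN sinN sqrrN.
rewrite exprMn (_ : 2 ^+ 2 = 4 :> R); last by ring.
rewrite ler_wpM2l// lerXn2r ?nnegrE ?(ltW g0)//.
  by apply: le_trans (ltW g0) _; apply: hc2; rewrite in_itv/=; exact: far.
by apply: hc2; rewrite in_itv/=; exact: far.
Qed.

Lemma away_sub (A B : set R) z c : A `<=` B -> away B z c -> away A z c.
Proof. by move=> AB [c0 h]; split => // x /AB; exact: h. Qed.

Lemma arcA_away s t : Icirc R t -> ~ E t -> exists c, away (arcA s) (zeta t) c.
Proof.
by move=> h1 h2; have [c hc] := cantor_away h1 h2; exists c; apply: away_sub hc => x [].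
Qed.

Definition badset : set R := E `|` ~` Icirc R.

Lemma measurable_badset : measurable badset.
Proof.
by apply: measurableU; [exact: measurable_cantor|apply: measurableC; exact: measurable_Icirc].
Qed.

Lemma lam_badset : lam R badset = 0%E.
Proof.
rewrite lamE (_ : _ `&` _ = E `&` Icirc R).
  apply/eqP; rewrite eq_le measure_ge0 andbT -[leRHS](lebm_cantor R).
  apply: le_measure; rewrite ?inE//; first by
    apply: measurableI; [exact: measurable_cantor|exact: measurable_Icirc].
  exact: measurable_cantor.
by apply/seteqP; split => x; [move=> [[|//]]|move=> [h1 h2]; split => //; left].
Qed.

Lemma arcA_good s : {ae lam R, forall t, exists c, away (arcA s) (zeta t) c}.
Proof.
exists badset; split; [exact: measurable_badset|exact: lam_badset|].
move=> t /= h; apply: contrapT => nb; apply: h; apply: arcA_away.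
  by apply: contrapT => h; apply: nb; right.
by move=> h; apply: nb; left.
Qed.

(** [zeta] is injective on [[0,1)], so at most one point of [arcA s] lies over [zeta t0], and single
    points are null for the Cantor measure. *)
Lemma arcA_noatom s t0 : s <= 1 -> {ae sgC, forall x, arcA s x -> zeta x != zeta t0}.
Proof.
move=> s1.
have aI x : arcA s x -> 0 <= x < 1.
  by move=> [_]; rewrite /= in_itv/= => /andP[x0 xs]; rewrite x0 (lt_le_trans xs).
have [[x0 [hx0 ex0]]|nex] := pselect (exists x0, arcA s x0 /\ zeta x0 = zeta t0).
  exists [set x0]; split => //; first exact: cantorm_set1.
  move=> x /= /not_implyP [hx]; move/negP; rewrite negbK => /eqP ex.
  by apply: zeta_inj; [exact: aI|exact: aI|rewrite ex].
exists set0; split => // x /= /not_implyP [hx]; move/negP; rewrite negbK => /eqP ex.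
by apply: nex; exists x.
Qed.

End Family.

Section RealIntegrable.
Context d (T : measurableType d) (R : realType) (mu : {measure set T -> \bar R}).
Implicit Types f g : T -> R.

Lemma rintegrableD f g : mu.-integrable setT (EFin \o f) -> mu.-integrable setT (EFin \o g) ->
  mu.-integrable setT (EFin \o (fun x => f x + g x)).
Proof. by move=> mf mg; exact: (integrableD measurableT mf mg). Qed.

Lemma rintegrableB f g : mu.-integrable setT (EFin \o f) -> mu.-integrable setT (EFin \o g) ->
  mu.-integrable setT (EFin \o (fun x => f x - g x)).
Proof. by move=> mf mg; exact: (integrableB measurableT mf mg). Qed.

Lemma rintegrableZ c f : mu.-integrable setT (EFin \o f) ->
  mu.-integrable setT (EFin \o (fun x => c * f x)).
Proof. by move=> mf; exact: (integrableZl measurableT c mf). Qed.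

Lemma rintegrable_norm f : mu.-integrable setT (EFin \o f) ->
  mu.-integrable setT (EFin \o (fun x => `|f x|)).
Proof. by move=> mf; exact: (integrable_norm mf). Qed.

End RealIntegrable.

(** * Continuity of the kernels in the parameter, uniformly in [a] *)

Section Continuity.
Variable R : realType.
Local Notation zeta := (@zeta R).
Local Notation sgC := (@sgC R).
Local Notation arcA := (@arcA R).

Lemma sgC_setT : sgC setT = 1%E.
Proof. by rewrite /sgC /= /cantorm preimage_setT; have := lamT R => /= ->. Qed.

Lemma mass_le1 A : measurable A -> mass sgC A <= 1.
Proof.
move=> mA; rewrite -lee_fin fineK ?fin_num_measure// -sgC_setT.
by apply: le_measure; rewrite ?inE.
Qed.

Definition windowC (t d : R) : set R := `[t - d, t + d]%classic.

Lemma arcA_indic_diff s t d x : `|s - t| <= d ->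
  `|\1_(arcA s) x - \1_(arcA t) x| <= \1_(windowC t d) x :> R.
Proof.
move=> sd; rewrite ![\1_ _ x]indicE.
have [/set_mem xs|xs] := boolP (x \in arcA s);
  have [/set_mem xt|xt] := boolP (x \in arcA t); rewrite /= ?subrr ?subr0 ?normr0 ?ler0n//.
- rewrite normr1 mem_set//; move: xs xt sd; rewrite ler_norml notin_setE.
  move=> [Ex]; rewrite /windowC /= !in_itv/= => /andP[x0 xs] xt /andP[h1 h2].
  have tx : t <= x.
    by rewrite leNgt; apply/negP => h; apply: xt; split => //=; rewrite in_itv/= x0.
  by apply/andP; split; lra.
- rewrite sub0r normrN1 mem_set//; move: xs xt sd; rewrite ler_norml notin_setE.
  move=> xs [Ex]; rewrite /windowC /= !in_itv/= => /andP[x0 xt] /andP[h1 h2].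
  have tx : s <= x.
    by rewrite leNgt; apply/negP => h; apply: xs; split => //=; rewrite in_itv/= x0.
  by apply/andP; split; lra.
Qed.

Let mW t d : measurable (windowC t d). Proof. exact: measurable_itv. Qed.

Let integrable_indic_sg A : measurable A -> sgC.-integrable setT (EFin \o (\1_A : R -> R)).
Proof.
move=> mA; apply: (@integrable_bounded_real _ _ _ _ _ 1); first exact: sg_lty.
  exact: measurable_indic.
by move=> x; have /andP[a b] := indic_le1 A x; rewrite ger0_norm.
Qed.

Let measurable_diff s t : measurable_fun setT (fun x => `|\1_(arcA s) x - \1_(arcA t) x| : R).
Proof.
apply: measurableT_comp => //; apply: measurable_funB; apply: measurable_indic;
  exact: measurable_arcA.
Qed.

Let integrable_diff s t :
  sgC.-integrable setT (EFin \o (fun x => `|\1_(arcA s) x - \1_(arcA t) x| : R)).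
Proof.
apply: (@integrable_bounded_real _ _ _ _ _ 1); [exact: sg_lty|exact: measurable_diff|].
move=> x; rewrite normr_id ![\1_ _ x]indicE.
by do 2 case: (_ \in _); rewrite ?subrr ?subr0 ?sub0r ?normrN ?normr1 ?normr0.
Qed.

Definition arc_dist s t : R := \int[sgC]_x `|\1_(arcA s) x - \1_(arcA t) x|.

Lemma arc_dist_le s t d : `|s - t| <= d -> arc_dist s t <= mass sgC (windowC t d).
Proof.
move=> sd; rewrite /mass -Rintegral_indic//; apply: le_Rintegral => //.
  exact: integrable_indic_sg.
by move=> x _; exact: arcA_indic_diff.
Qed.

Lemma arc_dist_mass s t : `|mass sgC (arcA s) - mass sgC (arcA t)| <= arc_dist s t.
Proof.
rewrite /mass -!Rintegral_indic; [|exact: measurable_arcA..].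
have i u := integrable_indic_sg (measurable_arcA u).
rewrite -RintegralB//; apply: (le_trans (le_normr_Rintegral _ _)) => //.
exact: rintegrableB.
Qed.

(** The integrands differ only for [y] in the window around [t]. There
    [|zeta y - zeta t| <= eta / 2], so [|zeta y - zeta x| >= eta / 2] and the Herglotz kernel is at
    most [4 / eta]; [cabs_cint] doubles this. *)
Lemma Fh_arc_diff s t d eta x : 0 < eta -> `|s - t| <= d -> 2 * pi * d <= eta / 2 ->
  Icirc R x -> ~ cantor_compact x -> eta <= cabs (zeta x - zeta t) ->
  cabs (Fh sgC (arcA s) (zeta x) - Fh sgC (arcA t) (zeta x)) <=
  8 / eta * mass sgC (windowC t d).
Proof.
move=> e0 sd hd Ix nE hx.
have ig u : cintegr sgC (fun y => (\1_(arcA u) y)%:C%C * herglotz y (zeta x)).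
  have [c hc] := arcA_away u Ix nE.
  exact: (cintegr_herglotz sgC (measurable_arcA u) (zeta_le1 x) hc).
rewrite /Fh opprD addrACA subrr add0r -cintB//.
apply: le_trans (_ : 2 * \int[sgC]_y (4 / eta * \1_(windowC t d) y) <= _).
  apply: cabs_cint; first exact: cintegrB.
    by apply: rintegrableZ; exact: integrable_indic_sg.
  move=> y; rewrite -mulrBl -rmorphB cabsM cabsr.
  have h := arcA_indic_diff y sd; rewrite mulrC.
  have [->|hn] := eqVneq (\1_(arcA s) y - \1_(arcA t) y : R) 0.
    by rewrite normr0 mulr0 mulr_ge0 ?divr_ge0 ?(ltW e0)//; have /andP[] := indic_le1 (windowC t d) y.
  have yW : windowC t d y.
    apply: contrapT => /(memNset (A:=windowC t d)) => hw; move: h.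
    by rewrite [\1_(windowC t d) y]indicE hw normr_le0 (negbTE hn).
  apply: ler_pM => //.
  have hy : eta / 2 <= cabs (zeta y - zeta x).
    have := ler_cabsDB (zeta y) (zeta x) (zeta t).
    have := zeta_lip y t; have : `|y - t| <= d.
      by move: yW; rewrite /windowC /= in_itv/= ler_norml => /andP[h1 h2]; apply/andP; split; lra.
    have p0 : 0 <= 2 * pi :> R by rewrite mulr_ge0// pi_ge0.
    move=> /(ler_wpM2l p0) h1 h2; rewrite (cabsBC (zeta x) (zeta y)) => h3; lra.
  rewrite /herglotz cabsM cabsV.
  have -> : 4 / eta = 2 / (eta / 2) by field; rewrite gt_eqF.
  rewrite ler_pM ?invr_ge0//.
    by rewrite (le_trans (ler_cabsD _ _))// !cabs_zeta -[2]/(1 + 1).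
  by rewrite lef_pV2 ?posrE// ?divr_gt0//; apply: lt_le_trans hy; rewrite divr_gt0.
rewrite RintegralZl//; last exact: integrable_indic_sg.
by rewrite Rintegral_indic// /mass; lra.
Qed.

(** The pointwise form of Scheffe's trick: a one-sided bound on [y - x] controls [|x - y|] up to the
    term [x - y], whose integral is merely a difference of total masses. *)
Lemma norm_sub_le (x y c : R) : 0 <= c -> y - x <= c -> `|x - y| <= x - y + 2 * c.
Proof. by rewrite ler_norml => *; apply/andP; split; lra. Qed.

(** Four errors are balanced: the difference of the total masses, the change of [K] away from [t],
    the kernel mass near [t], and a null set. [arc_dist] appears separately because at [zeta a = 1]
    both kernels are identically 1 and the change sits in the atom. *)
Lemma kk_continuous t e : 0 <= t <= 1 -> 0 < e -> exists2 d, 0 < d &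
  forall s, 0 <= s <= 1 -> `|s - t| < d -> arc_dist s t <= e /\
   forall a, \int[lam R]_x `|kk sgC (arcA s) a x - kk sgC (arcA t) a x| <= e.
Proof.
move=> /andP[t0 t1] e0.
have e8 : 0 < e / 8 by rewrite divr_gt0.
have [eta eta0 hnear] := near_mass (measurable_arcA t) (arcA_good t) (arcA_noatom t t1) e8.
(* [dl] will bound the change of [K] away from [t]. Its contribution is [6 * dl] times a mass of at
   most 2, hence at most [e / 4]. *)
pose dl := Num.min 1 (e / 48).
have dl0 : 0 < dl by rewrite lt_min ltr01 divr_gt0.
have dl1 : dl <= 1 by rewrite ge_min lexx.
have dle : dl <= e / 48 by rewrite ge_min lexx orbT.
(* [e / 20] meets the constant 5 of [poisson_phih0_lip] and yields [e / 4]; [dl * eta / 8]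
   compensates the factor [8 / eta] of [Fh_arc_diff]. *)
pose w := Num.min (e / 20) (dl * eta / 8).
have w0 : 0 < w by rewrite lt_min !divr_gt0// mulr_gt0.
have [d1 d10 hd1] := @small_itv _ sgC (@cantorm_set1 R) t w w0.
pose d := Num.min d1 (eta / (4 * pi)).
have p0 := @pi_gt0 R.
have d0 : 0 < d by rewrite lt_min d10 divr_gt0// mulr_gt0.
have dpi : 2 * pi * d <= eta / 2.
  have h : d <= eta / (4 * pi) by rewrite ge_min lexx orbT.
  have p20 : 0 <= 2 * pi :> R by rewrite mulr_ge0// ltW.
  apply: (le_trans (ler_wpM2l p20 h)).
  have fe (P : R) : P != 0 -> 2 * P * (eta / (4 * P)) = eta / 2 by move=> ?; field.
  by rewrite fe// gt_eqF.
have hW : mass sgC (windowC t d) <= w.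
  apply: le_trans hd1; apply: fine_le; rewrite ?fin_num_measure//.
  apply: le_measure; rewrite ?inE//.
  have h : d <= d1 by rewrite ge_min lexx.
  by move=> x; rewrite /windowC /= !in_itv/= => /andP[h1 h2]; apply/andP; split; lra.
have hwe : w <= e / 20 by rewrite ge_min lexx.
have hwd : w <= dl * eta / 8 by rewrite ge_min lexx orbT.
exists d => // s /andP[s0 s1] /ltW sd; split.
  by apply: (le_trans (arc_dist_le sd)); lra.
move=> a; have [ha|ha] := eqVneq (zeta a) 1.
  under eq_Rintegral do rewrite !kk_one// subrr normr0.
  by rewrite Rintegral_cst// mul0r ltW.
pose x0 u := kk sgC (arcA u) a.
have x0E u y : kk sgC (arcA u) a y = x0 u y by [].
have k0 u y : 0 <= x0 u y by exact: kk_ge0.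
have ik u : (lam R).-integrable setT (EFin \o x0 u).
  by apply: integrable_kkr; [exact: lamT_lty|exact: measurable_arcA].
have m u : \int[lam R]_y x0 u y = poisson (phih sgC (arcA u) 0) a.
  rewrite -kk_mass; [|exact: measurable_arcA|exact: arcA_good].
  by rewrite (negbTE ha) mul0r addr0.
have m0 u : measurable_fun setT (x0 u) by apply: measurable_kkr; exact: measurable_arcA.
have [B hB] : exists B, forall y, x0 t y <= B := kk_bounded sgC (arcA t) a.
have hnear0 : \int[lam R]_y (\1_(nearset t eta) y * x0 t y) <= e / 8 by exact: hnear.
under eq_Rintegral do rewrite !x0E.
clearbody x0.
pose N := nearset t eta.
have mN : measurable N by exact: measurable_nearset.
have mb := @measurable_badset R.
have iN : (lam R).-integrable setT (EFin \o (fun y => \1_N y * x0 t y)).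
  apply: (@integrable_bounded_real _ _ _ _ _ B); first exact: lamT_lty.
    by apply: measurable_funM; [exact: measurable_indic|exact: m0].
  move=> y; have /andP[i0 i1] := indic_le1 N y.
  have q0 : 0 <= \1_N y * x0 t y by exact: mulr_ge0.
  rewrite ger0_norm//. exact: (le_trans (ler_piMl (k0 t y) i1) (hB y)).
have ib : (lam R).-integrable setT (EFin \o (fun y => \1_(@badset R) y : R)).
  apply: (@integrable_bounded_real _ _ _ _ _ 1); first exact: lamT_lty.
    exact: measurable_indic.
  by move=> y; have /andP[i0 i1] := indic_le1 (@badset R) y; rewrite ger0_norm.
(* On the bad set and near [t], the difference [x0 t y - x0 s y] is bounded by [x0 t y] itself.
   Elsewhere [kk_stable] applies, with [(1 + dl) ^+ 2 <= 1 + 3 * dl]; [norm_sub_le] doubles all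
   three coefficients. *)
have pw y : `|x0 s y - x0 t y| <= x0 s y - x0 t y + 6 * dl * x0 s y +
    2 * (\1_N y * x0 t y) + 2 * B * \1_(@badset R) y.
  have b0 : 0 <= B by exact: le_trans (k0 t y) (hB y).
  have /andP[iN0 iN1] := indic_le1 N y; have /andP[ib0 ib1] := indic_le1 (@badset R) y.
  have q1 : 0 <= \1_N y * x0 t y by rewrite mulr_ge0.
  have q2 : 0 <= B * \1_(@badset R) y by rewrite mulr_ge0.
  have q3 : 0 <= 3 * dl * x0 s y by apply: mulr_ge0; [apply: mulr_ge0; [exact: ler0n|exact: ltW]|exact: k0].
  pose c := 3 * dl * x0 s y + \1_N y * x0 t y + B * \1_(@badset R) y.
  have c0 : 0 <= c by rewrite !addr_ge0.
  suff cP : x0 t y - x0 s y <= c.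
    by apply: le_trans (norm_sub_le c0 cP) _; rewrite /c le_eqVlt; apply/orP; left; apply/eqP; ring.
  have [/set_mem yb|/negP yb] := boolP (y \in @badset R).
    have e1 : \1_(@badset R) y = 1 :> R by rewrite indicE mem_set.
    rewrite lerBlDr ler_wpDr// /c e1 mulr1 ler_wpDl ?addr_ge0//; exact: hB.
  have [/set_mem yN|/negP yN] := boolP (y \in N).
    have e1 : \1_N y = 1 :> R by rewrite indicE mem_set.
    by rewrite lerBlDr ler_wpDr// /c e1 mul1r ler_wpDr// ler_wpDl.
  rewrite /c -addrA ler_wpDr ?addr_ge0// lerBlDr.
  have Iy : Icirc R y by apply: contrapT => h; apply: yb; rewrite inE; right.
  have nEy : ~ cantor_compact y by move=> h; apply: yb; rewrite inE; left.
  have hy : eta <= cabs (zeta y - zeta t) by rewrite leNgt; apply/negP => h; apply: yN; rewrite inE.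
  have st : x0 t y <= (1 + dl) ^+ 2 * x0 s y.
    rewrite -!x0E; apply: kk_stable; rewrite -ImB; apply: (le_trans (ler_Im_cabs _)).
    apply: (le_trans (Fh_arc_diff eta0 sd dpi Iy nEy hy)).
    have e0' : 0 <= 8 / eta by rewrite divr_ge0// ltW.
    apply: (le_trans (ler_wpM2l e0' (le_trans hW hwd))).
    by rewrite (_ : 8 / eta * (dl * eta / 8) = dl)//; field; rewrite gt_eqF.
  apply: (le_trans st); rewrite -[X in _ <= _ + X]mul1r -mulrDl ler_wpM2r//.
  by rewrite (_ : (1 + dl) ^+ 2 = dl * dl + 2 * dl + 1); [have := ler_piMl (ltW dl0) dl1; lra|ring].
have i1 := rintegrableB (ik s) (ik t).
have i2 := rintegrableZ (6 * dl) (ik s).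
have i3 := rintegrableZ 2 iN.
have i4 := rintegrableZ (2 * B) ib.
have i12 := rintegrableD i1 i2.
have i123 := rintegrableD i12 i3.
apply: le_trans (_ : \int[lam R]_y (x0 s y - x0 t y + 6 * dl * x0 s y +
    2 * (\1_N y * x0 t y) + 2 * B * \1_(@badset R) y) <= _).
  apply: le_Rintegral => //; last exact: rintegrableD.
  exact: rintegrable_norm.
rewrite RintegralD// RintegralD// RintegralD// RintegralB// !RintegralZl// !m.
rewrite Rintegral_indic// (_ : fine (lam R (@badset R)) = 0); last by rewrite lam_badset.
move: hnear0; rewrite -/N.
have := poisson_phih0_lip a (measurable_arcA s) (measurable_arcA t)
  (mass_le1 (measurable_arcA s)) (mass_le1 (measurable_arcA t)).
have dm : `|mass sgC (arcA s) - mass sgC (arcA t)| <= e / 20.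
  by apply: le_trans hwe; apply: le_trans hW; apply: le_trans (arc_dist_mass _ _) (arc_dist_le sd).
rewrite ler_norml => /andP[_ h1] h2.
have ps : poisson (phih sgC (arcA s) 0) a <= 2.
  apply: (le_trans (poisson_phih0_le sgC a (measurable_arcA s))).
  by rewrite (_ : 2 = 1 + 1)// lerD2l; exact: mass_le1 (measurable_arcA s).
have h3 : dl * poisson (phih sgC (arcA s) 0) a <= e / 48 * 2.
  by apply: ler_pM => //; [exact: ltW|rewrite -m; exact: Rintegral_ge0].
have sum (P Q I D : R) : P - Q <= 5 * D -> I <= e / 8 -> D <= e / 20 ->
    dl * P <= e / 48 * 2 -> P - Q + 6 * dl * P + 2 * I <= e.
  by rewrite -[6 * dl * _]mulrA; move: (dl * P) e0; clear => U; lra.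
by rewrite mulr0 addr0; exact: sum h1 h2 dm h3.
Qed.

End Continuity.

(** * Finite measures tested on bounded measurable functions *)

Section BoundedMeasurable.
Context d (T : measurableType d) (R : realType).
Implicit Types (m : {finite_measure set T -> \bar R}) (g h : T -> R).

Definition bmf g := measurable_fun setT g /\ exists M, forall x, `|g x| <= M.

Lemma finm_lty m : (m setT < +oo)%E.
Proof. by rewrite ltey_eq fin_num_measure. Qed.

Lemma bmf_integrable m g : bmf g -> m.-integrable setT (EFin \o g).
Proof. by move=> [mg [M gM]]; apply: (integrable_bounded_real (finm_lty m) mg gM). Qed.

Lemma bmf_indic A : measurable A -> bmf (\1_A : T -> R).
Proof.
move=> mA; split; first exact: measurable_indic.
by exists 1 => x; rewrite indicE; case: (x \in A); rewrite ?normr1 ?normr0.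
Qed.

Lemma bmfM g h : bmf g -> bmf h -> bmf (fun x => g x * h x).
Proof.
move=> [mg [M gM]] [mh [N hN]]; split; first exact: measurable_funM.
by exists (M * N) => x; rewrite normrM ler_pM.
Qed.

Lemma bmfB g h : bmf g -> bmf h -> bmf (fun x => g x - h x).
Proof.
move=> [mg [M gM]] [mh [N hN]]; split; first exact: measurable_funB.
by exists (M + N) => x; rewrite (le_trans (ler_normB _ _))// lerD.
Qed.

Lemma bmf_cst c : bmf (cst c : T -> R).
Proof. by split; [exact: measurable_cst|exists `|c| => x]. Qed.

Lemma integrableM_bmf (m : {measure set T -> \bar R}) g h : bmf g -> m.-integrable setT (EFin \o h) ->
  m.-integrable setT (EFin \o (fun x => g x * h x)).
Proof.
move=> [mg [M gM]] ih; have /measurable_EFinP mh := measurable_int _ ih.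
apply: (le_integrable measurableT _ _ (rintegrableZ `|M| (rintegrable_norm ih))).
  by apply/measurable_EFinP; exact: measurable_funM.
move=> x _ /=; rewrite lee_fin !normrM !normr_id ler_wpM2r//.
exact: le_trans (gM x) (ler_norm _).
Qed.

Lemma eq_Rintegral_measure m1 m2 g : (forall A, measurable A -> m1 A = m2 A) ->
  \int[m1]_x g x = \int[m2]_x g x.
Proof.
by move=> e; rewrite /Rintegral; congr fine; apply: eq_measure_integral => A mA _; exact: e.
Qed.

Lemma add_exists m1 m2 : exists m : {finite_measure set T -> \bar R},
  forall g, bmf g -> \int[m]_x g x = \int[m1]_x g x + \int[m2]_x g x.
Proof.
pose m : {measure set T -> \bar R} := measure_add m1 m2.
have mT : (m setT < +oo)%E by change (measure_add m1 m2 setT < +oo)%E; rewrite measure_addE lte_add_pinfty// finm_lty.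
exists (mfrestr measurableT mT) => g bg.
have i1 := bmf_integrable m1 bg; have i2 := bmf_integrable m2 bg; have [mg _] := bg.
rewrite (_ : \int[_]_x g x = \int[m]_x g x).
  have mE := integral_measure_add measurableT i1 i2.
  by rewrite /Rintegral mE fineD//; exact: integrable_fin_num.
rewrite /Rintegral; congr fine; apply: eq_measure_integral => A mA _.
by rewrite /= /mfrestr /mrestr setIT.
Qed.

(** Set integrals of [h] define the measure. For general [g] the formula comes from the
    Radon-Nikodym change of variables, the derivative of the new measure being almost everywhere
    [h]. *)
Lemma dens_exists m h : (forall x, 0 <= h x) -> m.-integrable setT (EFin \o h) ->
  exists m' : {finite_measure set T -> \bar R},
  forall g, bmf g -> \int[m']_x g x = \int[m]_x (g x * h x).
Proof.
move=> h0 ih; pose nu A := (\int[m]_(x in A) (h x)%:E)%E.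
have nu0 : nu set0 = 0%E by rewrite /nu integral_set0.
have nu_ge0 A : (0 <= nu A)%E by apply: integral_ge0 => x _; rewrite lee_fin.
have snu : semi_sigma_additive nu.
  apply: semi_sigma_additive_nng_induced => //; exact: measurable_int ih.
pose nuM := isMeasure.Build _ _ _ nu nu0 nu_ge0 snu.
pose num : {measure set T -> \bar R} := HB.pack nu nuM.
have numT : (num setT < +oo)%E.
  by rewrite ltey_eq (_ : num setT \is a fin_num)//; exact: integrable_fin_num.
exists (mfrestr measurableT numT); set m' := mfrestr _ _.
have m'E A : m' A = (\int[m]_(x in A) (h x)%:E)%E.
  by rewrite /m' /mfrestr /mrestr setIT.
have dom : m' `<< m.
  apply/null_content_dominatesP => A mA mA0; rewrite m'E.
  by apply: null_set_integral => //; apply: measurable_funTS; exact: measurable_int ih.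
move=> g bg; have ig := bmf_integrable m' bg.
rewrite /Rintegral -(Radon_Nikodym_change_of_variables dom)//; congr fine.
have ae : ae_eq m setT (Radon_Nikodym (charge_of_finite_measure m') m) (EFin \o h).
  apply: integral_ae_eq => //; first exact: Radon_Nikodym_integrable.
    exact: measurable_int ih.
  by move=> A _ mA; rewrite -Radon_Nikodym_integral.
apply: ae_eq_integral => //.
- apply: emeasurable_funM; first exact: measurable_int ig.
  by apply: measurable_int; exact: Radon_Nikodym_integrable.
- by apply: (@measurable_int _ _ _ m); exact: integrableM_bmf.
- by move: ae; apply: filterS => x /= hx _; rewrite hx// EFinM.
Qed.

End BoundedMeasurable.

(** * Complex measures through their four positive components *)

Section ComplexMeasure.
Variable R : realType.
Local Notation zeta := (@zeta R).
Implicit Types (m : {finite_measure set R -> \bar R}) (r : cmrep R) (g : R -> R).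

Lemma circ_lty m : (m (Icirc R) < +oo)%E.
Proof. by rewrite ltey_eq fin_num_measure//; exact: measurable_Icirc. Qed.

(** [cm_set] sees its components only on [[0,1)]; restricting them first turns the integrals of
    [cm_int] into integrals over the line. *)
Definition circ m : {finite_measure set R -> \bar R} := mfrestr (@measurable_Icirc R) (circ_lty m).

Lemma circE m A : circ m A = m (A `&` Icirc R).
Proof. by []. Qed.

Lemma circI m A : measurable A -> circ m A = circ m (A `&` Icirc R).
Proof. by move=> mA; rewrite !circE -setIA setIid. Qed.

Lemma Rintegral_circ m g : measurable_fun setT g ->
  \int[circ m]_x g x = fine (\int[m]_(x in Icirc R) (g x)%:E)%E.
Proof.
move=> mg; rewrite /Rintegral; congr fine.
by apply: (@integral_mrestr _ _ _ m _ (@measurable_Icirc R)); exact/measurable_EFinP.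
Qed.

Lemma Rintegral_circ_indic m g : measurable_fun setT g ->
  \int[circ m]_x g x = \int[m]_x (\1_(Icirc R) x * g x).
Proof.
move=> mg; rewrite Rintegral_circ// /Rintegral; congr fine.
rewrite [LHS]integral_mkcond; apply: eq_integral => x _.
by rewrite patchE indicE; case: (x \in _); rewrite ?mul1r ?mul0r.
Qed.

Definition cI r g : R[i] :=
  Complex (\int[circ (cm1 r)]_x g x - \int[circ (cm2 r)]_x g x)
          (\int[circ (cm3 r)]_x g x - \int[circ (cm4 r)]_x g x).

Lemma cm_intE r g : measurable_fun setT g -> cm_int r g = cI r g.
Proof. by move=> mg; rewrite /cm_int /cI !Rintegral_circ. Qed.

Lemma cm_setE r A : measurable A -> cm_set r A = cI r (\1_A).
Proof.
move=> mA; rewrite /cm_set ifT; last exact/asboolP.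
by rewrite /cI !Rintegral_indic.
Qed.

Lemma cm_set_ext r r' : (forall A, measurable A -> cI r (\1_A) = cI r' (\1_A)) ->
  cm_set r = cm_set r'.
Proof.
move=> h; apply/funext => A; have [mA|nA] := pselect (measurable A).
  by rewrite !cm_setE// h.
by rewrite /cm_set ifF ?ifF//; exact/asboolP.
Qed.

Lemma bmf_poisson z : inD z -> bmf (poisson z : R -> R).
Proof.
move=> hz; split; first exact: measurable_poisson.
by exists ((1 - cabs z) ^+ 2)^-1 => x; rewrite ger0_norm ?poisson_ge0// poisson_le.
Qed.

Lemma sub_eq_add (a b c d : R) : a - b = c - d <-> a + d = c + b.
Proof. by split => h; lra. Qed.

(** Moving the subtracted measures across turns an equality of differences into the equality of two
    positive measures, [m1 + m4] and [m3 + m2]. *)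
Lemma signed_ext (m1 m2 m3 m4 : {finite_measure set R -> \bar R}) :
  (forall A, measurable A -> \int[m1]_x \1_A x - \int[m2]_x \1_A x =
                             \int[m3]_x \1_A x - \int[m4]_x \1_A x) ->
  forall g, bmf g -> \int[m1]_x g x - \int[m2]_x g x = \int[m3]_x g x - \int[m4]_x g x.
Proof.
move=> h g bg; have [m14 h14] := add_exists m1 m4; have [m32 h32] := add_exists m3 m2.
apply/sub_eq_add; rewrite -h14// -h32//; apply: eq_Rintegral_measure => A mA.
have /sub_eq_add := h _ mA; rewrite -(h14 _ (bmf_indic _ mA)) -(h32 _ (bmf_indic _ mA)) !Rintegral_indic//.
by move=> e; have := congr1 (@EFin R) e; rewrite !fineK ?fin_num_measure.
Qed.

Lemma signed_poisson_unique (m1 m2 m3 m4 : {finite_measure set R -> \bar R}) :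
  (forall A, measurable A -> m1 A = m1 (A `&` Icirc R)) ->
  (forall A, measurable A -> m2 A = m2 (A `&` Icirc R)) ->
  (forall A, measurable A -> m3 A = m3 (A `&` Icirc R)) ->
  (forall A, measurable A -> m4 A = m4 (A `&` Icirc R)) ->
  (forall z, inD z -> \int[m1]_x poisson z x - \int[m2]_x poisson z x =
                      \int[m3]_x poisson z x - \int[m4]_x poisson z x) ->
  forall g, bmf g -> \int[m1]_x g x - \int[m2]_x g x = \int[m3]_x g x - \int[m4]_x g x.
Proof.
move=> I1 I2 I3 I4 h g bg; have [m14 h14] := add_exists m1 m4; have [m32 h32] := add_exists m3 m2.
have addI (a b c : {finite_measure set R -> \bar R}) :
    (forall A, measurable A -> a A = a (A `&` Icirc R)) ->
    (forall A, measurable A -> b A = b (A `&` Icirc R)) ->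
    (forall g, bmf g -> \int[c]_x g x = \int[a]_x g x + \int[b]_x g x) ->
    (forall A, measurable A -> c A = c (A `&` Icirc R)).
  move=> ha hb hc A mA; have mAI : measurable (A `&` Icirc R).
    by apply: measurableI => //; exact: measurable_Icirc.
  have := hc _ (bmf_indic _ mA); have := hc _ (bmf_indic _ mAI).
  rewrite !Rintegral_indic// -ha// -hb// => <- e; have := congr1 (@EFin R) e.
  by rewrite !fineK ?fin_num_measure.
apply/sub_eq_add; rewrite -h14// -h32//; apply: eq_Rintegral_measure => A mA.
apply: poisson_unique => //; [|exact: addI h14|exact: addI h32].
move=> z hz; have /sub_eq_add := h _ hz.
by rewrite -(h14 _ (bmf_poisson hz)) -(h32 _ (bmf_poisson hz)).
Qed.

Lemma cI_ext r r' : cm_set r = cm_set r' -> forall g, bmf g -> cI r g = cI r' g.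
Proof.
move=> h g bg; have h' A : measurable A -> cI r (\1_A) = cI r' (\1_A).
  by move=> mA; rewrite -!cm_setE// h.
by rewrite /cI; congr Complex; apply: signed_ext bg => A /h' [].
Qed.

Lemma cI_unique r r' : (forall z, inD z -> cI r (poisson z) = cI r' (poisson z)) ->
  forall g, bmf g -> cI r g = cI r' g.
Proof.
move=> h g bg; rewrite /cI; congr Complex; apply: signed_poisson_unique bg => [A mA|A mA|A mA|A mA|z /h []//];
  exact: circI.
Qed.

(** The representation picked by [epsilon] may differ from [r], but it has the same set function and
    therefore, by [cI_ext], the same integrals. *)
Lemma poisson_intE r z : inD z -> poisson_int (cm_set r) z = cI r (poisson z).
Proof.
move=> hz; rewrite /poisson_int.
have ex : exists v, exists r', cm_set r = cm_set r' /\ v = cm_int r' (poisson z).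
  by exists (cm_int r (poisson z)), r.
have [r' [e ->]] := epsilon_spec (inhabits 0) _ ex.
by rewrite cm_intE ?(cI_ext e)//; [exact: bmf_poisson|exact: measurable_poisson].
Qed.

Lemma cI_cmB r g h : bmf g -> bmf h -> cI r (fun x => g x - h x) = cI r g - cI r h.
Proof.
move=> bg bh; apply: eqC; rewrite ?ReB ?ImB /= !RintegralB//; try exact: bmf_integrable; ring.
Qed.

End ComplexMeasure.

(** * The composition operator as a kernel operator on measures *)

Section Transfer.
Variable R : realType.
Local Notation zeta := (@zeta R).
Variable sg : {finite_measure set R -> \bar R}.
Variable A : set R.
Hypothesis mA : measurable A.
Hypothesis gd : {ae lam R, forall t, exists c, away A (zeta t) c}.
Hypothesis AI : A `<=` Icirc R.
Local Notation kk := (kk sg A).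

Definition atone (a : R) : R := (zeta a == 1)%:R.

Lemma bmf_atone : bmf atone.
Proof.
have m1 : measurable [set a | cRe (zeta a) = 1].
  have [mz _] := cmeas_zeta R; have := mz measurableT [set 1] (measurable_set1 1).
  by rewrite setTI.
rewrite (_ : atone = \1_[set a | cRe (zeta a) = 1]); first exact: bmf_indic.
apply/funext => a; rewrite /atone indicE; congr (_%:R); congr nat_of_bool.
apply/eqP/idP => [h|/set_mem h0].
  by apply/mem_set; exact: (congr1 (@complex.Re R) h).
have h : cRe (zeta a) = 1 by [].
have := csq_zeta a; rewrite /csq h expr1n => /eqP.
rewrite -subr_eq0 addrAC subrr add0r sqrf_eq0 => /eqP h2.
exact: eqC.
Qed.

(** The transpose of the composition operator: integrating [g] against the image of a measure
    amounts to integrating [tau g] against the measure. The second term is the atom at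
    [zeta a = 1]. *)
Definition tau (g : R -> R) (a : R) : R :=
  \int[lam R]_t (g t * kk a t) + atone a * \int[sg]_x (g x * \1_A x).

(** No joint bound on the kernel is available near [zeta a = 1]; Tonelli works with the bound
    [1 + mass sg A] on the integrals in [t], which is uniform in [a]. *)
Lemma kk_prod_integrable (m : {finite_measure set R -> \bar R}) :
  (m \x lam R)%E.-integrable setT (EFin \o (fun at_ : R * R => kk at_.1 at_.2)).
Proof.
have mk : measurable_fun setT (EFin \o (fun at_ : R * R => kk at_.1 at_.2)).
  by apply/measurable_EFinP; exact: measurable_kk.
apply/integrableP; split => //.
under eq_integral do rewrite /= ger0_norm ?kk_ge0//.
rewrite (fubini_tonelli1 _ mk)//=; last by move=> x; rewrite lee_fin kk_ge0.
apply: (@le_lt_trans _ _ (\int[m]_x (cst (1 + mass sg A)%:E x))%E); last first.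
  by rewrite integral_cst// lte_mul_pinfty// ?lee_fin ?addr_ge0 ?mass_ge0// finm_lty.
apply: ge0_le_integral => //.
- by move=> x _; apply: integral_ge0 => y _; rewrite lee_fin kk_ge0.
- apply: (measurable_fun_fubini_tonelli_F _ mk).
  by move=> x; rewrite lee_fin kk_ge0.
- move=> x _; rewrite /fubini_F/= -[leLHS]fineK.
    by rewrite lee_fin; exact: kk_mass_le.
  apply: integrable_fin_num => //; apply: integrable_kkr => //; exact: finm_lty.
Qed.

Definition kk_avg (m : {finite_measure set R -> \bar R}) (t : R) : R := \int[m]_a kk a t.

Lemma integrable_kkl (m : {finite_measure set R -> \bar R}) t :
  m.-integrable setT (EFin \o (fun a => kk a t)).
Proof. by apply: bmf_integrable; apply: bmf_poisson; exact: phih_circle_inD. Qed.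

Lemma integrable_kk_avg (m : {finite_measure set R -> \bar R}) :
  (lam R).-integrable setT (EFin \o kk_avg m).
Proof.
have mk : measurable_fun setT (EFin \o (fun at_ : R * R => kk at_.1 at_.2)).
  by apply/measurable_EFinP; exact: measurable_kk.
have k0 x : (0 <= (EFin \o (fun at_ : R * R => kk at_.1 at_.2)) x)%E.
  by rewrite lee_fin kk_ge0.
have E : EFin \o kk_avg m = fubini_G m (EFin \o (fun at_ : R * R => kk at_.1 at_.2)).
  apply/funext => t; rewrite /fubini_G /= /kk_avg /Rintegral fineK//.
  by apply: integrable_fin_num => //; exact: integrable_kkl.
rewrite E; apply/integrableP; split; first exact: (measurable_fun_fubini_tonelli_G _ mk).
under eq_integral do rewrite gee0_abs ?integral_ge0//.
rewrite -(fubini_tonelli2 _ mk)//.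
have /integrableP [_] := kk_prod_integrable m.
by under eq_integral do rewrite gee0_abs//.
Qed.

Lemma int_tau (m : {finite_measure set R -> \bar R}) g : bmf g ->
  \int[m]_a tau g a = \int[lam R]_t (g t * kk_avg m t) +
    (\int[m]_a atone a) * \int[sg]_x (g x * \1_A x).
Proof.
move=> bg; have ba := bmf_atone.
have ik a : (lam R).-integrable setT (EFin \o (fun t => g t * kk a t)).
  by apply: integrableM_bmf => //; apply: integrable_kkr => //; exact: finm_lty.
have ikl t : m.-integrable setT (EFin \o (fun a => g t * kk a t)).
  by apply: rintegrableZ; exact: integrable_kkl.
have ip : (m \x lam R)%E.-integrable setT (EFin \o (fun at_ : R * R => g at_.2 * kk at_.1 at_.2)).
  apply: (@integrableM_bmf _ _ _ _ (fun at_ => g at_.2) (fun at_ => kk at_.1 at_.2)).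
    by have [mg [M gM]] := bg; split; [exact: measurableT_comp mg _|exists M => x; exact: gM].
  exact: kk_prod_integrable.
rewrite /tau RintegralD//.
- rewrite RintegralZr//; last exact: bmf_integrable.
  congr (_ + _).
  rewrite (RFubini ip)//; apply: eq_Rintegral => t _.
  change (\int[m]_a (g t * kk a t) = g t * kk_avg m t).
  by rewrite RintegralZl//; exact: integrable_kkl.
- have := integrable_fubini_F ip; apply: eq_integrable => // a _.
  rewrite /fubini_F /= /Rintegral fineK//; apply: integrable_fin_num => //; exact: ik.
- under eq_fun do rewrite mulrC; apply: rintegrableZ; exact: bmf_integrable.
Qed.

Lemma kk_avg_ge0 m t : 0 <= kk_avg m t.
Proof. by apply: Rintegral_ge0 => a _; exact: kk_ge0. Qed.

(** The image of [m] is explicit: density [kk_avg m] with respect to [lam], plus the mass of [m]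
    over [zeta a = 1] times [sg] restricted to [A]. *)
Lemma transfer_pos (m : {finite_measure set R -> \bar R}) :
  exists m' : {finite_measure set R -> \bar R},
  forall g, bmf g -> \int[m']_x g x = \int[m]_a tau g a.
Proof.
have [d1 hd1] := dens_exists (kk_avg_ge0 m) (integrable_kk_avg m).
pose c := \int[m]_a atone a.
have c0 : 0 <= c by apply: Rintegral_ge0 => a _; rewrite ler0n.
have h0 x : 0 <= c * \1_A x by rewrite mulr_ge0//; have /andP[] := indic_le1 A x.
have [d2 hd2] := dens_exists h0 (rintegrableZ c (bmf_integrable sg (bmf_indic R mA))).
have [m' hm'] := add_exists d1 d2; exists m' => g bg.
rewrite hm'// hd1// hd2// int_tau//; congr (_ + _).
under eq_Rintegral do rewrite mulrCA.
by rewrite RintegralZl//; apply: bmf_integrable; apply: bmfM => //; exact: bmf_indic.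
Qed.

Lemma lam_indic_circ (f : R -> R) : measurable_fun setT f ->
  \int[lam R]_t f t = \int[lam R]_t (\1_(Icirc R) t * f t).
Proof.
move=> mf; rewrite -Rintegral_circ_indic//; apply: eq_Rintegral_measure => B mB.
by rewrite circE !lamE -setIA setIid.
Qed.

Lemma tau_circ (g : R -> R) a : measurable_fun setT g -> tau (fun x => \1_(Icirc R) x * g x) a = tau g a.
Proof.
move=> mg; rewrite /tau [in RHS]lam_indic_circ; last first.
  by apply: measurable_funM => //; exact: measurable_kkr.
congr (_ + _ * _); first by apply: eq_Rintegral => t _; rewrite [RHS]mulrA.
apply: eq_Rintegral => x _; rewrite ![\1_ _ x]indicE.
have [/set_mem/AI xI|_] := boolP (x \in A); last by rewrite !mulr0.
by rewrite mem_set// mul1r.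
Qed.

Lemma tau_poisson z (a : R) : inD z -> tau (poisson z) a = poisson (phih sg A z) a.
Proof.
move=> hz; rewrite (kernel_poisson sg a mA gd hz) /tau; congr (_ + _ * _).
by apply: eq_Rintegral => x _; rewrite mulrC.
Qed.

Lemma transfer (r : cmrep R) : exists r', forall g, bmf g -> cI r' g = cI r (tau g).
Proof.
have [m1 h1] := transfer_pos (circ (cm1 r)); have [m2 h2] := transfer_pos (circ (cm2 r)).
have [m3 h3] := transfer_pos (circ (cm3 r)); have [m4 h4] := transfer_pos (circ (cm4 r)).
exists (CMRep m1 m2 m3 m4) => g bg; have [mg _] := bg.
have bIg : bmf (fun x => \1_(Icirc R) x * g x).
  by apply: bmfM => //; apply: bmf_indic; exact: measurable_Icirc.
have e (m m' : {finite_measure set R -> \bar R}) : (forall g, bmf g -> \int[m']_x g x = \int[circ m]_a tau g a) ->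
    \int[circ m']_x g x = \int[circ m]_a tau g a.
  move=> h; rewrite Rintegral_circ_indic// (h _ bIg).
  by apply: eq_Rintegral => a _; exact: tau_circ.
by rewrite /cI -(e _ _ h1) -(e _ _ h2) -(e _ _ h3) -(e _ _ h4).
Qed.

(** By [tau_poisson] the transferred measure has the Poisson integral demanded by [Cop], and
    uniqueness of Poisson representations identifies it with the measure that [epsilon] selects. *)
Theorem Cop_phih (r : cmrep R) : exists r', Cop (phih sg A) (cm_set r) = cm_set r' /\
  forall g, bmf g -> cI r' g = cI r (tau g).
Proof.
have [r' hr'] := transfer r; exists r'; split=> //.
have hP z : inD z -> poisson_int (cm_set r') z = poisson_int (cm_set r) (phih sg A z).
  move=> hz; rewrite !poisson_intE//; last by apply: phih_inD; exact: ltW.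
  rewrite hr'; last exact: bmf_poisson.
  by congr cI; apply/funext => a; exact: tau_poisson.
have [[r1 e1] h1] := epsilon_spec (inhabits (fun _ => 0)) _
  (ex_intro (fun nu' => is_cmeasure nu' /\
     forall z, inD z -> poisson_int nu' z = poisson_int (cm_set r) (phih sg A z))
     (cm_set r') (conj (ex_intro _ r' erefl) hP)).
rewrite /Cop e1; apply: cm_set_ext => B mB; apply: cI_unique; last exact: bmf_indic.
by move=> z hz; have := h1 z hz; rewrite e1 -(hP z hz) !poisson_intE.
Qed.

End Transfer.

(** * Total variation and economical representations *)

Section TotalVariation.
Variable R : realType.
Implicit Types (m : {finite_measure set R -> \bar R}) (r : cmrep R) (g : R -> R).

Lemma Rintegral_sum d (T : measurableType d) (mu : {measure set T -> \bar R}) (I : Type)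
  (s : seq I) (F : I -> T -> R) : (forall i, mu.-integrable setT (EFin \o F i)) ->
  mu.-integrable setT (EFin \o (fun x => \sum_(i <- s) F i x)) /\
  \int[mu]_x (\sum_(i <- s) F i x) = \sum_(i <- s) \int[mu]_x F i x.
Proof.
move=> iF; elim: s => [|i s [IH1 IH2]].
  rewrite big_nil; split.
    rewrite (_ : _ \o _ = cst 0%E); first exact: integrable0.
    by apply/funext => x /=; rewrite big_nil.
  by under eq_Rintegral do rewrite big_nil; rewrite Rintegral_cst// mul0r.
have e : (fun x => \sum_(j <- i :: s) F j x) = (fun x => F i x + \sum_(j <- s) F j x).
  by apply/funext => x; rewrite big_cons.
by rewrite e big_cons; split; [exact: rintegrableD|rewrite RintegralD// IH2].
Qed.

Lemma sum_indic_le1 n (E : 'I_n -> set R) x : (forall i j, i != j -> E i `&` E j = set0) ->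
  \sum_(i < n) \1_(E i) x <= 1 :> R.
Proof.
move=> tE; have [[i Ei]|nE] := pselect (exists i, E i x).
  rewrite (bigD1 i)//= big1 ?addr0; first by have /andP[] := indic_le1 (E i) x.
  move=> j ji; rewrite indicE memNset// => Ej.
  by have : set0 x by rewrite -(tE _ _ ji).
by rewrite big1 ?ler01// => i _; rewrite indicE memNset// => Ei; apply: nE; exists i.
Qed.

Lemma sum_indic_Rintegral_le m n (E : 'I_n -> set R) f :
  (forall i, measurable (E i)) -> (forall i j, i != j -> E i `&` E j = set0) ->
  m.-integrable setT (EFin \o f) ->
  \sum_(i < n) `|\int[m]_x (\1_(E i) x * f x)| <= \int[m]_x `|f x|.
Proof.
move=> mE tE fi.
have ii i : m.-integrable setT (EFin \o (fun x => \1_(E i) x * f x)).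
  by apply: integrableM_bmf => //; exact: bmf_indic.
have in_ i := rintegrable_norm (ii i).
apply: (@le_trans _ _ (\sum_(i < n) \int[m]_x `|\1_(E i) x * f x|)).
  by apply: ler_sum => i _; exact: le_normr_Rintegral.
have [i1 i2] := Rintegral_sum (index_enum 'I_n) in_.
rewrite -i2; apply: le_Rintegral => //; first exact: rintegrable_norm.
move=> x _; under eq_bigr do rewrite normrM ger0_norm ?(proj1 (andP (indic_le1 _ _)))//.
by rewrite -mulr_suml ler_piMl// sum_indic_le1.
Qed.

Definition rmass r : R := fine (circ (cm1 r) setT) + fine (circ (cm2 r) setT) +
  fine (circ (cm3 r) setT) + fine (circ (cm4 r) setT).

Definition cIabs r g : R := \int[circ (cm1 r)]_x g x + \int[circ (cm2 r)]_x g x +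
  \int[circ (cm3 r)]_x g x + \int[circ (cm4 r)]_x g x.

Lemma cabs_cI r g : bmf g -> cabs (cI r g) <= cIabs r (fun x => `|g x|).
Proof.
move=> bg; apply: (le_trans (ler_cabs_ReIm _)); rewrite /cI /cIabs /= -[leRHS]addrA.
have h m : `|\int[m]_x g x| <= \int[m]_x `|g x|.
  by apply: le_normr_Rintegral => //; exact: bmf_integrable.
by apply: lerD; apply: (le_trans (ler_normB _ _)); apply: lerD; exact: h.
Qed.

Lemma cIabs_sum_le r n (k : 'I_n -> R -> R) C : (forall i, bmf (k i)) ->
  (forall a, \sum_(i < n) `|k i a| <= C) ->
  \sum_(i < n) cabs (cI r (k i)) <= C * rmass r.
Proof.
move=> bk kC; apply: (@le_trans _ _ (\sum_(i < n) cIabs r (fun x => `|k i x|))).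
  by apply: ler_sum => i _; exact: cabs_cI.
have h m : \sum_(i < n) \int[m]_x `|k i x| <= C * fine (m setT).
  have ik i : m.-integrable setT (EFin \o (fun x => `|k i x|)).
    by apply: rintegrable_norm; exact: bmf_integrable.
  have [i1 <-] := Rintegral_sum (index_enum 'I_n) ik.
  have -> : C * fine (m setT) = \int[m]_x (cst C x) by rewrite Rintegral_cst.
  apply: le_Rintegral => //; first by apply: bmf_integrable; exact: bmf_cst.
by rewrite /cIabs !big_split/= /rmass !mulrDr !lerD.
Qed.

Lemma tv_norm_le (nu : set R -> R[i]) (C : R) :
  (forall n (E : 'I_n -> set R), (forall i, measurable (E i)) ->
    (forall i j, i != j -> E i `&` E j = set0) -> \sum_(i < n) cabs (nu (E i)) <= C) ->
  (tv_norm nu <= C%:E)%E.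
Proof.
move=> h; apply: ge_ereal_sup => _ [n [E [mE [tE [_ ->]]]]].
by rewrite lee_fin; exact: h.
Qed.

Lemma tv_norm_ge2 (nu : set R -> R[i]) (M : R) P : measurable P -> (tv_norm nu <= M%:E)%E ->
  cabs (nu (P `&` Icirc R)) + cabs (nu (~` P `&` Icirc R)) <= M.
Proof.
move=> mP h; rewrite -lee_fin; apply: le_trans h; apply: ereal_sup_ubound.
have mI := @measurable_Icirc R.
exists 2%N, (fun i : 'I_2 => (if (i : nat) == 0 then P else ~` P) `&` Icirc R).
split; first by move=> i; apply: measurableI => //; case: ifP => // _; exact: measurableC.
have d0 : (P `&` Icirc R) `&` (~` P `&` Icirc R) = set0.
  by apply/seteqP; split => x //= [[? _] [? _]].
split.
  by move=> [[|[|i]] hi] [[|[|j]] hj] //= _; rewrite ?eqxx /= ?d0// setIC d0.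
split; last by rewrite !big_ord_recl big_ord0 /= addr0.
rewrite !big_ord_recl big_ord0 /= setU0.
apply/seteqP; split => x /=; first by move=> [[]|[]].
by move=> xI; have [xP|xP] := pselect (P x); [left|right].
Qed.

Lemma jordan_real m1 m2 : exists p n : {finite_measure set R -> \bar R}, exists P,
  [/\ measurable P,
   forall B, measurable B -> fine (p B) - fine (n B) = fine (m1 B) - fine (m2 B),
   fine (p setT) = fine (m1 P) - fine (m2 P) &
   fine (n setT) = fine (m2 (~` P)) - fine (m1 (~` P))].
Proof.
pose nu : {charge set R -> \bar R} :=
  cadd (charge_of_finite_measure m1) (copp (charge_of_finite_measure m2)).
have nuE B : measurable B -> nu B = (fine (m1 B) - fine (m2 B))%:E.
  by move=> mB; rewrite EFinB !fineK ?fin_num_measure.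
have [P [N PN]] := Hahn_decomposition nu; have [[mP _] [mN _] PNT PN0] := PN.
have NE : N = ~` P.
  apply/seteqP; split => x /=; first by move=> xN xP; have : set0 x by rewrite -PN0.
  by move=> xP; have [/xP|] : (P `|` N) x by rewrite PNT.
exists (jordan_pos PN), (jordan_neg PN), P; split => //.
- move=> B mB; have := jordan_decomp PN mB; rewrite (nuE _ mB).
  rewrite /cadd /= cscaleN1 /copp /= => /(congr1 fine) /= ->.
  by rewrite fineB// fin_num_measure.
- change (fine (crestr0 nu mP setT) = fine (m1 P) - fine (m2 P)).
  by rewrite /crestr0 mem_set// /crestr setTI nuE.
- change (fine ((-1)%:E * crestr0 nu mN setT)%E = fine (m2 (~` P)) - fine (m1 (~` P))).
  by rewrite mulN1e /crestr0 mem_set// /crestr setTI nuE// NE /= opprB.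
Qed.

(** An arbitrary representation may carry mass that cancels. The Jordan parts of the real component
    have total mass at most the variation, tested on a Hahn set and its complement; the imaginary
    component costs as much again, whence the factor 2. *)
Lemma good_rep (nu : set R -> R[i]) (M : R) : is_cmeasure nu -> (tv_norm nu <= M%:E)%E ->
  exists r, nu = cm_set r /\ rmass r <= 2 * M.
Proof.
move=> [r ->] hM.
have [p [n [P [mP e1 e2 e3]]]] := jordan_real (circ (cm1 r)) (circ (cm2 r)).
have [p' [n' [P' [mP' e1' e2' e3']]]] := jordan_real (circ (cm3 r)) (circ (cm4 r)).
have mI := @measurable_Icirc R.
have ci m B : measurable B -> fine (circ m (B `&` Icirc R)) = fine (circ m B).
  by move=> mB; rewrite -circI.
exists (CMRep p n p' n'); split.
  apply: cm_set_ext => B mB; rewrite /cI !Rintegral_indic// !circE.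
  have mBI : measurable (B `&` Icirc R) by exact: measurableI.
  by rewrite e1// e1'// !ci// -!circE.
have cle m : fine (circ m setT) <= fine (m setT).
  rewrite circE setTI; apply: fine_le; [exact: fin_num_measure|exact: fin_num_measure|].
  by rewrite le_measure ?inE.
have re B : measurable B ->
    `|fine (circ (cm1 r) B) - fine (circ (cm2 r) B)| <= cabs (cm_set r (B `&` Icirc R)) /\
    `|fine (circ (cm3 r) B) - fine (circ (cm4 r) B)| <= cabs (cm_set r (B `&` Icirc R)).
  move=> mB; have mBI : measurable (B `&` Icirc R) by exact: measurableI.
  have e : cm_set r (B `&` Icirc R) =
      Complex (fine (circ (cm1 r) B) - fine (circ (cm2 r) B))
              (fine (circ (cm3 r) B) - fine (circ (cm4 r) B)).
    by rewrite cm_setE// /cI !Rintegral_indic// !ci.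
  by rewrite e; split; [exact: (ler_Re_cabs (Complex _ _))|exact: (ler_Im_cabs (Complex _ _))].
have [a1 _] := re _ mP; have [a2 _] := re _ (measurableC mP).
have [_ a3] := re _ mP'; have [_ a4] := re _ (measurableC mP').
rewrite mulr_natl mulr2n /rmass /= -addrA; apply: lerD.
  apply: (le_trans (lerD (cle p) (cle n))); rewrite e2 e3; apply: (le_trans _ (tv_norm_ge2 mP hM)).
  apply: lerD; first exact: le_trans (ler_norm _) a1.
  by apply: (le_trans (ler_norm _)); rewrite distrC.
apply: (le_trans (lerD (cle p') (cle n'))); rewrite e2' e3'; apply: (le_trans _ (tv_norm_ge2 mP' hM)).
apply: lerD; first exact: le_trans (ler_norm _) a3.
by apply: (le_trans (ler_norm _)); rewrite distrC.
Qed.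

End TotalVariation.

(** * Norm estimates on M *)

Section CopOnMeasures.
Variable R : realType.
Variable sg : {finite_measure set R -> \bar R}.
Implicit Types (A B : set R) (r : cmrep R).

Lemma bmf_tau A g : measurable A -> {ae lam R, forall t, exists c, away A (zeta t) c} ->
  bmf g -> bmf (tau sg A g).
Proof.
move=> mA gd bg.
have ik a : (lam R).-integrable setT (EFin \o (fun t => g t * kk sg A a t)).
  by apply: integrableM_bmf => //; apply: integrable_kkr => //; exact: finm_lty.
have ip : (sg \x lam R)%E.-integrable setT (EFin \o (fun at_ : R * R => g at_.2 * kk sg A at_.1 at_.2)).
  apply: (@integrableM_bmf _ _ _ _ (fun at_ => g at_.2) (fun at_ => kk sg A at_.1 at_.2)).
    by have [mg [M gM]] := bg; split; [exact: measurableT_comp mg _|exists M => x; exact: gM].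
  exact: kk_prod_integrable.
have [m1 [N hN]] := bmf_atone R.
split.
  apply: measurable_funD; last by apply: measurable_funM => //; exact: measurable_cst.
  have := measurable_int _ (integrable_fubini_F ip).
  rewrite (_ : fubini_F _ _ = EFin \o (fun a => \int[lam R]_t (g t * kk sg A a t))).
    by move/measurable_EFinP.
  apply/funext => a; rewrite /fubini_F /= /Rintegral fineK//.
  by apply: integrable_fin_num => //; exact: ik.
have [mg [M gM]] := bg.
exists (M * (1 + mass sg A) + N * `|\int[sg]_x (g x * \1_A x)|) => a.
apply: (le_trans (ler_normD _ _)); apply: lerD; last by rewrite normrM ler_wpM2r.
apply: (le_trans (le_normr_Rintegral _ (ik a))) => //.
have M0 : 0 <= M by exact: le_trans (normr_ge0 _) (gM 0).
apply: (@le_trans _ _ (\int[lam R]_t (M * kk sg A a t))).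
  apply: le_Rintegral => //; first exact: rintegrable_norm.
    by apply: rintegrableZ; apply: integrable_kkr => //; exact: finm_lty.
  by move=> t _; rewrite normrM [`|kk _ _ _ _|]ger0_norm ?kk_ge0// ler_wpM2r// kk_ge0.
rewrite RintegralZl//; last by apply: integrable_kkr => //; exact: finm_lty.
by rewrite ler_wpM2l//; exact: kk_mass_le.
Qed.

Lemma tau_sum_le (w : R -> R -> R) (v : R -> R) n (E : 'I_n -> set R) a :
  (lam R).-integrable setT (EFin \o w a) -> sg.-integrable setT (EFin \o v) ->
  (forall i, measurable (E i)) -> (forall i j, i != j -> E i `&` E j = set0) ->
  \sum_(i < n) `|\int[lam R]_t (\1_(E i) t * w a t) + atone a * \int[sg]_x (\1_(E i) x * v x)|
  <= \int[lam R]_t `|w a t| + \int[sg]_x `|v x|.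
Proof.
move=> iw iv mE tE.
apply: (le_trans _ (lerD (sum_indic_Rintegral_le mE tE iw) (sum_indic_Rintegral_le mE tE iv))).
rewrite -big_split; apply: ler_sum => i _ /=.
apply: (le_trans (ler_normD _ _)); rewrite lerD2l normrM ler_piMl//.
by rewrite /atone; case: eqP => _; rewrite ?normr1 ?normr0.
Qed.

(** The constant is [3 * 2]: kernel and atom together have mass at most
    [(1 + mass sg A) + mass sg A <= 3], and [good_rep] contributes 2. *)
Lemma Cop_tv_norm A nu (M : R) : measurable A ->
  {ae lam R, forall t, exists c, away A (zeta t) c} -> A `<=` Icirc R ->
  mass sg A <= 1 -> is_cmeasure nu -> 0 <= M -> (tv_norm nu <= M%:E)%E ->
  is_cmeasure (Cop (phih sg A) nu) /\ (tv_norm (Cop (phih sg A) nu) <= (6 * M)%:E)%E.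
Proof.
move=> mA gd AI m1 cnu M0 hM; have [r [-> hr]] := good_rep cnu hM.
have [r' [-> hr']] := Cop_phih sg mA gd AI r; split; first by exists r'.
apply: tv_norm_le => n E mE tE.
have bE i : bmf (\1_(E i) : R -> R) by exact: bmf_indic.
under eq_bigr do rewrite cm_setE// hr'//.
apply: le_trans (_ : 3 * rmass r <= _); last by lra.
apply: cIabs_sum_le => [i|a]; first exact: bmf_tau.
have ik : (lam R).-integrable setT (EFin \o kk sg A a).
  by apply: integrable_kkr => //; exact: finm_lty.
have iv := bmf_integrable sg (bmf_indic R mA).
apply: (le_trans (tau_sum_le ik iv mE tE)).
have e1 : \int[lam R]_t `|kk sg A a t| <= 1 + mass sg A.
  under eq_Rintegral do rewrite ger0_norm ?kk_ge0//; exact: kk_mass_le.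
have e2 : \int[sg]_x `|\1_A x : R| = mass sg A.
  rewrite /mass -Rintegral_indic//; apply: eq_Rintegral => x _.
  by have /andP[i0 _] := indic_le1 A x; rewrite ger0_norm.
rewrite e2; lra.
Qed.

Lemma Cop_sub_tv_norm A B nu (M e : R) : measurable A -> measurable B ->
  {ae lam R, forall t, exists c, away A (zeta t) c} ->
  {ae lam R, forall t, exists c, away B (zeta t) c} ->
  A `<=` Icirc R -> B `<=` Icirc R ->
  (forall a, \int[lam R]_t `|kk sg A a t - kk sg B a t| <= e) ->
  \int[sg]_x `|\1_A x - \1_B x| <= e ->
  is_cmeasure nu -> 0 <= M -> 0 <= e -> (tv_norm nu <= M%:E)%E ->
  (tv_norm (cm_sub (Cop (phih sg A) nu) (Cop (phih sg B) nu)) <= (4 * e * M)%:E)%E.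
Proof.
move=> mA mB gA gB AI BI h1 h2 cnu M0 e0 hM; have [r [-> hr]] := good_rep cnu hM.
have [r1 [-> hr1]] := Cop_phih sg mA gA AI r.
have [r2 [-> hr2]] := Cop_phih sg mB gB BI r.
apply: tv_norm_le => n E mE tE.
have bE i : bmf (\1_(E i) : R -> R) by exact: bmf_indic.
have eE i : cm_sub (cm_set r1) (cm_set r2) (E i) =
    cI r (fun a => tau sg A (\1_(E i)) a - tau sg B (\1_(E i)) a).
  by rewrite /cm_sub !cm_setE// hr1// hr2// cI_cmB//; exact: bmf_tau.
under eq_bigr do rewrite eE.
have e20 : 0 <= 2 * e by rewrite mulr_ge0.
apply: le_trans (_ : 2 * e * rmass r <= _); last first.
  by apply: (le_trans (ler_wpM2l e20 hr)); rewrite le_eqVlt; apply/orP; left; apply/eqP; ring.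
apply: cIabs_sum_le => [i|a]; first by apply: bmfB; exact: bmf_tau.
have ikA : (lam R).-integrable setT (EFin \o kk sg A a).
  by apply: integrable_kkr => //; exact: finm_lty.
have ikB : (lam R).-integrable setT (EFin \o kk sg B a).
  by apply: integrable_kkr => //; exact: finm_lty.
have ivA := bmf_integrable sg (bmf_indic R mA).
have ivB := bmf_integrable sg (bmf_indic R mB).
have := tau_sum_le (w := fun a t => kk sg A a t - kk sg B a t)
  (rintegrableB ikA ikB) (rintegrableB ivA ivB) mE tE.
move=> h; apply: le_trans (le_trans h _); last by rewrite mulr_natl mulr2n lerD.
apply: ler_sum => i _; rewrite le_eqVlt; apply/orP; left; apply/eqP; congr `|_|.
rewrite /tau.
have jA : (lam R).-integrable setT (EFin \o (fun t => \1_(E i) t * kk sg A a t)).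
  exact: (integrableM_bmf (bmf_indic R (mE i)) ikA).
have jB : (lam R).-integrable setT (EFin \o (fun t => \1_(E i) t * kk sg B a t)).
  exact: (integrableM_bmf (bmf_indic R (mE i)) ikB).
have lA := integrableM_bmf (bmf_indic R (mE i)) ivA.
have lB := integrableM_bmf (bmf_indic R (mE i)) ivB.
under [X in _ = X + _]eq_Rintegral do rewrite mulrBr.
under [X in _ = _ + _ * X]eq_Rintegral do rewrite mulrBr.
by rewrite (RintegralB _ jA jB)// (RintegralB _ lA lB)// [atone a * (_ - _)]mulrBr opprD addrACA.
Qed.

End CopOnMeasures.

(** * Action of the operator on absolutely continuous measures *)

Section Densities.
Variable R : realType.
Implicit Types (f g : R -> R[i]) (r : cmrep R).
Let mI := @measurable_Icirc R.

Lemma densityE f B : cmeas f -> measurable B ->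
  density f B = cint (lam R) (fun x => (\1_B x)%:C%C * f x).
Proof.
move=> [m1 m2] mB; rewrite /density ifT; last exact/asboolP.
have h (k : R -> R) : measurable_fun setT k ->
    fine (\int[leb R]_(x in B `&` Icirc R) (k x)%:E)%E = \int[lam R]_x (\1_B x * k x).
  move=> mk; rewrite /Rintegral integral_lam; last first.
    by apply/measurable_EFinP; apply: measurable_funM => //; exact: measurable_indic.
  congr fine; rewrite setIC integral_mkcondr; apply: eq_integral => x _.
  by rewrite patchE indicE; case: (x \in B); rewrite ?mul1r ?mul0r.
rewrite /cleb_int !h//; apply: eqC => /=; apply: eq_Rintegral => x _.
  by rewrite ReMr.
by rewrite ImMr.
Qed.

Lemma cintegrable_lam f : cmeas f -> cintegr (lam R) f <-> cintegrable f.
Proof.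
move=> [m1 m2]; have h1 : measurable_fun setT (fun x => (cRe (f x))%:E) by exact/measurable_EFinP.
have h2 : measurable_fun setT (fun x => (cIm (f x))%:E) by exact/measurable_EFinP.
by split => -[i1 i2]; split; [exact/(integrable_lam h1)|exact/(integrable_lam h2)
  |exact/(integrable_lam h1)|exact/(integrable_lam h2)].
Qed.

Lemma eq_density f g : (forall x, Icirc R x -> f x = g x) -> density f = density g.
Proof.
move=> h; apply/funext => B; rewrite /density; case: ifP => // _; rewrite /cleb_int.
by congr Complex; congr fine; apply: eq_integral => x /set_mem[_ xI]; rewrite h.
Qed.

(** [cintegrable] speaks about [[0,1)] only; extension by 0 gives a function measurable on the whole
    line. *)
Lemma cintegrable_normal f : cintegrable f ->
  exists g, cintegr (lam R) g /\ forall x, Icirc R x -> g x = f x.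
Proof.
move=> [i1 i2]; exists (fun x => if x \in Icirc R then f x else 0).
have hI x : Icirc R x -> (if x \in Icirc R then f x else 0) = f x by move=> xI; rewrite mem_set.
split => //.
have m (k : R -> R) : measurable_fun (Icirc R) (EFin \o k) ->
    measurable_fun setT (fun x => if x \in Icirc R then k x else 0).
  move=> /measurable_EFinP mk; rewrite (_ : (fun x => _) = k \_ (Icirc R)).
    exact/(measurable_restrictT k mI).
  by apply/funext => x; rewrite patchE.
have m1 := m _ (measurable_int _ i1); have m2 := m _ (measurable_int _ i2).
apply/cintegrable_lam.
  by split; [move: m1|move: m2]; congr (measurable_fun _ _); apply/funext => x; case: (x \in _).
split; [move: i1|move: i2]; apply: eq_integrable => // x /set_mem xI; by rewrite hI.
Qed.

Lemma Rintegral_posneg (h : R -> R) (g : R -> R) : bmf g -> (lam R).-integrable setT (EFin \o h) ->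
  \int[lam R]_x (g x * ((`|h x| + h x) / 2)) - \int[lam R]_x (g x * ((`|h x| - h x) / 2)) =
  \int[lam R]_x (g x * h x).
Proof.
move=> bg ih; have ia := rintegrable_norm ih.
rewrite -RintegralB//; first by apply: eq_Rintegral => x _; field.
  apply: integrableM_bmf => //; under eq_fun do rewrite mulrC.
  by apply: rintegrableZ; exact: rintegrableD.
apply: integrableM_bmf => //; under eq_fun do rewrite mulrC.
by apply: rintegrableZ; exact: rintegrableB.
Qed.

Lemma density_rep f : cintegr (lam R) f -> exists r, density f = cm_set r /\
  forall g : R -> R, bmf g -> cI r g = cint (lam R) (fun x => (g x)%:C%C * f x).
Proof.
move=> fi; have [i1 i2] := fi; have mf := cintegr_cmeas fi.
have dp (h : R -> R) : (lam R).-integrable setT (EFin \o h) ->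
    exists p n : {finite_measure set R -> \bar R}, forall g : R -> R, bmf g ->
    \int[circ p]_x g x - \int[circ n]_x g x = \int[lam R]_x (g x * h x).
  move=> ih; have ia := rintegrable_norm ih.
  have mh : measurable_fun setT h by apply/measurable_EFinP; exact: measurable_int ih.
  have p0 x : 0 <= (`|h x| + h x) / 2.
    by rewrite divr_ge0// -lerBlDr sub0r -normrN ler_norm.
  have n0 x : 0 <= (`|h x| - h x) / 2 by rewrite divr_ge0// subr_ge0 ler_norm.
  have ip : (lam R).-integrable setT (EFin \o (fun x => (`|h x| + h x) / 2)).
    under eq_fun do rewrite mulrC; apply: rintegrableZ; exact: rintegrableD.
  have in_ : (lam R).-integrable setT (EFin \o (fun x => (`|h x| - h x) / 2)).
    under eq_fun do rewrite mulrC; apply: rintegrableZ; exact: rintegrableB.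
  have [p hp] := dens_exists p0 ip; have [n hn] := dens_exists n0 in_.
  exists p, n => g bg; have [mg _] := bg.
  have bIg : bmf (fun x => \1_(Icirc R) x * g x) by apply: bmfM => //; exact: bmf_indic.
  rewrite !Rintegral_circ_indic// (hp _ bIg) (hn _ bIg) Rintegral_posneg//.
  rewrite [RHS]lam_indic_circ; last exact: measurable_funM.
  by apply: eq_Rintegral => x _; rewrite mulrA.
have [p1 [n1 h1]] := dp _ i1; have [p2 [n2 h2]] := dp _ i2.
have hg (g : R -> R) : bmf g ->
    cI (CMRep p1 n1 p2 n2) g = cint (lam R) (fun x => (g x)%:C%C * f x).
  move=> bg; rewrite /cI (h1 _ bg) (h2 _ bg); apply: eqC => /=; apply: eq_Rintegral => x _.
    by rewrite ReMr.
  by rewrite ImMr.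
exists (CMRep p1 n1 p2 n2); split => //.
apply/funext => B; have [mB|nB] := pselect (measurable B).
  by rewrite cm_setE// densityE// hg//; exact: bmf_indic.
by rewrite /density /cm_set !ifF//; apply/asboolP.
Qed.

Lemma density_cmeasure f : cintegr (lam R) f -> is_cmeasure (density f).
Proof. by move=> /density_rep [r [-> _]]; exists r. Qed.

Lemma atone_ae0 : {ae lam R, forall x, atone x = 0 :> R}.
Proof.
exists (@badset R); split; [exact: measurable_badset|exact: lam_badset|].
move=> x /= h; have [xI|xI] := pselect (Icirc R x); last by right.
left; have zx : zeta x = 1.
  by apply: contrapT => /eqP/negbTE zx; apply: h; rewrite /atone zx.
move: xI; rewrite /Icirc /= in_itv/= => xI.
by rewrite (zeta_eq1 xI zx); exact: cantor0.
Qed.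

Lemma cint_atone f : cintegr (lam R) f -> cint (lam R) (fun x => (atone x)%:C%C * f x) = 0.
Proof.
move=> fi; have [i1 i2] := fi.
have h (k : R -> R) : (lam R).-integrable setT (EFin \o k) -> \int[lam R]_x (atone x * k x) = 0.
  move=> ik; transitivity (\int[lam R]_x (cst 0 x : R)); last by rewrite Rintegral_cst// mul0r.
  rewrite /Rintegral; congr fine; apply: ae_eq_integral => //.
  - by apply: (@measurable_int _ _ _ (lam R)); apply: integrableM_bmf => //; exact: bmf_atone.
  - by apply/measurable_EFinP; exact: measurable_cst.
  - have [N [mN N0 hN]] := atone_ae0; exists N; split => // x /= h; apply: hN => /= h'.
    by apply: h => _; rewrite h' mul0r.
apply: eqC => /=; [rewrite -[RHS](h _ i1)|rewrite -[RHS](h _ i2)]; apply: eq_Rintegral => x _.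
  by rewrite ReMr.
by rewrite ImMr.
Qed.

Variable sg : {finite_measure set R -> \bar R}.
Variable A : set R.
Hypothesis mA : measurable A.
Hypothesis gd : {ae lam R, forall t, exists c, away A (zeta t) c}.
Hypothesis AI : A `<=` Icirc R.

Definition Top f (t : R) : R[i] := cint (lam R) (fun a : R => (kk sg A a t)%:C%C * f a).

Lemma bmf_kkl t : bmf (fun a => kk sg A a t).
Proof. by apply: bmf_poisson; exact: phih_circle_inD. Qed.

(** A measure with a density does not charge [zeta a = 1], so the atom disappears and the kernel
    operator [Top] is all that is left. *)
Lemma Cop_density f : cintegr (lam R) f ->
  cintegr (lam R) (Top f) /\ Cop (phih sg A) (density f) = density (Top f).
Proof.
move=> fi; have [r [-> hr]] := density_rep fi.
have TE t : Top f t = cI r (fun a => kk sg A a t) by rewrite hr//; exact: bmf_kkl.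
have ia m := integrable_kk_avg sg mA gd m.
have Ti : cintegr (lam R) (Top f).
  split.
    under eq_fun do rewrite TE; apply: rintegrableB; exact: ia.
  under eq_fun do rewrite TE; apply: rintegrableB; exact: ia.
split=> //; have [r' [-> hr']] := Cop_phih sg mA gd AI r.
apply/funext => B; have [mB|nB] := pselect (measurable B); last first.
  by rewrite /density /cm_set !ifF//; apply/asboolP.
have bB := bmf_indic R mB.
rewrite cm_setE// hr'// densityE//; last exact: (cintegr_cmeas Ti).
have at0 : cI r (@atone R) = 0 by rewrite hr ?cint_atone//; exact: bmf_atone.
have /= a1 := congr1 (@complex.Re R) at0; have /= a2 := congr1 (@complex.Im R) at0.
have ii m : (lam R).-integrable setT (EFin \o (fun t => \1_B t * kk_avg sg A m t)).
  by apply: integrableM_bmf.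
have key (m1 m2 : {finite_measure set R -> \bar R}) : \int[m1]_a atone a - \int[m2]_a atone a = 0 ->
    \int[m1]_a tau sg A (\1_B) a - \int[m2]_a tau sg A (\1_B) a =
    \int[lam R]_t (\1_B t * (kk_avg sg A m1 t - kk_avg sg A m2 t)).
  move=> h0; rewrite !int_tau// opprD addrACA -mulrBl h0 mul0r addr0 -RintegralB//.
  by apply: eq_Rintegral => t _; rewrite mulrBr.
rewrite /cI (key _ _ a1) (key _ _ a2) /cint; congr Complex; apply: eq_Rintegral => t _.
  by rewrite ReMr TE.
by rewrite ImMr TE.
Qed.

End Densities.

(** * Power mean inequalities up to a constant *)

Section PowerMean.
Variable R : realType.
Implicit Types (p x y l C e : R).

(** Either [y <= l], or the nonincreasing power [1 - p] compares [y] with [l]. With [l] free, this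
    elementary form of Young's inequality takes over the part of Hoelder's. *)
Lemma powR_young p y l : 1 <= p -> 0 <= y -> 0 < l -> y <= l + l `^ (1 - p) * y `^ p.
Proof.
move=> p1 y0 l0; have [yl|ly] := leP y l; first by rewrite ler_wpDr// mulr_ge0 ?powR_ge0.
have yp : 0 < y by exact: lt_trans ly.
apply: ler_wpDl; first exact: ltW.
have e : y = y `^ (1 - p) * y `^ p.
  by rewrite -powRD ?subrK ?powRr1// gt_eqF ?implybT.
rewrite {1}e ler_wpM2r ?powR_ge0// -opprB !powRN lef_pV2 ?posrE ?powR_gt0//.
by rewrite ge0_ler_powR ?nnegrE ?subr_ge0// ltW.
Qed.

Lemma powR_le_scale p x I : 1 <= p -> 0 <= x -> 0 <= I ->
  (forall l, 0 < l -> I <= l `^ p -> x <= 3 * l) -> x `^ p <= 3 `^ p * I.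
Proof.
move=> p1 x0 I0 h; have p0 : 0 < p by exact: lt_le_trans p1.
have c0 : 0 < 3 `^ p :> R by rewrite powR_gt0.
suff H : forall d, 0 < d -> x `^ p <= 3 `^ p * I + d by apply/ler_addgt0Pr => d /H.
(* The extra term keeps [J] positive, so that its [p]-th root is an admissible [l] even if
   [I = 0]. *)
move=> d d0; pose J := I + d / 3 `^ p.
have J0 : 0 < J by rewrite ltr_wpDl// divr_gt0.
have lp : (J `^ p^-1) `^ p = J by rewrite -powRrM mulVf ?gt_eqF// powRr1// ltW.
have l0 : 0 < J `^ p^-1 by rewrite powR_gt0.
have := h _ l0; rewrite lp lerDl divr_ge0 ?(ltW d0) ?(ltW c0)// => /(_ isT) hx.
apply: (@le_trans _ _ ((3 * J `^ p^-1) `^ p)).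
  by rewrite ge0_ler_powR ?nnegrE ?mulr_ge0 ?powR_ge0// ltW.
by rewrite powRM ?powR_ge0// lp /J mulrDr mulrCA divff ?mulr1// gt_eqF.
Qed.

Lemma measurable_powR_comp d (T : measurableType d) p (f : T -> R) : measurable_fun setT f ->
  measurable_fun setT (fun t => f t `^ p).
Proof. exact: (measurableT_comp (measurable_powR p)). Qed.

(** Jensen's inequality up to [3 ^ p]: after [powR_young], the mass bound 2 contributes [2 * l] and
    the second term one more [l]. *)
Lemma Rintegral_powR_le d (T : measurableType d) (m : {finite_measure set T -> \bar R})
  p (u v : T -> R) : 1 <= p -> bmf u -> (forall a, 0 <= u a) -> (forall a, 0 <= v a) ->
  \int[m]_a u a <= 2 -> m.-integrable setT (EFin \o v) ->
  m.-integrable setT (EFin \o (fun a => v a `^ p)) ->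
  (\int[m]_a (u a * v a)) `^ p <= 3 `^ p * \int[m]_a (u a * v a `^ p).
Proof.
move=> p1 bu u0 v0 u2 iv ivp.
have iu := bmf_integrable m bu.
have iuv := integrableM_bmf bu iv; have iuvp := integrableM_bmf bu ivp.
apply: powR_le_scale => //.
- by apply: Rintegral_ge0 => a _; exact: mulr_ge0.
- by apply: Rintegral_ge0 => a _; rewrite mulr_ge0 ?powR_ge0.
move=> l l0 hI.
apply: (@le_trans _ _ (\int[m]_a (l * u a + l `^ (1 - p) * (u a * v a `^ p)))).
  apply: le_Rintegral => //; first by apply: rintegrableD; exact: rintegrableZ.
  move=> a _; have := ler_wpM2l (u0 a) (powR_young p1 (v0 a) l0).
  by rewrite mulrDr [l * _]mulrC [X in _ <= _ + X -> _]mulrCA.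
rewrite RintegralD//; [|exact: rintegrableZ..]; rewrite !RintegralZl//.
rewrite (_ : 3 * l = l * 2 + l); last by ring.
apply: lerD; first by rewrite ler_wpM2l// ltW.
apply: (le_trans (ler_wpM2l (powR_ge0 _ _) hI)).
by rewrite -powRD ?subrK ?powRr1 ?(ltW l0)// gt_eqF ?implybT.
Qed.

End PowerMean.

(** * Schur's test on L^p *)

Section KernelOperator.
Variable R : realType.
Variables (p e : R) (w : R * R -> R).
Hypothesis p1 : 1 <= p.
Hypothesis e0 : 0 <= e.
Hypothesis mw : measurable_fun setT w.
Hypothesis wb : forall t, bmf (fun a => w (a, t)).
Hypothesis w2 : forall t, \int[lam R]_a `|w (a, t)| <= 2.
Hypothesis wi : forall a, (lam R).-integrable setT (EFin \o (fun t => w (a, t))).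
Hypothesis we : forall a, \int[lam R]_t `|w (a, t)| <= e.

Definition lpb (f : R -> R[i]) (C : R) := cintegr (lam R) f /\
  (\int[lam R]_t (cabs (f t) `^ p)%:E <= C%:E)%E.

Lemma lpb_integrable f C : lpb f C ->
  (lam R).-integrable setT (EFin \o (fun t => cabs (f t) `^ p)).
Proof.
move=> [fi hC]; apply/integrableP; split.
  apply/measurable_EFinP; apply: measurable_powR_comp; apply: measurable_cabs.
  exact: (cintegr_cmeas fi).
under eq_integral do rewrite /= ger0_norm ?powR_ge0//.
exact: le_lt_trans hC (ltry _).
Qed.

(** The bound 2 on the integral in [a] permits the power mean inequality for fixed [t]; Tonelli and
    the bound [e] on the integral in [t] then conclude, so smallness in one variable suffices. The 6
    is the 2 of [cabs_cint] times the 3 of [Rintegral_powR_le]. *)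
Lemma kernel_operator_lp f C : lpb f C ->
  (\int[lam R]_t (cabs (cint (lam R) (fun a : R => (w (a, t))%:C%C * f a)) `^ p)%:E
     <= (6 `^ p * e * C)%:E)%E.
Proof.
move=> hf; have [fi hC] := hf; have mf := cintegr_cmeas fi.
have ip := lpb_integrable hf; have ic := cintegr_cabs fi.
pose vp a := cabs (f a) `^ p.
have vp0 a : 0 <= vp a by exact: powR_ge0.
have wb' t : bmf (fun a => `|w (a, t)|).
  have [m [M hM]] := wb t; split; first exact: measurableT_comp.
  by exists M => x; rewrite normr_id.
pose F (at_ : R * R) : \bar R := (`|w at_| * vp at_.1)%:E.
have mF : measurable_fun setT F.
  apply/measurable_EFinP; apply: measurable_funM; first exact: measurableT_comp.
  have := measurable_int _ ip => /measurable_EFinP mv.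
  exact: (measurableT_comp mv measurable_fst).
have F0 x : (0 <= F x)%E by rewrite lee_fin mulr_ge0.
have K0 : 0 <= 6 `^ p :> R by exact: powR_ge0.
have iF t : (lam R).-integrable setT (EFin \o (fun a => `|w (a, t)| * vp a)).
  exact: integrableM_bmf.
have iT a : (lam R).-integrable setT (EFin \o (fun t => `|w (a, t)| * vp a)).
  under eq_fun do rewrite mulrC; apply: rintegrableZ; exact: rintegrable_norm.
apply: (@le_trans _ _ (\int[lam R]_t ((6 `^ p)%:E * \int[lam R]_a F (a, t)))%E).
  apply: ge0_le_integral => //.
  - by move=> t _; rewrite lee_fin powR_ge0.
  - apply/measurable_EFinP; apply: measurable_powR_comp; apply: measurable_cabs.
    apply: (@cmeas_cint_param _ _ _ _ _ (lam R) (fun ta : R * R => (w (ta.2, ta.1))%:C%C * f ta.2)).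
    apply: cmeasM; last exact: cmeas_snd.
    apply: cmeas_real; have := measurableT_comp mw (@measurable_swap _ _ R R).
    by apply.
  - apply: measurable_funeM; exact: (measurable_fun_fubini_tonelli_G _ mF F0).
  move=> t _; have -> : (\int[lam R]_a F (a, t) = (\int[lam R]_a (`|w (a, t)| * vp a))%:E)%E.
    by rewrite /Rintegral fineK//; apply: integrable_fin_num => //; exact: iF.
  rewrite -EFinM lee_fin.
  have h1 : cabs (cint (lam R) (fun a : R => (w (a, t))%:C%C * f a)) <=
      2 * \int[lam R]_a (`|w (a, t)| * cabs (f a)).
    have [mwt [M hM]] := wb t.
    apply: cabs_cint.
    - rewrite (_ : (fun a => _) = (fun a => f a * (w (a, t))%:C%C)); last by apply/funext => a; rewrite mulrC.
      have bb (a : R) : cabs ((w (a, t))%:C%C : R[i]) <= M by rewrite cabsr.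
      exact: (cintegrM_bounded fi (cmeas_real mwt) bb).
    - exact: integrableM_bmf.
    - by move=> a; rewrite cabsM cabsr.
  have i0 : 0 <= \int[lam R]_a (`|w (a, t)| * cabs (f a)).
    by apply: Rintegral_ge0 => a _; exact: mulr_ge0.
  apply: (@le_trans _ _ ((2 * \int[lam R]_a (`|w (a, t)| * cabs (f a))) `^ p)).
    by rewrite ge0_ler_powR ?nnegrE ?mulr_ge0// (le_trans _ p1).
  rewrite powRM// (_ : 6 = 2 * 3 :> R); last by ring.
  rewrite [(2 * 3) `^ p]powRM// -mulrA ler_wpM2l ?powR_ge0//.
  exact: Rintegral_powR_le.
have mG : measurable_fun setT (fun t => (\int[lam R]_a F (a, t))%E).
  exact: (measurable_fun_fubini_tonelli_G _ mF F0).
rewrite ge0_integralZl//; last by move=> t _; exact: integral_ge0.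
rewrite -(fubini_tonelli _ mF)// -mulrA EFinM lee_wpmul2l ?lee_fin//.
have mF1 : measurable_fun setT (fun a => (\int[lam R]_t F (a, t))%E).
  exact: (measurable_fun_fubini_tonelli_F _ mF F0).
have mv : measurable_fun setT (fun a => (e%:E * (vp a)%:E)%E).
  by apply: measurable_funeM; exact: measurable_int ip.
have le1 a : (\int[lam R]_t F (a, t) <= e%:E * (vp a)%:E)%E.
  have -> : (\int[lam R]_t F (a, t) = (\int[lam R]_t (`|w (a, t)| * vp a))%:E)%E.
    by rewrite /Rintegral fineK//; apply: integrable_fin_num => //; exact: iT.
  rewrite RintegralZr//; last exact: rintegrable_norm.
  by rewrite -EFinM lee_fin ler_wpM2r.
have g0 a : (0 <= \int[lam R]_t F (a, t))%E by exact: integral_ge0.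
apply: (le_trans (ge0_le_integral (lam R) measurableT (fun a _ => g0 a) mF1 mv (fun a _ => le1 a))).
have mvp : measurable_fun setT (fun a => (vp a)%:E) by exact: measurable_int ip.
have vp0' a : (0 <= (vp a)%:E)%E by rewrite lee_fin.
rewrite (@ge0_integralZl _ _ _ (lam R) setT measurableT (fun a => (vp a)%:E))//.
by rewrite EFinM lee_wpmul2l// lee_fin.
Qed.

End KernelOperator.

(** * Invariance of the Hardy class *)

Section HardyInvariance.
Variable R : realType.
Implicit Types (f : R -> R[i]).
Local Notation zeta := (@zeta R).

Lemma geometric_squeeze (x q B : R) : 0 <= q < 1 -> (forall n, x <= q ^+ n * B) -> x <= 0.
Proof.
move=> /andP[q0 q1] h; rewrite leNgt; apply/negP => x0.
have c : (fun n => q ^+ n * B) @ \oo --> (0 * B : R).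
  by apply: cvgMl; apply: cvg_expr; rewrite ger0_norm.
rewrite mul0r in c; move/cvgrPdist_lt : c => /(_ _ x0) [n _ /(_ n (leqnn n))] /=.
rewrite sub0r normrN => hn; have := le_lt_trans (le_trans (h n) (ler_norm _)) hn.
by rewrite ltxx.
Qed.

Lemma cmeas_szego (a : R[i]) n : cmeas (fun x : R => zeta x ^+ n * (1 - a * zeta x)^-1).
Proof.
apply: cmeasM; first by apply: cmeasX; exact: cmeas_zeta.
apply: cmeasV; apply: cmeasB; first exact: cmeas_cst.
by apply: cmeasM; [exact: cmeas_cst|exact: cmeas_zeta].
Qed.

Lemma szego_le (a : R[i]) n x : inD a ->
  cabs (zeta x ^+ n * (1 - a * zeta x)^-1) <= (1 - cabs a)^-1.
Proof.
move=> ha; have d : 1 - cabs a <= cabs (1 - a * zeta x).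
  by apply: le_trans (ler_cabs_sub _ _); rewrite cabs1 cabsM cabs_zeta mulr1.
have d0 : 0 < 1 - cabs a by rewrite subr_gt0.
rewrite cabsM cabsX cabs_zeta expr1n mul1r cabsV lef_pV2 ?posrE//.
exact: lt_le_trans d.
Qed.

(** The vanishing moments give [Z n = a * Z n.+1], so [Z 0 = a ^+ n * Z n] with [Z] bounded and
    [|a| < 1]. This replaces the expansion into a geometric series. *)
Lemma szego_vanish f (a : R[i]) : cintegr (lam R) f -> inD a ->
  (forall n, (0 < n)%N -> cint (lam R) (fun x => f x * zeta x ^+ n) = 0) ->
  cint (lam R) (fun x => f x * (zeta x ^+ 1 * (1 - a * zeta x)^-1)) = 0.
Proof.
move=> fi ha h; pose Z n := cint (lam R) (fun x => f x * (zeta x ^+ n.+1 * (1 - a * zeta x)^-1)).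
have ig n : cintegr (lam R) (fun x => f x * (zeta x ^+ n * (1 - a * zeta x)^-1)).
  apply: (cintegrM_bounded fi (cmeas_szego a n)) => x; exact: szego_le.
have iz n : cintegr (lam R) (fun x => f x * zeta x ^+ n).
  apply: (cintegrM_bounded fi (cmeasX n (@cmeas_zeta R)) (B := 1)) => x.
  by rewrite cabsX cabs_zeta expr1n.
have step n : Z n = a * Z n.+1.
  rewrite /Z -cintZ// -[RHS]add0r -(h n.+1 isT) -cintD//; last exact: cintegrZ.
  apply: eq_cint => x; have nz : 1 - a * zeta x != 0.
    apply/eqP => /eqP; rewrite subr_eq0 => /eqP /(congr1 (@cabs R)).
    by rewrite cabs1 cabsM cabs_zeta mulr1 => e2; move: ha; rewrite /inD -e2 ltxx.
  rewrite [zeta x ^+ n.+2]exprS.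
  by apply: (mulIf nz); rewrite [RHS]mulrDl -!mulrA mulVf// mulr1; ring.
have step' n : Z 0%N = a ^+ n * Z n.
  by elim: n => [|n IH]; rewrite ?expr0 ?mul1r// IH step exprSr mulrA.
have [B hB] : exists B, forall n, cabs (Z n) <= B.
  exists (2 * \int[lam R]_x ((1 - cabs a)^-1 * cabs (f x))) => n.
  have ic := cintegr_cabs fi.
  apply: cabs_cint => //; first exact: rintegrableZ.
  by move=> x; rewrite cabsM mulrC ler_wpM2r// szego_le.
suff : cabs (Z 0%N) <= 0 by move=> h0; apply/eqP; apply: contraTT h0 => nz; rewrite -ltNge; exact: cabs_gt0.
apply: (@geometric_squeeze _ (cabs a) B); first by rewrite cabs_ge0.
by move=> n; rewrite (step' n) cabsM cabsX ler_wpM2l ?exprn_ge0.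
Qed.

Definition hardy f := forall n, (0 < n)%N -> cint (lam R) (fun x => f x * zeta x ^+ n) = 0.

Definition cauchy_transform f (w : R[i]) :=
  cint (lam R) (fun x => f x * (1 - zeta (- x) * w)^-1).

(** [szego_vanish] annihilates the second summand of [poissonE]. The Poisson integral of a Hardy
    function is thus a Cauchy transform, hence holomorphic. *)
Lemma poisson_hardy f w : cintegr (lam R) f -> hardy f -> inD w ->
  cint (lam R) (fun x => (poisson w x)%:C%C * f x) = cauchy_transform f w.
Proof.
move=> fi hf hw; have hw' := inDJ hw.
have i2 : cintegr (lam R) (fun x => conjc w * (f x * (zeta x ^+ 1 * (1 - conjc w * zeta x)^-1))).
  apply: cintegrZ; apply: (cintegrM_bounded fi (cmeas_szego _ 1)) => x; exact: szego_le.
have e x : (1 - zeta (- x) * w)^-1 = zeta x / (zeta x - w).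
  have z0 := zeta_neq0 x; rewrite zetaN.
  have -> : 1 - (zeta x)^-1 * w = (zeta x - w) / zeta x by rewrite mulrBl divff// mulrC.
  by rewrite invf_div.
have i1 : cintegr (lam R) (fun x => f x * (1 - zeta (- x) * w)^-1).
  have mk : cmeas (fun x : R => (1 - zeta (- x) * w)^-1).
    by apply: eq_cmeas (cmeas_cauchy_kernel w) => x; rewrite e.
  by apply: (cintegrM_bounded fi mk) => x; rewrite e; exact: cauchy_kernel_le.
rewrite -[RHS]addr0 -(mulr0 (conjc w)) -(szego_vanish fi hw' hf) -cintZ; last first.
  by apply: (cintegrM_bounded fi (cmeas_szego _ 1)) => x; exact: szego_le.
rewrite -cintD//; apply: eq_cint => x; rewrite poissonE// e expr1; ring.
Qed.

Lemma cint_ReIm d (T : measurableType d) (m : {measure set T -> \bar R}) (f h : T -> R[i]) (B : R) :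
  cintegr m f -> cmeas h -> (forall x, cabs (h x) <= B) ->
  cint m (fun x => f x * h x) = cint m (fun x => (cRe (h x))%:C%C * f x) +
     Complex 0 1 * cint m (fun x => (cIm (h x))%:C%C * f x).
Proof.
move=> fi [mr mi] hB.
have ir : cintegr m (fun x => (cRe (h x))%:C%C * f x).
  rewrite (_ : (fun x => _) = fun x => f x * (cRe (h x))%:C%C); last by apply/funext => x; rewrite mulrC.
  by apply: (cintegrM_bounded fi (cmeas_real mr) (B := B)) => x; rewrite cabsr (le_trans (ler_Re_cabs _)).
have ii : cintegr m (fun x => (cIm (h x))%:C%C * f x).
  rewrite (_ : (fun x => _) = fun x => f x * (cIm (h x))%:C%C); last by apply/funext => x; rewrite mulrC.
  by apply: (cintegrM_bounded fi (cmeas_real mi) (B := B)) => x; rewrite cabsr (le_trans (ler_Im_cabs _)).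
rewrite -cintZ// -cintD//; last exact: cintegrZ.
by apply: eq_cint => x; apply: eqC; rewrite !cReImE /=; ring.
Qed.

Lemma bmf_ReIm (h : R -> R[i]) (B : R) : cmeas h -> (forall x, cabs (h x) <= B) ->
  bmf (fun x => cRe (h x)) /\ bmf (fun x => cIm (h x)).
Proof.
move=> [mr mi] hB; split; split => //; exists B => x.
  exact: le_trans (ler_Re_cabs _) (hB x).
exact: le_trans (ler_Im_cabs _) (hB x).
Qed.

Lemma density_test_ext f g (h : R -> R[i]) (B : R) : cintegr (lam R) f -> cintegr (lam R) g ->
  density f = density g -> cmeas h -> (forall x, cabs (h x) <= B) ->
  cint (lam R) (fun x => f x * h x) = cint (lam R) (fun x => g x * h x).
Proof.
move=> fi gi e mh hB; have [br bi] := bmf_ReIm mh hB.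
have [rf [ef hf]] := density_rep fi; have [rg [eg hg]] := density_rep gi.
have er : cm_set rf = cm_set rg by rewrite -ef -eg.
by rewrite !(cint_ReIm _ mh hB)// -!hf// -!hg// !(cI_ext er).
Qed.

Lemma cI_poisson_fubini (r : cmrep R) (s : R) (h : R -> R) : 0 <= s < 1 -> bmf h ->
  cint (lam R) (fun y => (h y)%:C%C * cI r (poisson (s%:C%C * zeta y))) =
  cI r (fun x => \int[lam R]_y (h y * poisson (s%:C%C * zeta y) x)).
Proof.
move=> /andP[s0 s1] bh; have [mh [M hM]] := bh.
have zD y : inD (s%:C%C * zeta y) by rewrite /inD cabsM cabs_zeta mulr1 cabsr ger0_norm.
have b y x : `|h y * poisson (s%:C%C * zeta y) x| <= M * ((1 - s) ^+ 2)^-1.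
  rewrite normrM [`|poisson _ _|]ger0_norm ?poisson_ge0// ler_pM ?poisson_ge0//.
  by apply: (le_trans (poisson_le x (zD y))); rewrite cabsM cabs_zeta mulr1 cabsr ger0_norm.
have mj : measurable_fun setT (fun yx : R * R => h yx.1 * poisson (s%:C%C * zeta yx.1) yx.2).
  apply: measurable_funM; last exact: measurable_poisson_joint.
  exact: (measurableT_comp mh measurable_fst).
have F (m : {finite_measure set R -> \bar R}) :
    \int[lam R]_y (h y * \int[m]_x poisson (s%:C%C * zeta y) x) =
    \int[m]_x \int[lam R]_y (h y * poisson (s%:C%C * zeta y) x).
  rewrite -(@RFubini_bounded _ _ _ _ _ (lam R) m
    (fun yx => h yx.1 * poisson (s%:C%C * zeta yx.1) yx.2) _ mj (fun yx => b yx.1 yx.2)).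
  apply: eq_Rintegral => y _.
  have ip : m.-integrable setT (EFin \o poisson (s%:C%C * zeta y)).
    by apply: bmf_integrable; exact: bmf_poisson.
  change (h y * \int[m]_x poisson (s%:C%C * zeta y) x =
    \int[m]_x (h y * poisson (s%:C%C * zeta y) x)).
  by rewrite RintegralZl.
have bm (m : {finite_measure set R -> \bar R}) :
    (lam R).-integrable setT (EFin \o (fun y => h y * \int[m]_x poisson (s%:C%C * zeta y) x)).
  apply: (@integrableM_bmf _ _ _ (lam R) h) => //; apply: bmf_integrable; split.
    exact: (measurable_Rintegral_param m (measurable_poisson_joint s)).
  exists (((1 - s) ^+ 2)^-1 * fine (m setT)) => y; rewrite ger0_norm; last first.
    by apply: Rintegral_ge0 => x _; exact: poisson_ge0.
  rewrite -Rintegral_cst//; apply: le_Rintegral => //.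
  - by apply: bmf_integrable; exact: bmf_poisson.
  - by apply: bmf_integrable; exact: bmf_cst.
  - by move=> x _; apply: (le_trans (poisson_le x (zD y))); rewrite cabsM cabs_zeta mulr1 cabsr ger0_norm.
rewrite /cI /cint -!F; congr Complex; rewrite -RintegralB//; apply: eq_Rintegral => y _.
  by rewrite ReMr /= mulrBr.
by rewrite ImMr /= mulrBr.
Qed.

Variable sg : {finite_measure set R -> \bar R}.
Variable A : set R.
Hypothesis mA : measurable A.
Hypothesis gd : {ae lam R, forall t, exists c, away A (zeta t) c}.
Hypothesis AI : A `<=` Icirc R.

(** [1 - |phi|^2 = 4 * Re F / |F + 1|^2], where [Re F >= 1] and [|F| <= B] on the smaller disc. *)
Lemma phih_strict r : 0 <= r -> r < 1 -> exists r', [/\ 0 <= r', r' < 1 &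
  forall z, cabs z <= r -> cabs (phih sg A z) <= r'].
Proof.
move=> r0 r1; have [F' [B [B0 _ hB _]]] := holP r0 (holD1_Fh sg mA r0 r1).
pose q := 1 - 4 / (B + 1) ^+ 2.
have B1 : 0 < (B + 1) ^+ 2 by rewrite exprn_gt0// ltr_wpDl.
have q1 : q < 1 by rewrite gtrBl divr_gt0.
exists (Num.sqrt q); split => //.
  by rewrite -[ltRHS]sqrtr1 ltr_sqrt.
move=> z hz; have z1 : cabs z <= 1 by apply: le_trans hz (ltW r1).
have F1 := Re_Fh_ge1 sg A z1; have F0 : 0 < cRe (Fh sg A z) by exact: lt_le_trans F1.
rewrite /cabs ler_wsqrtr// csq_phih// /q lerD2l lerN2.
have [hF _] := hB z hz.
have c1 : cabs (Fh sg A z + 1) <= B + 1 by rewrite (le_trans (ler_cabsD _ _))// cabs1 lerD2r.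
have c0 : 0 < csq (Fh sg A z + 1).
  rewrite /csq ReD /= ltr_wpDr ?sqr_ge0// exprn_gt0// addr_gt0//.
rewrite ler_pM ?invr_ge0 ?(ltW B1)//; first by rewrite ler_peMr.
by rewrite lef_pV2 ?posrE// -cabs_sqr lerXn2r ?nnegrE ?addr_ge0.
Qed.

(** The Poisson extension of the image is the holomorphic Cauchy transform of [f] composed with the
    symbol; at radius [s], multiplied by [w ^+ n], it has mean 0. Fubini moves the Poisson kernel
    onto [zeta ^+ n], turning it into [s ^+ n * zeta ^+ n], so [s ^+ n] times the moment
    vanishes. *)
Lemma Top_hardy f : cintegr (lam R) f -> hardy f -> hardy (Top sg A f).
Proof.
move=> fi hf n n0; have [Ti eT] := Cop_density sg mA gd AI fi.
have [r [er hr]] := density_rep fi; have [r1 [er1 hr1]] := density_rep Ti.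
have [r' [er' hr']] := Cop_phih sg mA gd AI r.
have e1 : cm_set r1 = cm_set r' by rewrite -er1 -eT er er'.
(* Any radius strictly between 0 and 1 would serve; it is divided out at the end. *)
pose s : R := 1 / 2.
have s01 : 0 <= s < 1 by rewrite /s; apply/andP; split; lra.
have /andP[s0 s1] := s01.
have s0' : s%:C%C != 0 :> R[i] by rewrite fmorph_eq0 /s mul1r invr_neq0.
have zD y : inD (s%:C%C * zeta y) by rewrite /inD cabsM cabs_zeta mulr1 cabsr ger0_norm.
have U y : cI r1 (poisson (s%:C%C * zeta y)) = cauchy_transform f (phih sg A (s%:C%C * zeta y)).
  have pD : inD (phih sg A (s%:C%C * zeta y)) by apply: phih_inD; exact: (ltW (zD y)).
  rewrite -poisson_hardy// -hr; last exact: bmf_poisson.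
  rewrite (cI_ext e1); last exact: bmf_poisson.
  rewrite hr'; last exact: bmf_poisson.
  by congr cI; apply/funext => a; exact: tau_poisson.
pose G w := cauchy_transform f (phih sg A (s%:C%C * w)) * w ^+ n.
have hG : hol 1 G.
  have [q [q0 q1 hq]] := phih_strict s0 s1.
  apply: holM => //; last by apply: holX => //; exact: hol_id.
  apply: (@hol_scale _ s (fun z => cauchy_transform f (phih sg A z))) => //.
  apply: (hol_comp s0 q0 hq); first exact: (holD1_phih sg mA).
  exact: (hol_cauchy_transform fi q0 q1).
have G0 : G 0 = 0 by rewrite /G expr0n eqn0Ngt n0 mulr0.
have := mean_value hG; rewrite G0 /G.
have mz : cmeas (fun y : R => zeta y ^+ n) by apply: cmeasX; exact: cmeas_zeta.
have bz y : cabs (zeta y ^+ n) <= 1 by rewrite cabsX cabs_zeta expr1n.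
have [br bi] := bmf_ReIm mz bz.
have iU : cintegr (lam R) (fun y => cauchy_transform f (phih sg A (s%:C%C * zeta y))).
  have hS : hol 1 (fun w => cauchy_transform f (phih sg A (s%:C%C * w))).
    have [q [q0 q1 hq]] := phih_strict s0 s1.
    apply: (@hol_scale _ s (fun z => cauchy_transform f (phih sg A z))) => //.
    apply: (hol_comp s0 q0 hq); first exact: (holD1_phih sg mA).
    exact: (hol_cauchy_transform fi q0 q1).
  have [f' [B [B0 _ f2 f3]]] := holP ler01 hS.
  apply: (cintegr_bounded (B := B) (lamT_lty R)); last by move=> y; have [] := f2 (zeta y) (zeta_le1 y).
  have ps : cabs (0 : R[i]) + 1 <= 1 by rewrite cabs0 add0r.
  pose H w := cauchy_transform f (phih sg A (s%:C%C * w)).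
  have f3' v w : cabs v <= 1 -> cabs w <= 1 -> cabs (H w - H v) <= B * cabs (w - v).
    by move=> hv hw; have [] := f3 v w hv hw.
  by apply: eq_cmeas (cmeas_circle B0 f3' ler01 ps) => y; rewrite add0r mul1r.
rewrite (cint_ReIm iU mz bz).
have P (h : R -> R) (g : R -> R) : bmf h -> bmf g ->
    (forall x, \int[lam R]_y (h y * poisson (s%:C%C * zeta y) x) = g x) ->
    cint (lam R) (fun y => (h y)%:C%C * cauchy_transform f (phih sg A (s%:C%C * zeta y))) =
    cint (lam R) (fun x => (g x)%:C%C * Top sg A f x).
  move=> bh bg hg; rewrite -hr1//.
  rewrite (_ : g = fun x => \int[lam R]_y (h y * poisson (s%:C%C * zeta y) x)); last by apply/funext.
  by rewrite -cI_poisson_fubini//; apply: eq_cint => y; rewrite U.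
have pf x : cint (lam R) (fun y => zeta y ^+ n * (poisson (s%:C%C * zeta y) x)%:C%C) =
    (s%:C%C * zeta x) ^+ n.
  under eq_cint do rewrite poisson_sym.
  by rewrite (poisson_formula (holX n ler01 (hol_id 1)) (zD x)).
have mg : cmeas (fun x : R => (s%:C%C * zeta x) ^+ n).
  by apply: cmeasX; apply: cmeasM; [exact: cmeas_cst|exact: cmeas_zeta].
have bg x : cabs ((s%:C%C * zeta x) ^+ n) <= 1.
  by rewrite cabsX exprn_ile1 ?cabs_ge0// ltW// zD.
have [gr gi] := bmf_ReIm mg bg.
rewrite (P _ (fun x => cRe ((s%:C%C * zeta x) ^+ n)))//; last first.
  move=> x; rewrite -pf; apply: eq_Rintegral => y _.
  by rewrite [zeta y ^+ n * _]mulrC ReMr mulrC.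
rewrite (P _ (fun x => cIm ((s%:C%C * zeta x) ^+ n)))//; last first.
  move=> x; rewrite -pf; apply: eq_Rintegral => y _.
  by rewrite [zeta y ^+ n * _]mulrC ImMr mulrC.
rewrite -(cint_ReIm Ti mg bg).
under eq_cint do rewrite exprMn mulrCA.
rewrite cintZ; last first.
  exact: (cintegrM_bounded Ti mz bz).
by move/eqP; rewrite mulf_eq0 expf_eq0 (negbTE s0') andbF => /eqP.
Qed.

End HardyInvariance.

(** * Norms of L^p and H^p through representatives *)

Section LpNorm.
Variable R : realType.
Variable p : R.
Hypothesis p1 : 1 <= p.
Implicit Types (f g : R -> R[i]).
Let p0 : 0 < p. Proof. exact: lt_le_trans p1. Qed.
Let pn0 : p != 0. Proof. by rewrite gt_eqF. Qed.
Let pV0 : 0 < p^-1. Proof. by rewrite invr_gt0. Qed.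

Lemma lp_norm_fun_lam f : cmeas f ->
  lp_norm_fun p f = ((\int[lam R]_t (cabs (f t) `^ p)%:E) `^ p^-1)%E.
Proof.
move=> mf; rewrite /lp_norm_fun; congr (_ `^ _)%E; rewrite ge0_integral_lam//.
  by apply/measurable_EFinP; apply: measurable_powR_comp; exact: measurable_cabs.
by move=> x; rewrite lee_fin powR_ge0.
Qed.

Lemma eq_lp_norm_fun f g : (forall x, Icirc R x -> f x = g x) ->
  lp_norm_fun p f = lp_norm_fun p g.
Proof.
move=> h; have E : (\int[leb R]_(x in Icirc R) (cabs (f x) `^ p)%:E =
    \int[leb R]_(x in Icirc R) (cabs (g x) `^ p)%:E)%E.
  by apply: eq_integral => x /set_mem xI; rewrite h.
by rewrite /lp_norm_fun E.
Qed.

Lemma cleb_int_lam f g : cmeas f -> (forall x, Icirc R x -> f x = g x) ->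
  cleb_int (Icirc R) g = cint (lam R) f.
Proof.
move=> [m1 m2] h; rewrite /cleb_int /cint /Rintegral !integral_lam;
  [|exact/measurable_EFinP..].
by congr Complex; congr fine; apply: eq_integral => x /set_mem xI; rewrite h.
Qed.

Lemma lp_norm_le f C : lpb p f C -> 0 <= C -> (lp_norm p (density f) <= (C `^ p^-1)%:E)%E.
Proof.
move=> [fi hC] C0; have mf := cintegr_cmeas fi.
apply: (@le_trans _ _ (lp_norm_fun p f)).
  by apply: ereal_inf_lbound; exists f; split => //; exact/cintegrable_lam.
rewrite lp_norm_fun_lam// -poweR_EFin gt0_ler_poweR ?(ltW pV0)// in_itv/= ?leey ?andbT//.
by apply: integral_ge0 => t _; rewrite lee_fin powR_ge0.
Qed.

Lemma lpb_of_norm f M : cintegr (lam R) f -> 0 < M -> (lp_norm_fun p f < M%:E)%E ->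
  lpb p f (M `^ p).
Proof.
move=> fi M0; have mf := cintegr_cmeas fi; rewrite lp_norm_fun_lam// => h; split => //.
rewrite leNgt; apply/negP => /ltW h2; move: h; apply/negP; rewrite -leNgt.
have -> : M%:E = ((M `^ p)%:E `^ p^-1)%E.
  by rewrite poweR_EFin -powRrM divff// powRr1// ltW.
by rewrite gt0_ler_poweR ?(ltW pV0)// in_itv/= ?leey ?andbT ?lee_fin ?powR_ge0//;
  apply: le_trans h2; rewrite lee_fin powR_ge0.
Qed.

(** [lp_norm] is an infimum over densities, so a representative within the bound is obtained from a
    strict inequality. *)
Lemma lp_norm_ex nu M : 0 < M -> (lp_norm p nu < M%:E)%E ->
  exists f, nu = density f /\ lpb p f (M `^ p).
Proof.
move=> M0 /ereal_inf_lt [_ [f [fi [-> ->]]] hM].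
have [g [gi hg]] := cintegrable_normal fi; exists g; split.
  by apply: eq_density => x /hg.
have h : (lp_norm_fun p g < M%:E)%E by rewrite (eq_lp_norm_fun hg).
exact: (lpb_of_norm gi M0 h).
Qed.

Lemma lpb_in_Lp f C : lpb p f C -> 0 <= C -> in_Lp p (density f).
Proof. by move=> h C0; exact: le_lt_trans (lp_norm_le h C0) (ltry _). Qed.

Lemma in_Lp_ex nu : in_Lp p nu -> exists f C, [/\ nu = density f, 0 <= C & lpb p f C].
Proof.
move=> h; have [M M0 hM] : exists2 M : R, 0 < M & (lp_norm p nu < M%:E)%E.
  move: h; rewrite /in_Lp; case: (lp_norm p nu) => [r _|//|_].
    by exists (`|r| + 1); [rewrite ltr_wpDl|rewrite lte_fin (le_lt_trans (ler_norm _))// ltrDl].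
  by exists 1; rewrite ?ltNyr.
have [f [e hf]] := lp_norm_ex M0 hM; exists f, (M `^ p); split => //; exact: powR_ge0.
Qed.

Lemma lpb_in_Hp f C : lpb p f C -> hardy f -> in_Hp p (density f).
Proof.
move=> [fi hC] hf; have mf := cintegr_cmeas fi; exists f; split; first exact/cintegrable_lam.
split=> //; split.
  by rewrite lp_norm_fun_lam// poweR_lty// (le_lt_trans hC)// ltry.
move=> n n0; rewrite -(hf n n0); apply: cleb_int_lam => //.
by apply: cmeasM => //; apply: cmeasX; exact: cmeas_zeta.
Qed.

(** The function witnessing membership may differ from [f]; equal densities have equal integrals
    against the bounded functions [zeta ^+ n]. *)
Lemma in_Hp_hardy f : cintegr (lam R) f -> in_Hp p (density f) -> hardy f.
Proof.
move=> fi [g [gi [e [_ hg]]]] n n0.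
have [k [ki hk]] := cintegrable_normal gi.
have mz := cmeasX n (@cmeas_zeta R).
have bz x : cabs (zeta x ^+ n : R[i]) <= 1 by rewrite cabsX cabs_zeta expr1n.
have e' : density f = density k by rewrite e; apply/esym/eq_density.
rewrite (density_test_ext fi ki e' mz bz) -(hg n n0); apply/esym/cleb_int_lam.
  by apply: cmeasM => //; exact: cintegr_cmeas ki.
by move=> x xI; rewrite hk.
Qed.

Lemma in_Hp_Lp nu : in_Hp p nu -> in_Lp p nu.
Proof.
by move=> [f [fi [e [h _]]]]; apply: le_lt_trans h; apply: ereal_inf_lbound; exists f.
Qed.

Lemma density_sub f g : cintegr (lam R) f -> cintegr (lam R) g ->
  cm_sub (density f) (density g) = density (fun x => f x - g x).
Proof.
move=> fi gi; have mf := cintegr_cmeas fi; have mg := cintegr_cmeas gi.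
apply/funext => B; rewrite /cm_sub; have [mB|nB] := pselect (measurable B); last first.
  by rewrite /density !ifF ?subr0//; apply/asboolP.
rewrite !densityE//; last exact: cmeasB.
have ii (k : R -> R[i]) : cintegr (lam R) k -> cintegr (lam R) (fun x => (\1_B x)%:C%C * k x).
  move=> ki; rewrite (_ : (fun x => _) = fun x => k x * (\1_B x)%:C%C); last by apply/funext => x; rewrite mulrC.
  apply: (cintegrM_bounded ki (cmeas_indic mB) (B := 1)) => x.
  by rewrite cabsr; have /andP[a b] := indic_le1 B x; rewrite ger0_norm.
by rewrite -cintB; [apply: eq_cint => x; rewrite mulrBr|exact: ii|exact: ii].
Qed.

End LpNorm.

(** * Norm estimates on L^p *)

Section CopOnLp.
Variable R : realType.
Variable p : R.
Hypothesis p1 : 1 <= p.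
Variable sg : {finite_measure set R -> \bar R}.
Implicit Types (A B : set R) (f : R -> R[i]).
Let p0 : 0 < p. Proof. exact: lt_le_trans p1. Qed.

Lemma Rintegral_kkl A t : \int[lam R]_a `|kk sg A a t| = 1.
Proof.
under eq_Rintegral do rewrite ger0_norm ?kk_ge0//.
exact: kk_int_dual.
Qed.

Lemma Top_lpb A f C : measurable A -> {ae lam R, forall t, exists c, away A (zeta t) c} ->
  A `<=` Icirc R -> mass sg A <= 1 -> lpb p f C ->
  lpb p (Top sg A f) (6 `^ p * 2 * C).
Proof.
move=> mA gd AI m1 hf; have [Ti _] := Cop_density sg mA gd AI hf.1; split=> //.
apply: (kernel_operator_lp (w := fun at_ => kk sg A at_.1 at_.2)) hf => //.
- exact: measurable_kk.
- by move=> t; exact: bmf_kkl.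
- by move=> t; rewrite Rintegral_kkl ler1n.
- by move=> a; apply: integrable_kkr => //; exact: finm_lty.
- move=> a; have e1 : \int[lam R]_t `|kk sg A a t| <= 1 + mass sg A.
    by under eq_Rintegral do rewrite ger0_norm ?kk_ge0//; exact: kk_mass_le.
  by apply: (le_trans e1); lra.
Qed.

(** The integral of the difference in [a] is merely bounded by [1 + 1]; the small factor comes from
    the integral in [t]. *)
Lemma Top_sub_lpb A B f C e : measurable A -> measurable B ->
  {ae lam R, forall t, exists c, away A (zeta t) c} ->
  {ae lam R, forall t, exists c, away B (zeta t) c} ->
  A `<=` Icirc R -> B `<=` Icirc R -> 0 <= e ->
  (forall a, \int[lam R]_t `|kk sg A a t - kk sg B a t| <= e) -> lpb p f C ->
  lpb p (fun t => Top sg A f t - Top sg B f t) (6 `^ p * e * C).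
Proof.
move=> mA mB gA gB AI BI e0 he hf; have fi := hf.1.
have [TA _] := Cop_density sg mA gA AI fi; have [TB _] := Cop_density sg mB gB BI fi.
split; first exact: cintegrB.
have mf := cintegr_cmeas fi.
have ik D t : cintegr (lam R) (fun a : R => (kk sg D a t)%:C%C * f a).
  rewrite (_ : (fun a => _) = fun a => f a * (kk sg D a t)%:C%C); last by apply/funext => x; rewrite mulrC.
  have [mk [M hM]] := bmf_kkl sg D t.
  by apply: (cintegrM_bounded fi (cmeas_real mk) (B := M)) => x; rewrite cabsr.
have E t : Top sg A f t - Top sg B f t =
    cint (lam R) (fun a : R => (kk sg A a t - kk sg B a t)%:C%C * f a).
  by rewrite /Top -cintB//; apply: eq_cint => a; rewrite rmorphB mulrBl.
under eq_integral do rewrite E.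
apply: (kernel_operator_lp (w := fun at_ => kk sg A at_.1 at_.2 - kk sg B at_.1 at_.2)) hf => //.
- by apply: measurable_funB; exact: measurable_kk.
- by move=> t; apply: bmfB; exact: bmf_kkl.
- move=> t; apply: (@le_trans _ _ (\int[lam R]_a (`|kk sg A a t| + `|kk sg B a t|))).
    have i1 := rintegrable_norm (bmf_integrable (lam R) (bmf_kkl sg A t)).
    have i2 := rintegrable_norm (bmf_integrable (lam R) (bmf_kkl sg B t)).
    apply: le_Rintegral => //; last by move=> a _; exact: ler_normB.
    + by apply: rintegrable_norm; apply: bmf_integrable; apply: bmfB; exact: bmf_kkl.
    + exact: (rintegrableD i1 i2).
  rewrite RintegralD//; [|by apply: rintegrable_norm; apply: bmf_integrable; exact: bmf_kkl..].
  by rewrite !Rintegral_kkl.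
- by move=> a; apply: rintegrableB; apply: integrable_kkr => //; exact: finm_lty.
Qed.

End CopOnLp.

(** * Properties common to M, L^p and H^p *)

Section NiceSpace.
Variable R : realType.
Implicit Types (X : bspace R) (f g : R -> R[i]).
Let mI := @measurable_Icirc R.

(** What the arguments at [t = 0] and [t = 1] ask of a space. [nice_total] and [nice_cst] serve the
    rank-one operator. [nice_eval] turns norm convergence into setwise convergence, [nice_lower]
    makes the integral of the [p]-th power small with the norm, and [nice_hardy] admits the peak
    functions; Hardy functions are used so that H^p is included. M takes part with [p = 1]. *)
Record nice_space X (p : R) : Prop := NiceSpace {
  nice_cmeasure : forall x, bs_mem X x -> is_cmeasure x;
  nice_total : forall M : R, exists K : R, forall x, bs_mem X x -> (bs_norm X x <= M%:E)%E ->
    cabs (x setT) <= K;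
  nice_cst : forall k : R[i], bs_mem X (density (fun=> k)) /\
    (bs_norm X (density (fun=> k)) <= (cabs k)%:E)%E;
  nice_eval : forall u v (e : R), is_cmeasure u -> is_cmeasure v -> 0 < e ->
    (bs_norm X (cm_sub u v) < e%:E)%E -> forall B, measurable B -> cabs (u B - v B) <= 4 * e;
  nice_lower : forall d : R, 0 < d -> exists2 e : R, 0 < e & forall g, cintegr (lam R) g ->
    (bs_norm X (density g) < e%:E)%E -> (\int[lam R]_t (cabs (g t) `^ p)%:E < d%:E)%E;
  nice_hardy : forall f, lpb p f 1 -> hardy f ->
    bs_mem X (density f) /\ (bs_norm X (density f) <= 2%:E)%E }.

Lemma cm_set_circ r B : measurable B -> cm_set r B = cm_set r (B `&` Icirc R) :> R[i].
Proof.
move=> mB; rewrite /cm_set !ifT ?setIA; [|exact/asboolP/measurableI|exact/asboolP].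
by rewrite -setIA setIid.
Qed.

Lemma cmeasure_circ nu B : is_cmeasure nu -> measurable B -> nu B = nu (B `&` Icirc R) :> R[i].
Proof. by move=> [r ->]; exact: cm_set_circ. Qed.

Lemma cabs_density_le f B : cintegr (lam R) f -> measurable B ->
  cabs (density f B) <= 2 * \int[lam R]_x (\1_B x * cabs (f x)).
Proof.
move=> fi mB; have mf := cintegr_cmeas fi; rewrite densityE//.
have ic := cintegr_cabs fi.
apply: cabs_cint.
- rewrite (_ : (fun x => _) = fun x => f x * (\1_B x)%:C%C); last by apply/funext => x; rewrite mulrC.
  apply: (cintegrM_bounded fi (cmeas_indic mB) (B := 1)) => x.
  by rewrite cabsr; have /andP[a b] := indic_le1 B x; rewrite ger0_norm.
- by apply: integrableM_bmf => //; exact: bmf_indic.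
- by move=> x; rewrite cabsM cabsr ger0_norm//; have /andP[] := indic_le1 B x.
Qed.

Lemma lpb_L1 p f (l C : R) : 1 <= p -> 0 < l -> lpb p f C ->
  \int[lam R]_x cabs (f x) <= l + l `^ (1 - p) * C.
Proof.
move=> p1 l0 hf; have ip := lpb_integrable hf; have [fi hC] := hf.
have ic := cintegr_cabs fi.
apply: (@le_trans _ _ (\int[lam R]_x (cst l x + l `^ (1 - p) * cabs (f x) `^ p))).
  apply: le_Rintegral => //.
    apply: rintegrableD; last exact: rintegrableZ.
    by apply: bmf_integrable; exact: bmf_cst.
  by move=> x _; exact: powR_young.
rewrite RintegralD//; [|by apply: bmf_integrable; exact: bmf_cst|exact: rintegrableZ].
rewrite Rintegral_cst// RintegralZl// (_ : fine (lam R setT) = 1); last by have := lamT R => /= ->.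
rewrite mulr1 lerD2l ler_wpM2l ?powR_ge0// -lee_fin /Rintegral fineK//.
exact: integrable_fin_num.
Qed.

Lemma cintegr_cst (k : R[i]) : cintegr (lam R) (fun=> k).
Proof.
apply: (cintegr_bounded (B := cabs k) (lamT_lty R)) => //; exact: cmeas_cst.
Qed.

Lemma lpb_cst p (k : R[i]) : lpb p (fun=> k) (cabs k `^ p).
Proof.
split; first exact: cintegr_cst.
by rewrite integral_cst//; have := lamT R => /= ->; rewrite mule1.
Qed.

Lemma hardy_cst (k : R[i]) : hardy (fun _ : R => k).
Proof.
move=> n n0.
have /= <- : (fun w : R[i] => k * w ^+ n) 0 = 0 by rewrite expr0n eqn0Ngt n0 mulr0.
rewrite -(@mean_value _ (fun w => k * w ^+ n))//.
by apply: holM => //; [exact: hol_cst|apply: holX => //; exact: hol_id].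
Qed.

Lemma density_ae f g : cintegr (lam R) f -> cintegr (lam R) g -> density f = density g ->
  {ae lam R, forall x, f x = g x}.
Proof.
move=> fi gi e; have [f1 f2] := fi; have [g1 g2] := gi.
have mf := cintegr_cmeas fi; have mg := cintegr_cmeas gi.
have key (h k : R -> R) : (lam R).-integrable setT (EFin \o h) -> (lam R).-integrable setT (EFin \o k) ->
    (forall B, measurable B -> \int[lam R]_x (\1_B x * h x) = \int[lam R]_x (\1_B x * k x)) ->
    ae_eq (lam R) setT (EFin \o h) (EFin \o k).
  move=> ih ik hk; apply: integral_ae_eq => //; first exact: measurable_int ik.
  move=> B _ mB.
  have c (q : R -> R) : (lam R).-integrable setT (EFin \o q) ->
      (\int[lam R]_(x in B) (EFin \o q) x = (\int[lam R]_x (\1_B x * q x))%:E)%E.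
    move=> iq; have iBq : (lam R).-integrable setT (EFin \o (fun x => \1_B x * q x)).
      by apply: integrableM_bmf => //; exact: bmf_indic.
    rewrite /Rintegral fineK; last exact: integrable_fin_num.
    rewrite [LHS]integral_mkcond; apply: eq_integral => x _.
    by rewrite patchE indicE /=; case: (x \in B); rewrite ?mul1r ?mul0r.
  by rewrite !c// hk.
have eB B : measurable B -> cint (lam R) (fun x => (\1_B x)%:C%C * f x) =
    cint (lam R) (fun x => (\1_B x)%:C%C * g x).
  by move=> mB; rewrite -!densityE// e.
have k1 : ae_eq (lam R) setT (EFin \o (fun x => cRe (f x))) (EFin \o (fun x => cRe (g x))).
  apply: key => // B mB; have := congr1 (@complex.Re R) (eB B mB); rewrite /cint.
  move=> h; transitivity (\int[lam R]_x cRe ((\1_B x)%:C%C * f x)).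
    by apply: eq_Rintegral => x _; rewrite ReMr.
  by rewrite -[LHS]/(cRe (Complex _ (\int[lam R]_x cIm ((\1_B x)%:C%C * f x)))) h /=;
    apply: eq_Rintegral => x _; exact: ReMr.
have k2 : ae_eq (lam R) setT (EFin \o (fun x => cIm (f x))) (EFin \o (fun x => cIm (g x))).
  apply: key => // B mB; have := congr1 (@complex.Im R) (eB B mB); rewrite /cint.
  move=> h; transitivity (\int[lam R]_x cIm ((\1_B x)%:C%C * f x)).
    by apply: eq_Rintegral => x _; rewrite ImMr.
  by rewrite -[LHS]/(cIm (Complex (\int[lam R]_x cRe ((\1_B x)%:C%C * f x)) _)) h /=;
    apply: eq_Rintegral => x _; exact: ImMr.
move: k1 k2 => [N1 [mN1 N10 h1]] [N2 [mN2 N20 h2]].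
exists (N1 `|` N2); split; [exact: measurableU|exact: null_set_setU|].
move=> x /= hx; apply: contrapT => nN; apply: hx; apply: eqC.
  by apply: contrapT => h; apply: nN; left; apply: h1 => /= h'; apply: h; have [] := h' I.
by apply: contrapT => h; apply: nN; right; apply: h2 => /= h'; apply: h; have [] := h' I.
Qed.

Lemma lp_integral_ext p f g : cintegr (lam R) f -> cintegr (lam R) g -> density f = density g ->
  (\int[lam R]_t (cabs (f t) `^ p)%:E = \int[lam R]_t (cabs (g t) `^ p)%:E)%E.
Proof.
move=> fi gi e; have [N [mN N0 hN]] := density_ae fi gi e.
have m k : cintegr (lam R) k -> measurable_fun setT (fun t => (cabs (k t) `^ p)%:E).
  move=> ki; apply/measurable_EFinP; apply: measurable_powR_comp; apply: measurable_cabs.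
  exact: (cintegr_cmeas ki).
apply: ae_eq_integral => //; [exact: m|exact: m|].
exists N; split => // x /= h; apply: hN => /= h'; apply: h => _; by rewrite h'.
Qed.

Lemma nice_M : nice_space (Mspace R) 1.
Proof.
have tvI u (e : R) : (forall B, measurable B -> u B = u (B `&` Icirc R)) ->
    (tv_norm u <= e%:E)%E -> forall B, measurable B -> cabs (u B) + cabs (u (~` B)) <= e.
  by move=> uI hu B mB; have := tv_norm_ge2 mB hu; rewrite -!uI//; exact: measurableC.
have tvd f : cintegr (lam R) f -> (tv_norm (density f) <= (2 * \int[lam R]_x cabs (f x))%:E)%E.
  move=> fi; have ic := cintegr_cabs fi; apply: tv_norm_le => n E mE tE.
  apply: (@le_trans _ _ (\sum_(i < n) 2 * `|\int[lam R]_x (\1_(E i) x * cabs (f x))|)).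
    apply: ler_sum => i _; apply: (le_trans (cabs_density_le fi (mE i))).
    by rewrite ler_wpM2l// ler_norm.
  rewrite -mulr_sumr ler_wpM2l//; apply: (le_trans (sum_indic_Rintegral_le mE tE ic)).
  by rewrite le_eqVlt; apply/orP; left; apply/eqP; apply: eq_Rintegral => x _; rewrite ger0_norm.
split.
- by [].
- move=> M; exists M => x cx hx.
  have := tvI x M (fun B mB => cmeasure_circ cx mB) hx setT measurableT.
  by apply: le_trans; rewrite lerDl.
- move=> k; split; first by apply: density_cmeasure; exact: cintegr_cst.
  apply: tv_norm_le => n E mE tE.
  have e i : cabs (density (fun=> k) (E i)) = cabs k * `|\int[lam R]_x (\1_(E i) x * cst 1 x)|.
    rewrite densityE//.
    under eq_cint do rewrite mulrC.
    rewrite cintZ ?cint_real; last first.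
      apply: (cintegr_bounded (B := 1) (lamT_lty R)); first exact: cmeas_indic.
      by move=> x; rewrite cabsr; have /andP[a b] := indic_le1 (E i) x; rewrite ger0_norm.
    rewrite cabsM cabsr; congr (_ * `|_|).
    by apply: eq_Rintegral => x _; rewrite mulr1.
  under eq_bigr do rewrite e.
  rewrite -mulr_sumr ler_piMr//.
  have i1 := bmf_integrable (lam R) (bmf_cst R (1 : R)).
  apply: (le_trans (sum_indic_Rintegral_le mE tE i1)).
  under eq_Rintegral do rewrite normr1.
  by rewrite Rintegral_cst// mul1r; have := lamT R => /= ->.
- move=> u v e cu cv e0 h B mB.
  have hI B' : measurable B' -> cm_sub u v B' = cm_sub u v (B' `&` Icirc R).
    by move=> mB'; rewrite /cm_sub (cmeasure_circ cu mB') (cmeasure_circ cv mB').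
  have := tvI (cm_sub u v) e hI (ltW h) B mB; rewrite /cm_sub => h1.
  have := cabs_ge0 (u (~` B) - v (~` B)); lra.
(* Real and imaginary parts will each have L^1 norm at most [d / 4], which leaves room for the
   strict inequality. *)
- move=> d d0; exists (d / 4); first by rewrite divr_gt0.
  move=> g gi h; have [g1 g2] := gi; have mg := cintegr_cmeas gi.
  have ic := cintegr_cabs gi.
  have cd := density_cmeasure gi.
  have tvg := tvI _ _ (fun B mB => cmeasure_circ cd mB) (ltW h).
  (* Evaluating the measure on the set [P] where [q] is nonnegative and on its complement recovers
     the L^1 norm of [q]. *)
  have key (q : R -> R) : (lam R).-integrable setT (EFin \o q) -> 
      (forall B, measurable B -> `|\int[lam R]_x (\1_B x * q x)| <= cabs (density g B)) ->
      \int[lam R]_x `|q x| <= d / 4.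
    move=> iq hq; pose P := [set x | 0 <= q x].
    have mq : measurable_fun setT q by apply/measurable_EFinP; exact: measurable_int iq.
    have mP : measurable P.
      rewrite (_ : P = setT `&` q @^-1` `[0, +oo[%classic); first exact: mq.
      by apply/seteqP; split => x; rewrite /P /= in_itv/= andbT; [split|case].
    have iB B : measurable B -> (lam R).-integrable setT (EFin \o (fun x => \1_B x * q x)).
      by move=> mB; apply: integrableM_bmf => //; exact: bmf_indic.
    have -> : \int[lam R]_x `|q x| = \int[lam R]_x (\1_P x * q x) - \int[lam R]_x (\1_(~` P) x * q x).
      rewrite -RintegralB//; [|exact: iB|by apply: iB; exact: measurableC].
      apply: eq_Rintegral => x _; rewrite !indicE in_setC.
      have [/set_mem /= h0|/negP h0] := boolP (x \in P).
        by rewrite ger0_norm// mul1r mul0r subr0.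
      rewrite mul0r mul1r sub0r ltr0_norm//; rewrite ltNge; apply/negP => h1.
      by apply: h0; rewrite inE.
    apply: le_trans (tvg P mP); apply: lerD.
      exact: le_trans (ler_norm _) (hq _ mP).
    by rewrite (le_trans (ler_norm _))// normrN; apply: hq; exact: measurableC.
  have k1 : \int[lam R]_x `|cRe (g x)| <= d / 4.
    apply: key => // B mB; rewrite densityE//; apply: le_trans (ler_Re_cabs _).
    by rewrite /cint /=; under [X in _ <= `|X|]eq_Rintegral do rewrite -[X in cRe X]/(_ * _) ReMr.
  have k2 : \int[lam R]_x `|cIm (g x)| <= d / 4.
    apply: key => // B mB; rewrite densityE//; apply: le_trans (ler_Im_cabs _).
    by rewrite /cint /=; under [X in _ <= `|X|]eq_Rintegral do rewrite -[X in cIm X]/(_ * _) ImMr.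
  have n1 := rintegrable_norm g1; have n2 := rintegrable_norm g2.
  have -> : (\int[lam R]_t (cabs (g t) `^ 1)%:E = (\int[lam R]_t cabs (g t))%:E)%E.
    rewrite /Rintegral fineK; last exact: integrable_fin_num.
    by apply: eq_integral => t _; rewrite powRr1.
  rewrite lte_fin; apply: (@le_lt_trans _ _ (\int[lam R]_t (`|cRe (g t)| + `|cIm (g t)|))).
    apply: le_Rintegral => //; first exact: rintegrableD.
    by move=> t _; exact: ler_cabs_ReIm.
  by rewrite RintegralD//; lra.
- move=> f hf _; split; first exact: density_cmeasure hf.1.
  have h := lpb_L1 (lexx 1) (ltr01 : 0 < (1:R)) hf.
  apply: (le_trans (tvd f hf.1)); rewrite lee_fin ler_piMr//.
  rewrite -lee_fin; apply: le_trans hf.2; rewrite /Rintegral fineK; last first.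
    by apply: integrable_fin_num => //; exact: cintegr_cabs hf.1.
  by apply: ge0_le_integral => //; [by move=> t _; rewrite lee_fin|
    exact: measurable_int (cintegr_cabs hf.1)|exact: measurable_int (lpb_integrable hf)|
    by move=> t _; rewrite powRr1].
Qed.

Lemma nice_Lp_sub p X : 1 <= p -> bs_norm X = lp_norm p ->
  (forall x, bs_mem X x -> in_Lp p x) ->
  (forall f C, 0 <= C -> lpb p f C -> hardy f -> bs_mem X (density f)) ->
  nice_space X p.
Proof.
move=> p1 eN sub mem; have p0 : 0 < p by exact: lt_le_trans p1.
have pn0 : p != 0 by rewrite gt_eqF.
split; rewrite ?eN.
- by move=> x /sub/in_Lp_ex -/(_ p1) [f [C [-> C0 [fi _]]]]; exact: density_cmeasure.
- move=> M; pose M' := `|M| + 1; have M'0 : 0 < M' by rewrite ltr_wpDl.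
  exists (2 * (1 + 1 `^ (1 - p) * M' `^ p)) => x _ hx.
  have hx' : (lp_norm p x < M'%:E)%E.
    by apply: (le_lt_trans hx); rewrite lte_fin (le_lt_trans (ler_norm _))// ltrDl.
  have [f [-> hf]] := lp_norm_ex p1 M'0 hx'.
  apply: (le_trans (cabs_density_le hf.1 measurableT)); rewrite ler_wpM2l//.
  apply: le_trans (lpb_L1 p1 ltr01 hf).
  by rewrite le_eqVlt; apply/orP; left; apply/eqP; apply: eq_Rintegral => x' _; rewrite indicT mul1r.
- move=> k; split.
    by apply: (mem _ (cabs k `^ p)); [exact: powR_ge0|exact: lpb_cst|exact: hardy_cst].
  apply: (le_trans (lp_norm_le p1 (lpb_cst p k) (powR_ge0 _ _))).
  by rewrite -powRrM divff// powRr1.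
- move=> u v e cu cv e0 h B mB; have [f [ef hf]] := lp_norm_ex p1 e0 h.
  have -> : u B - v B = density f B by rewrite -ef.
  have ic := cintegr_cabs hf.1.
  apply: (le_trans (cabs_density_le hf.1 mB)).
  apply: (@le_trans _ _ (2 * (e + e))); last lra.
  rewrite ler_wpM2l//; apply: (@le_trans _ _ (\int[lam R]_x cabs (f x))).
    apply: le_Rintegral => //; first by apply: integrableM_bmf => //; exact: bmf_indic.
    by move=> x _; have /andP[a b] := indic_le1 B x; rewrite ler_piMl.
  (* With [l = e] both terms of [lpb_L1] equal [e], because [e ^ (1 - p) * e ^ p = e]. *)
  apply: (le_trans (lpb_L1 p1 e0 hf)); rewrite lerD2l -powRD ?subrK ?powRr1 ?(ltW e0)//.
  by rewrite gt_eqF ?implybT.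
- move=> d d0; exists ((d / 2) `^ p^-1); first by rewrite powR_gt0// divr_gt0.
  move=> g gi h; have e0 : 0 < (d / 2) `^ p^-1 by rewrite powR_gt0// divr_gt0.
  have [f [ef [fi hf]]] := lp_norm_ex p1 e0 h.
  rewrite (lp_integral_ext p gi fi ef); apply: (le_lt_trans hf).
  by rewrite -powRrM mulVf// powRr1 ?divr_ge0 ?(ltW d0)// lte_fin; lra.
- move=> f hf hh; split; first exact: (mem _ 1).
  apply: (le_trans (lp_norm_le p1 hf ler01)).
  by rewrite lee_fin powR1 ler1n.
Qed.

Lemma admissible_nice X : admissible_space X -> exists2 p, 1 <= p & nice_space X p.
Proof.
move=> [->|[p [p1 [->|->]]]]; [by exists 1 => //; exact: nice_M| |]; exists p => //.
  apply: nice_Lp_sub => // f C C0 hf _; exact: lpb_in_Lp hf C0.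
apply: nice_Lp_sub => //; first by move=> x; exact: in_Hp_Lp.
by move=> f C C0 hf hh; exact: lpb_in_Hp hf hh.
Qed.

End NiceSpace.

(** * Compactness at [t = 0] *)

Section CompactAtZero.
Variable R : realType.
Local Notation sgC := (@sgC R).
Local Notation arcA := (@arcA R).

Lemma arcA_sub s : s <= 1 -> arcA s `<=` Icirc R.
Proof.
move=> s1 x [_]; rewrite /Icirc /= !in_itv/= => /andP[-> h] /=; exact: lt_le_trans h s1.
Qed.

Lemma arcA0 : arcA 0 = set0.
Proof.
apply/seteqP; split => x //= [_]; rewrite /= in_itv/= => /andP[h1 h2].
by have := le_lt_trans h1 h2; rewrite ltxx.
Qed.

Lemma kk_set0 a t : kk sgC set0 a t = 1 :> R.
Proof.
have F : Fh sgC set0 (zeta t) = 1.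
  rewrite /Fh (_ : (fun x : R => _) = fun=> 0); first by rewrite cint_cst mul0r addr0.
  by apply/funext => x; rewrite indicE in_set0 rmorph0 mul0r.
by rewrite kkE F /= mulr0 mul0r subr0 expr0n mul0r addr0 divff.
Qed.

Lemma Cop_arcA0 nu : is_cmeasure nu ->
  Cop (phih sgC (arcA 0)) nu = density (fun=> nu setT).
Proof.
move=> [r ->]; rewrite arcA0.
have gd : {ae lam R, forall t, exists c, away set0 (zeta t : R[i]) c}.
  by rewrite -arcA0; exact: arcA_good.
have [r' [-> hr']] := Cop_phih sgC measurable0 gd (sub0set _) r.
apply/funext => B; have [mB|nB] := pselect (measurable B); last first.
  by rewrite /density /cm_set !ifF//; apply/asboolP.
have bB := bmf_indic R mB.
rewrite cm_setE// hr'// densityE//.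
have -> : tau sgC set0 (\1_B) = fun=> \int[lam R]_x \1_B x.
  apply/funext => a; rewrite /tau; under [X in _ + _ * X]eq_Rintegral do rewrite indic0 /= mulr0.
  rewrite [X in _ + _ * X](_ : _ = 0) ?mulr0 ?addr0; last by rewrite Rintegral_cst// mul0r.
  by apply: eq_Rintegral => t _; rewrite kk_set0 mulr1.
rewrite cm_setE//; under eq_cint do rewrite mulrC.
rewrite cintZ ?cint_real; last first.
  apply: (cintegr_bounded (B := 1) (lamT_lty R)); first exact: cmeas_indic.
  by move=> x; rewrite cabsr; have /andP[a b] := indic_le1 B x; rewrite ger0_norm.
set c := \int[lam R]_x \1_B x.
have h (m : {finite_measure set R -> \bar R}) : \int[m]_x (cst c x) = c * \int[m]_x \1_setT x.
  by rewrite Rintegral_cst// Rintegral_indic.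
rewrite /cI !h -!mulrBr; apply: eqC => /=; ring.
Qed.

Lemma complex_bw (c : nat -> R[i]) (K : R) : (forall n, cabs (c n) <= K) ->
  exists (s : nat -> nat) (l : R[i]), (forall n, (s n < s n.+1)%N) /\
  forall e, 0 < e -> exists N, forall n, (N <= n)%N -> cabs (c (s n) - l) < e.
Proof.
move=> hK.
have bd (u : nat -> R) : (forall n, `|u n| <= K) -> bounded_fun u.
  by move=> h; exists K; split; [exact: num_real|move=> M hM n _; exact: le_trans (h n) (ltW hM)].
have [f f_incr cf] := @bolzano_weierstrass R (fun n => cRe (c n))
  (bd _ (fun n => le_trans (ler_Re_cabs _) (hK n))).
have [g g_incr cg] := @bolzano_weierstrass R (fun n => cIm (c (f n)))
  (bd _ (fun n => le_trans (ler_Im_cabs _) (hK (f n)))).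
have fS m n : (m < n)%N -> (f m < f n)%N by move=> mn; have := leW_mono f_incr m n; rewrite !ltEnat /= mn.
have gS m n : (m < n)%N -> (g m < g n)%N by move=> mn; have := leW_mono g_incr m n; rewrite !ltEnat /= mn.
(* Ensures that the tail estimate for the first subsequence remains valid along the second. *)
have gn n : (n <= g n)%N by elim: n => // n IH; exact: leq_ltn_trans IH (gS _ _ (ltnSn n)).
exists (f \o g), (Complex (limn ((fun n => cRe (c n)) \o f)) (limn ((fun n => cIm (c (f n))) \o g))).
split; first by move=> n /=; apply: fS; exact: gS.
move=> e e0; have e2 : 0 < e / 2 by rewrite divr_gt0.
move/cvgrPdist_lt : cf => /(_ _ e2) [N1 _ h1]; move/cvgrPdist_lt : cg => /(_ _ e2) [N2 _ h2].
exists (maxn N1 N2) => n; rewrite geq_max => /andP[n1 n2].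
have k1 := h1 (g n) (leq_trans n1 (gn n)); have k2 := h2 n n2.
apply: (le_lt_trans (ler_cabs_ReIm _)); rewrite ReB ImB [e]splitr; apply: ltrD.
  by rewrite distrC.
by rewrite distrC.
Qed.

(** The image of a measure depends only on its total mass, so a convergent subsequence of the
    bounded complex masses gives one of the images. *)
Lemma compact_Cop0 X p : nice_space X p -> compact_op X (Cop (phih sgC (arcA 0))).
Proof.
move=> hX x hx [M hM]; have [K hK] := nice_total hX M.
have [s [l [hs hl]]] := complex_bw (fun n => hK _ (hx n) (hM n)).
exists s, (density (fun=> l)); split=> //; split; first by have [] := nice_cst hX l.
move=> e e0; have [N hN] := hl e e0; exists N => n /hN h.
rewrite Cop_arcA0; last exact: (nice_cmeasure hX).
rewrite density_sub; [|exact: cintegr_cst..].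
by have [_ hc] := nice_cst hX (x (s n) setT - l); apply: (le_lt_trans hc); rewrite lte_fin.
Qed.

End CompactAtZero.

(** * Boundedness, and continuity in operator norm *)

Section Boundedness.
Variable R : realType.
Local Notation sgC := (@sgC R).
Local Notation arcA := (@arcA R).

Lemma opnorm_le (X : bspace R) (T : cmop R) (C : R) :
  (forall x, bs_mem X x -> (bs_norm X x <= 1)%E -> (bs_norm X (T x) <= C%:E)%E) ->
  (opnorm X T <= C%:E)%E.
Proof. by move=> h; apply: ge_ereal_sup => _ [x [hx [h1 ->]]]; exact: h. Qed.

(** The two smallness hypotheses are the quantities that [kk_continuous] controls; [d] depends on
    [X] and [e] but not on [s] and [t]. *)
Lemma Cop_bounded_continuous (X : bspace R) : admissible_space X ->
  (forall t : R, 0 <= t <= 1 -> bounded_op X (Cop (phih sgC (arcA t)))) /\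
  forall e : R, 0 < e -> exists2 d, 0 < d & forall s t : R, 0 <= s <= 1 -> 0 <= t <= 1 ->
    arc_dist s t <= d ->
    (forall a, \int[lam R]_x `|kk sgC (arcA s) a x - kk sgC (arcA t) a x| <= d) ->
    (opnorm X (op_sub (Cop (phih sgC (arcA s))) (Cop (phih sgC (arcA t)))) < e%:E)%E.
Proof.
have mA t := @measurable_arcA R t; have gA t := @arcA_good R t.
have m1 t := mass_le1 (mA t).
have sub t : 0 <= t <= 1 -> arcA t `<=` Icirc R by move=> /andP[_ t1]; exact: arcA_sub.
case=> [->|].
  split.
    move=> t ht; split.
      move=> x cx; have [r er] := cx; have [r' [e _]] := Cop_phih sgC (mA t) (gA t) (sub t ht) r.
      by rewrite /= er e; exists r'.
    apply: (@le_lt_trans _ _ (6 * 1)%:E); last exact: ltry.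
    apply: opnorm_le => x cx hx.
    by have [] := Cop_tv_norm (mA t) (gA t) (sub t ht) (m1 t) cx ler01 hx.
  move=> e e0; exists (e / 8); first by rewrite divr_gt0.
  move=> s t hs ht h1 h2; apply: (@le_lt_trans _ _ (4 * (e / 8) * 1)%:E).
    apply: opnorm_le => x cx hx.
    have e8 : 0 <= e / 8 by rewrite divr_ge0// ltW.
    exact: (Cop_sub_tv_norm (mA s) (mA t) (gA s) (gA t) (sub s hs) (sub t ht) h2 h1 cx ler01 e8 hx).
  by rewrite lte_fin; lra.
move=> [p [p1 hX]]; have p0 : 0 < p by exact: lt_le_trans p1.
have eN : bs_norm X = lp_norm p by case: hX => ->.
have lt12 : (1 < 2%:E :> \bar R)%E by rewrite lte_fin ltr1n.
(* The infimum in the norm need not be attained, so only a representative of norm below 2 is at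
   hand. *)
have rep x : (bs_norm X x <= 1)%E -> exists f, x = density f /\ lpb p f (2 `^ p).
  by rewrite eN => hx; apply: lp_norm_ex => //; exact: le_lt_trans hx lt12.
split.
  move=> t ht; split; last first.
    apply: (@le_lt_trans _ _ ((6 `^ p * 2 * 2 `^ p) `^ p^-1)%:E); last exact: ltry.
    apply: opnorm_le => x _ /rep [f [-> hf]].
    have [_ ->] := Cop_density sgC (mA t) (gA t) (sub t ht) hf.1.
    rewrite eN; apply: (lp_norm_le p1 (Top_lpb p1 (mA t) (gA t) (sub t ht) (m1 t) hf)).
    by rewrite !mulr_ge0 ?powR_ge0.
  have memL f C : 0 <= C -> lpb p f C -> lpb p (Top sgC (arcA t) f) (6 `^ p * 2 * C) /\
      0 <= 6 `^ p * 2 * C.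
    by move=> C0 hf; split; [exact: (Top_lpb p1 (mA t) (gA t) (sub t ht) (m1 t) hf)|rewrite !mulr_ge0 ?powR_ge0].
  case: hX => -> x /= hx.
    have [f [C [-> C0 hf]]] := in_Lp_ex p1 hx; have [h1 h2] := memL f C C0 hf.
    have [_ ->] := Cop_density sgC (mA t) (gA t) (sub t ht) hf.1.
    exact: lpb_in_Lp h1 h2.
  have [f [C [e C0 hf]]] := in_Lp_ex p1 (in_Hp_Lp hx); have [h1 h2] := memL f C C0 hf.
  rewrite e in hx *; have [_ ->] := Cop_density sgC (mA t) (gA t) (sub t ht) hf.1.
  apply: (lpb_in_Hp h1); apply: Top_hardy => //; [exact: sub|exact: hf.1|].
  exact: (in_Hp_hardy hf.1 hx).
(* Solves [6 ^ p * d * 2 ^ p = (e / 2) ^ p]. *)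
move=> e e0; pose d := (e / 2) `^ p / (6 `^ p * 2 `^ p).
have K0 : 0 < 6 `^ p * 2 `^ p :> R by rewrite mulr_gt0 ?powR_gt0.
have e2 : 0 < e / 2 by rewrite divr_gt0.
have d0 : 0 < d by rewrite divr_gt0// powR_gt0.
exists d => // s t hs ht _ h2; apply: (@le_lt_trans _ _ (e / 2)%:E); last first.
  by rewrite lte_fin; lra.
apply: opnorm_le => x _ /rep [f [-> hf]].
rewrite /op_sub; have [iS ->] := Cop_density sgC (mA s) (gA s) (sub s hs) hf.1.
have [iT ->] := Cop_density sgC (mA t) (gA t) (sub t ht) hf.1.
rewrite density_sub// eN.
have hd := Top_sub_lpb p1 (mA s) (mA t) (gA s) (gA t) (sub s hs) (sub t ht) (ltW d0) h2 hf.
apply: (le_trans (lp_norm_le p1 hd _)); first by rewrite !mulr_ge0 ?powR_ge0// ltW.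
rewrite (_ : 6 `^ p * d * 2 `^ p = (e / 2) `^ p); last by rewrite mulrAC /d mulrCA divff ?mulr1// gt_eqF.
by rewrite -powRrM divff ?gt_eqF// powRr1// ltW.
Qed.

End Boundedness.

(** * Failure of compactness at [t = 1] *)

Section NotCompactAtOne.
Variable R : realType.
Local Notation sgC := (@sgC R).
Local Notation A := (arcA (1 : R)).
Local Notation zeta := (@zeta R).
Local Notation F t := (Fh sgC A (zeta t)).
Local Notation K t := (cIm (F t)).

Let mA : measurable A. Proof. exact: measurable_arcA. Qed.
Let gA := @arcA_good R 1.
Let AI : A `<=` Icirc R. Proof. exact: arcA_sub. Qed.

Lemma mass_arcA1 : mass sgC A = 1.
Proof. by rewrite /mass; have := cantorm_Icirc R => /= h; rewrite (_ : sgC A = 1%E). Qed.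

Lemma csq_FhD t (c : R) : csq (F t + c%:C%C) = (1 + c) ^+ 2 + K t ^+ 2.
Proof. by rewrite /csq ReD ImD Re_Fh_circle /= addr0. Qed.

(** On the circle this equals [1 - L * Re (1 / (F + L - 1))], so Poisson's formula computes its
    mean. It detects where [|K|] is large compared with [L]. *)
Definition zeeta (L : R) t := K t ^+ 2 / (L ^+ 2 + K t ^+ 2).

Lemma measurable_K : measurable_fun setT (fun t => K t).
Proof. by have [_ m] := cmeas_Fh_circle sgC mA. Qed.

Lemma bmf_zeeta L : 1 <= L -> bmf (zeeta L).
Proof.
move=> L1; have L0 : 0 < L by exact: lt_le_trans L1.
have m2 : measurable_fun setT (fun t => K t ^+ 2).
  by apply: measurable_funX; exact: measurable_K.
split.
  apply: measurable_funM => //; apply: measurable_funV.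
  by apply: measurable_funD => //; exact: measurable_cst.
exists 1 => t; have k0 := sqr_ge0 (K t); have d0 : 0 < L ^+ 2 + K t ^+ 2 by rewrite ltr_pwDl ?exprn_gt0.
rewrite ger0_norm ?divr_ge0 ?(ltW d0)// ler_pdivrMr// mul1r lerDr.
exact: sqr_ge0.
Qed.

(** At the origin [F = 1 + mass = 2], so [1 / (F + L - 1)] takes the value [1 / (L + 1)]. The decay
    is only of order [1 / L]: this heavy tail of [K] is the trace of the singular mass and the cause
    of non-compactness. *)
Lemma int_zeeta L : 1 <= L -> \int[lam R]_t zeeta L t = (L + 1)^-1.
Proof.
move=> L1; have L0 : 0 < L by exact: lt_le_trans L1.
have c0 : 0 <= cRe ((L - 1)%:C%C : R[i]) by rewrite /= subr_ge0.
have := poisson_Fh_inv sgC mA gA c0 (inD0 R).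
rewrite Fh0// mass_arcA1 -rmorphD (_ : 1 + 1 + (L - 1) = L + 1); last by ring.
rewrite -fmorphV => /(congr1 (@complex.Re R)); rewrite /cint.
set I := \int[lam R]_x _ => hI; have {}hI : I = (L + 1)^-1 by exact: hI.
have e t : zeeta L t = 1 - L * cRe ((F t + (L - 1)%:C%C)^-1 * (poisson 0 t)%:C%C).
  have d0 : L ^+ 2 + K t ^+ 2 != 0 by rewrite gt_eqF// ltr_pwDl ?exprn_gt0 ?sqr_ge0.
  have hR : cRe (F t + (L - 1)%:C%C) = L by rewrite ReD Re_Fh_circle /=; ring.
  have hC : csq (F t + (L - 1)%:C%C) = L ^+ 2 + K t ^+ 2.
    by rewrite csq_FhD (_ : 1 + (L - 1) = L)//; ring.
  rewrite poisson0 rmorph1 mulr1 ReV hR hC /zeeta.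
  by move: (K t ^+ 2) d0 => k d0; field.
have iz := bmf_integrable (lam R) (bmf_zeeta L1).
have h1 : L * I = 1 - \int[lam R]_t zeeta L t.
  have -> : 1 = \int[lam R]_t (cst 1 t : R).
    by rewrite Rintegral_cst// mul1r; have := lamT R => /= ->.
  rewrite -RintegralB//; last by apply: bmf_integrable; exact: bmf_cst.
  have iI : (lam R).-integrable setT (EFin \o
      (fun t => cRe ((F t + (L - 1)%:C%C)^-1 * (poisson 0 t)%:C%C))).
    rewrite (_ : (fun t => _) = fun t => L^-1 * (1 - zeeta L t)).
      apply: rintegrableZ; apply: rintegrableB => //.
      by apply: bmf_integrable; exact: (bmf_cst R (1 : R)).
    by apply/funext => t; rewrite e subKr mulKf// gt_eqF.
  rewrite /I -RintegralZl//; apply: eq_Rintegral => t _ /=.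
  by rewrite e subKr.
have -> : \int[lam R]_t zeeta L t = 1 - L * I by rewrite h1; ring.
by rewrite hI; field; rewrite gt_eqF// addr_gt0.
Qed.

(** This is [|(F + 1) / (F + L - 1)|^2] on the circle, the modulus of a composed peak function up to
    normalization. *)
Definition YY (L : R) t := (4 + K t ^+ 2) / (L ^+ 2 + K t ^+ 2).

(** Subtracting the second [zeeta] discards small [K] while keeping an integral that is known. If
    [K ^+ 2 <= L ^+ 2 / 64] the bracket is nonpositive, since [32 * ((L / 8) ^+ 2 + K ^+ 2) <= L ^+
    2 + K ^+ 2]; otherwise it is at most 1 and [YY L t >= 1 / 65]. *)
Lemma YY_lower p L t : 1 <= p -> 1 <= L ->
  65^-1 `^ p * (zeeta L t - 32^-1 * zeeta (L / 8) t) <= YY L t `^ p.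
Proof.
move=> p1 L1; have L0 : 0 < L by exact: lt_le_trans L1.
have p0 : 0 <= p by exact: le_trans p1.
rewrite /zeeta /YY; have := sqr_ge0 (K t); move: (K t ^+ 2) => k k0.
have L20 : 0 < L ^+ 2 by rewrite exprn_gt0.
have d0 : 0 < L ^+ 2 + k by rewrite ltr_pwDl.
have [kL|kL] := leP k (L ^+ 2 / 64).
  apply: le_trans (powR_ge0 _ _); rewrite mulr_ge0_le0 ?powR_ge0// subr_le0.
  have d1 : 0 < (L / 8) ^+ 2 + k by rewrite ltr_pwDl// exprn_gt0// divr_gt0.
  rewrite mulrCA ler_wpM2l//.
  rewrite -invfM lef_pV2 ?posrE ?mulr_gt0//.
  have -> : (L / 8) ^+ 2 = L ^+ 2 / 64 by rewrite expr_div_n; congr (_ / _); ring.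
  lra.
apply: (@le_trans _ _ (65^-1 `^ p * 1)).
  rewrite ler_wpM2l ?powR_ge0// lerBlDr ler_wpDr//.
    by rewrite mulr_ge0 ?invr_ge0// mulr_ge0 ?invr_ge0// addr_ge0 ?sqr_ge0.
  by rewrite ler_pdivrMr// mul1r lerDr ltW.
rewrite mulr1 ge0_ler_powR ?nnegrE ?invr_ge0//; first by rewrite divr_ge0 ?(ltW d0)// addr_ge0.
by rewrite ler_pdivlMr//; lra.
Qed.

(** With [1 - r = 2 / L] one has [1 - r * phi = (2 / L) * (F + L - 1) / (F + 1)], which ties the
    peaks to [zeeta L]. The offset 16 keeps [r >= 0] and [L / 8 >= 1], with room for the numerical
    estimates. *)
Definition LL (n : nat) : R := n%:R + 16.
Definition rr n : R := 1 - 2 / LL n.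
Definition peak p n (w : R[i]) : R[i] :=
  ((LL n / 2) `^ p^-1 * (1 - rr n) ^+ 2)%:C%C * ((1 - (rr n)%:C%C * w)^-1) ^+ 2.

Lemma LL_ge16 n : 16 <= LL n. Proof. by rewrite lerDr. Qed.
Let LL0 n : 0 < LL n. Proof. exact: lt_le_trans (LL_ge16 n). Qed.
Let LL1 n : 1 <= LL n. Proof. by apply: le_trans (LL_ge16 n); rewrite ler1n. Qed.

Lemma rr_bound n : 0 <= rr n /\ rr n < 1.
Proof.
have h := LL_ge16 n; rewrite /rr; split; last by rewrite gtrBl divr_gt0.
by rewrite subr_ge0 ler_pdivrMr// mul1r; lra.
Qed.

Let rD n : inD ((rr n)%:C%C : R[i]).
Proof. by have [h1 h2] := rr_bound n; rewrite /inD cabsr ger0_norm. Qed.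

Lemma hol_peak p n : hol 1 (peak p n).
Proof.
by apply: holM => //; [exact: hol_cst|apply: holX => //; exact: hol_szego].
Qed.

Lemma cabs_peak p n w : cabs (peak p n w) =
  (LL n / 2) `^ p^-1 * ((1 - rr n) ^+ 2 / csq (1 - (rr n)%:C%C * w)).
Proof.
have c0 : 0 <= (LL n / 2) `^ p^-1 * (1 - rr n) ^+ 2 by exact: mulr_ge0 (powR_ge0 _ _) (sqr_ge0 _).
by rewrite /peak cabsM cabsX cabsV exprVn cabs_sqr cabsr (ger0_norm c0) -[LHS]mulrA.
Qed.

Lemma cmeas_peak p n : cmeas (fun x : R => peak p n (zeta x)).
Proof.
apply: cmeasM; first exact: cmeas_cst.
apply: cmeasX; apply: cmeasV; apply: cmeasB; first exact: cmeas_cst.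
by apply: cmeasM; [exact: cmeas_cst|exact: cmeas_zeta].
Qed.

(** The normalized modulus [q] is at most 1, so [q ^ p <= q], and [L / 2 * q] lies below the Poisson
    kernel of the point [r], whose integral is 1. *)
Lemma peak_lpb p n : 1 <= p -> lpb p (fun x : R => peak p n (zeta x)) 1.
Proof.
move=> p1; have p0 : 0 < p by exact: lt_le_trans p1.
have [r0 r1] := rr_bound n; have L0 := LL0 n.
have h1 : 0 < 1 - rr n by rewrite subr_gt0.
pose q x := (1 - rr n) ^+ 2 / csq (1 - (rr n)%:C%C * zeta x).
have csqE x : csq (1 - (rr n)%:C%C * zeta x) = csq (zeta x - (rr n)%:C%C).
  have := csq_zeta x; rewrite /csq ReB ImB ReMr ImMr ReB ImB /= => h.
  rewrite (_ : _ + _ = 1 - 2 * rr n * cos (2 * pi * x) +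
     rr n ^+ 2 * (cos (2 * pi * x) ^+ 2 + sin (2 * pi * x) ^+ 2)); last by ring.
  rewrite h [RHS](_ : _ = (cos (2 * pi * x) ^+ 2 + sin (2 * pi * x) ^+ 2) -
     2 * rr n * cos (2 * pi * x) + rr n ^+ 2); last by ring.
  by rewrite h; ring.
have lb x : (1 - rr n) ^+ 2 <= csq (1 - (rr n)%:C%C * zeta x).
  rewrite csqE -cabs_sqr lerXn2r ?nnegrE ?(ltW h1)//.
  by have := zetaB_lb ((rr n)%:C%C) x; rewrite cabsr ger0_norm.
have c0 x : 0 < csq (1 - (rr n)%:C%C * zeta x).
  by apply: lt_le_trans (lb x); rewrite exprn_gt0.
have q0 x : 0 < q x by rewrite divr_gt0// exprn_gt0.
have q1 x : q x <= 1 by rewrite ler_pdivrMr// mul1r.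
have cb x : cabs (peak p n (zeta x)) = (LL n / 2) `^ p^-1 * q x by exact: cabs_peak.
have fi : cintegr (lam R) (fun x : R => peak p n (zeta x)).
  apply: (cintegr_bounded (B := (LL n / 2) `^ p^-1) (lamT_lty R)); first exact: cmeas_peak.
  by move=> x; rewrite cb ler_piMr ?powR_ge0.
split=> //; rewrite -(poisson_int1 (rD n)) /Rintegral fineK; last first.
  by apply: integrable_fin_num => //; apply: bmf_integrable; exact: bmf_poisson.
apply: ge0_le_integral => //.
- by move=> x _; rewrite lee_fin powR_ge0.
- apply/measurable_EFinP; apply: measurable_powR_comp; apply: measurable_cabs.
  exact: cmeas_peak.
- by apply/measurable_EFinP; exact: measurable_poisson.
move=> x _; rewrite lee_fin cb powRM ?powR_ge0 ?(ltW (q0 x))//.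
rewrite -powRrM mulVf ?gt_eqF// powRr1 ?divr_ge0 ?(ltW L0)//.
have qp : q x `^ p <= q x by apply: ge1r_powR => //; rewrite q0 q1.
apply: (@le_trans _ _ (LL n / 2 * q x)); first by rewrite ler_wpM2l// divr_ge0// ltW.
rewrite /q /poisson csqE.
have -> : csq ((rr n)%:C%C : R[i]) = rr n ^+ 2 by rewrite /csq /= expr0n addr0.
rewrite mulrA; apply: ler_wpM2r; first by rewrite invr_ge0 ltW// -csqE.
rewrite /rr; have L16 := LL_ge16 n; rewrite (_ : LL n / 2 * _ = 2 / LL n); last first.
  by field; rewrite gt_eqF.
rewrite (_ : 1 - _ = (2 / LL n) * (2 - 2 / LL n)); last by ring.
rewrite ler_peMr ?divr_ge0 ?(ltW L0)// lerBrDr -lerBrDl.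
by rewrite ler_pdivrMr//; lra.
Qed.

Lemma peak_hardy p n : hardy (fun x : R => peak p n (zeta x)).
Proof.
move=> m m0.
have <- : peak p n 0 * 0 ^+ m = 0 by rewrite expr0n eqn0Ngt m0 mulr0.
rewrite -(@mean_value _ (fun w => peak p n w * w ^+ m))//.
by apply: holM => //; [exact: hol_peak|apply: holX => //; exact: hol_id].
Qed.

(** [Top] integrates against the Poisson kernel of the point [phih sgC A (zeta t)], which lies
    inside the disc, and peaks are holomorphic on the closed disc. *)
Lemma Top_peak p n t : Top sgC A (fun x => peak p n (zeta x)) t = peak p n (phih sgC A (zeta t)).
Proof.
rewrite /Top -(poisson_formula (hol_peak p n) (phih_circle_inD sgC A t)).
by apply: eq_cint => a; rewrite mulrC.
Qed.

Lemma cabs_Top_peak p n t : cabs (Top sgC A (fun x => peak p n (zeta x)) t) =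
  (LL n / 2) `^ p^-1 * YY (LL n) t.
Proof.
rewrite Top_peak cabs_peak; congr (_ * _); have L0 := LL0 n.
have F1 : F t + 1 != 0.
  apply/eqP => /(congr1 (@complex.Re R)); rewrite ReD Re_Fh_circle /= => /eqP.
  by rewrite -(natrD _ 1 1) pnatr_eq0.
have e : 1 - (rr n)%:C%C * phih sgC A (zeta t) =
    (2 / LL n)%:C%C * ((F t + (LL n - 1)%:C%C) / (F t + 1)).
  have ph : phih sgC A (zeta t) * (F t + 1) = F t - 1 by rewrite /phih divfK.
  have al : (2 / LL n)%:C%C * (LL n)%:C%C = 2 :> R[i].
    by rewrite -rmorphM divfK ?gt_eqF//= (rmorph_nat _ 2).
  apply: (mulIf F1); rewrite mulrBl mul1r -[X in _ - X = _]mulrA ph -[RHS]mulrA divfK//.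
  have er : (rr n)%:C%C = 1 - (2 / LL n)%:C%C :> R[i] by rewrite /rr rmorphB rmorph1.
  have el : (LL n - 1)%:C%C = (LL n)%:C%C - 1 :> R[i] by rewrite rmorphB rmorph1.
  rewrite er el.
  have key (a l w : R[i]) : a * l = 2 -> w + 1 - (1 - a) * (w - 1) = a * (w + (l - 1)).
    by move=> h; rewrite (_ : a * (w + (l - 1)) = a * w + a * l - a); [rewrite h; ring|ring].
  exact: key al.
have d1 : csq (F t + 1) = 4 + K t ^+ 2.
  by have := csq_FhD t 1; rewrite (_ : (1 + 1) ^+ 2 = 4 :> R)//; ring.
have d2 : csq (F t + (LL n - 1)%:C%C) = LL n ^+ 2 + K t ^+ 2.
  by rewrite csq_FhD (_ : 1 + (LL n - 1) = LL n)//; ring.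
rewrite e !csqM csqV d1 d2 /YY (_ : csq ((2 / LL n)%:C%C : R[i]) = (2 / LL n) ^+ 2); last first.
  by rewrite /csq /= expr0n addr0.
rewrite (_ : 1 - rr n = 2 / LL n); last by rewrite /rr; ring.
have k0 := sqr_ge0 (K t); have L2 : 0 < LL n ^+ 2 by rewrite exprn_gt0.
move: (K t ^+ 2) k0 => k k0.
have z1 : LL n != 0 by rewrite gt_eqF.
have z2 : 4 + k != 0 by rewrite gt_eqF// ltr_pwDl.
have z3 : LL n ^+ 2 + k != 0 by rewrite gt_eqF// ltr_pwDl.
by field; rewrite z1 z2 z3.
Qed.

Lemma Top_peak_lower p n : 1 <= p ->
  ((65^-1 `^ p / 4)%:E <= \int[lam R]_t (cabs (Top sgC A (fun x => peak p n (zeta x)) t) `^ p)%:E)%E.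
Proof.
move=> p1; have p0 : 0 < p by exact: lt_le_trans p1.
have hT := Top_lpb p1 mA gA AI (mass_le1 mA) (peak_lpb n p1).
have iT := lpb_integrable hT.
have L0 := LL0 n; have L16 := LL_ge16 n.
have L8 : 1 <= LL n / 8 by rewrite ler_pdivlMr//; lra.
have z1 := bmf_integrable (lam R) (bmf_zeeta (LL1 n)).
have z2 := bmf_integrable (lam R) (bmf_zeeta L8).
set c := 65^-1 `^ p; have c0 : 0 < c by rewrite powR_gt0// invr_gt0.
pose g t := LL n / 2 * c * (zeeta (LL n) t - 32^-1 * zeeta (LL n / 8) t).
have ig : (lam R).-integrable setT (EFin \o g).
  by apply: rintegrableZ; apply: rintegrableB => //; exact: rintegrableZ.
have -> : (\int[lam R]_t (cabs (Top sgC A (fun x => peak p n (zeta x)) t) `^ p)%:E =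
  (\int[lam R]_t (cabs (Top sgC A (fun x => peak p n (zeta x)) t) `^ p))%:E)%E.
  by rewrite /Rintegral fineK//; exact: integrable_fin_num.
rewrite lee_fin; apply: (@le_trans _ _ (\int[lam R]_t g t)); last first.
  apply: le_Rintegral => // t _.
  have Y0 : 0 <= YY (LL n) t.
    by rewrite divr_ge0// addr_ge0 ?sqr_ge0.
  rewrite cabs_Top_peak powRM ?powR_ge0// -powRrM mulVf ?gt_eqF// powRr1 ?divr_ge0 ?(ltW L0)//.
  by rewrite /g -mulrA ler_wpM2l ?divr_ge0 ?(ltW L0)//; exact: YY_lower.
rewrite /g RintegralZl//; last by apply: rintegrableB => //; exact: rintegrableZ.
rewrite RintegralB//; last exact: rintegrableZ.
rewrite RintegralZl// !int_zeeta//.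
rewrite (_ : LL n / 2 * c * _ = c * (LL n / 2 * ((LL n + 1)^-1 - 32^-1 * (LL n / 8 + 1)^-1))); last by ring.
rewrite ler_wpM2l ?(ltW c0)//.
move: (LL n) L0 L16 {L8 z1 z2 g ig} => L L0 L16.
(* For [L >= 16] the new form is at least [8 / 17 - 1 / 8], which exceeds 1/4. *)
have -> : L / 2 * ((L + 1)^-1 - 32^-1 * (L / 8 + 1)^-1) =
   (L / (L + 1)) / 2 - (L / (L + 8)) / 8.
  by field; rewrite !gt_eqF//; lra.
have a1 : 16 / 17 <= L / (L + 1) by rewrite ler_pdivlMr ?addr_gt0//; lra.
have a2 : L / (L + 8) <= 1 by rewrite ler_pdivrMr ?addr_gt0//; lra.
lra.
Qed.

(** The normalizing factor grows at most like [L], whereas [YY L] is of order [L^-2] where [K] is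
    bounded. *)
Lemma Top_peak_upper p n (T : R) t : 1 <= p -> `|K t| <= T ->
  cabs (Top sgC A (fun x => peak p n (zeta x)) t) <= (4 + T ^+ 2) / LL n.
Proof.
move=> p1 hT; have L0 := LL0 n; have L16 := LL_ge16 n; rewrite cabs_Top_peak.
have c1 : (LL n / 2) `^ p^-1 <= LL n.
  apply: (@le_trans _ _ (LL n / 2)); last lra.
  apply: ler1_powR; first by rewrite ler_pdivlMr//; lra.
  by rewrite invf_le1// (lt_le_trans _ p1).
have T0 : 0 <= T by exact: le_trans (normr_ge0 _) hT.
have kT : K t ^+ 2 <= T ^+ 2.
  by rewrite -[leLHS]real_normK ?num_real// lerXn2r ?nnegrE.
have Y1 : YY (LL n) t <= (4 + T ^+ 2) / LL n ^+ 2.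
  have e1 : 0 < LL n ^+ 2 by rewrite exprn_gt0.
  have e2 : LL n ^+ 2 <= LL n ^+ 2 + K t ^+ 2 by rewrite lerDl sqr_ge0.
  apply: ler_pM.
  - by rewrite addr_ge0 ?sqr_ge0.
  - by rewrite invr_ge0 (le_trans (ltW e1)).
  - by rewrite lerD2l.
  - by rewrite lef_pV2 ?posrE// (lt_le_trans e1).
have Y0 : 0 <= YY (LL n) t by rewrite divr_ge0// addr_ge0 ?sqr_ge0.
apply: (le_trans (ler_pM (powR_ge0 _ _) Y0 c1 Y1)).
rewrite (_ : LL n * _ = (4 + T ^+ 2) / LL n)//; field; by rewrite gt_eqF.
Qed.

(** A limit [y] of images of peaks vanishes on each set [S k] where [|K| <= k], because the images
    tend to 0 uniformly there. These sets exhaust the line, so [y = 0], and [nice_lower] then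
    contradicts [Top_peak_lower]. *)
Lemma not_compact_Cop1 X p : 1 <= p -> nice_space X p -> ~ compact_op X (Cop (phih sgC A)).
Proof.
move=> p1 hX cX; pose f n x := peak p n (zeta x).
have hf n : lpb p (f n) 1 by exact: peak_lpb.
have memf n := nice_hardy hX (hf n) (peak_hardy p n).
have bd : exists M : R, forall n, (bs_norm X (density (f n)) <= M%:E)%E.
  by exists 2 => n; exact: (memf n).2.
have [s [y [sS [my hy]]]] := cX (fun n => density (f n)) (fun n => (memf n).1) bd.
have cT n := Cop_density sgC mA gA AI (hf n).1.
have sn n : (n <= s n)%N by elim: n => // n IH; exact: leq_ltn_trans IH (sS n).
have cy := nice_cmeasure hX my; have [r er] := cy.
pose S (k : nat) := [set t | `|K t| <= k%:R].
have mS k : measurable (S k).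
  rewrite (_ : S k = setT `&` (fun t => K t) @^-1` `[- k%:R, k%:R]%classic).
    exact: measurable_K.
  by apply/seteqP; split => t; rewrite /S /= in_itv/= ler_norml; [split|case].
have yS k B : measurable B -> y (B `&` S k) = 0.
  move=> mB; have mBS : measurable (B `&` S k) by exact: measurableI.
  apply/eqP; apply: contraT => /cabs_gt0 y0; exfalso.
  (* The approximation error [4 * e] and the size [e] of the image add up to less than the supposed
     value [8 * e]. *)
  pose e := cabs (y (B `&` S k)) / 8; have e0 : 0 < e by rewrite divr_gt0.
  have [N hN] := hy e e0.
  pose c : R := 2 * (4 + k%:R ^+ 2); have c0 : 0 < c by rewrite mulr_gt0// ltr_pwDl ?sqr_ge0.
  have ec : 0 < e / c by rewrite divr_gt0.
  have := @cvg_harmonic R => /cvgrPdist_lt /(_ _ ec) [N' _ hN'].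
  pose n := maxn N N'; have := hN n (leq_maxl _ _); have := hN' n (leq_maxr _ _).
  rewrite /= sub0r normrN ger0_norm ?invr_ge0// => hn'.
  rewrite (cT (s n)).2 => h.
  have h1 := nice_eval hX (density_cmeasure (cT (s n)).1) cy e0 h mBS.
  have h2 : cabs (density (Top sgC A (f (s n))) (B `&` S k)) <= c / LL (s n).
    apply: (le_trans (cabs_density_le (cT (s n)).1 mBS)).
    rewrite /c -mulrA ler_wpM2l//.
    have -> : (4 + k%:R ^+ 2) / LL (s n) = \int[lam R]_x (cst ((4 + k%:R ^+ 2) / LL (s n)) x).
      by rewrite Rintegral_cst//; have := lamT R => /= ->; rewrite mulr1.
    apply: le_Rintegral => //.
    - apply: integrableM_bmf; first exact: bmf_indic.
      exact: (cintegr_cabs (cT (s n)).1).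
    - by apply: bmf_integrable; exact: bmf_cst.
    move=> x _; rewrite indicE; have [/set_mem [_ xS]|_] := boolP (x \in _).
      by rewrite mul1r; exact: Top_peak_upper.
    by rewrite mul0r divr_ge0 ?addr_ge0 ?sqr_ge0// ltW.
  have h3 : (LL (s n))^-1 <= n.+1%:R^-1.
    rewrite lef_pV2 ?posrE//; apply: (@le_trans _ _ (s n).+1%:R); first by rewrite ler_nat ltnS; exact: sn.
    by rewrite -natr1 lerD2l ler1n.
  have h4 : c / LL (s n) <= e.
    apply: (le_trans (ler_wpM2l (ltW c0) h3)); rewrite mulrC -ler_pdivlMr//; exact: ltW.
  have := ler_cabsDB (density (Top sgC A (f (s n))) (B `&` S k)) (y (B `&` S k)) 0.
  rewrite !subr0 cabsBC => h5.
  have e8 : cabs (y (B `&` S k)) = 8 * e by rewrite /e mulrC divfK.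
  by move: h1 h2 h4 h5 e0; rewrite e8; clear; move: (cabs _) (cabs _) => u v; lra.
have y0 B : y B = 0.
  rewrite er; have [mB|nB] := pselect (measurable B); last by rewrite /cm_set ifF//; apply/asboolP.
  have lim (m : {finite_measure set R -> \bar R}) :
      (fun k : nat => \int[m]_x \1_(B `&` S k) x) @ \oo --> \int[m]_x (\1_B x : R).
    apply: (@Rdct _ _ _ m (fun k x => \1_(B `&` S k) x) (\1_B) (cst 1)).
    - by move=> k; apply: measurable_indic; exact: measurableI.
    - exact: measurable_indic.
    - apply: aeW => x; apply: cvg_near_cst.
      have [k hk] : exists k : nat, `|K x| <= k%:R.
        by exists (Num.truncn `|K x|).+1; rewrite ltW// truncnS_gt.
      exists k => // j /= kj; rewrite /= indicI /=.
      rewrite [\1_(S j) x]indicE mem_set ?mulr1//=.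
      by rewrite /S /= (le_trans hk)// ler_nat.
    - by apply: bmf_integrable; exact: bmf_cst.
    - move=> k x; have /andP[a b] := indic_le1 (B `&` S k) x; rewrite ger0_norm//.
  have z k : cI r (\1_(B `&` S k)) = 0.
    by rewrite -cm_setE -?er ?yS//; exact: measurableI.
  have sub (a b : {finite_measure set R -> \bar R}) :
      (forall k, \int[a]_x \1_(B `&` S k) x - \int[b]_x (\1_(B `&` S k) x) = 0 :> R) ->
      \int[a]_x \1_B x - \int[b]_x (\1_B x) = 0 :> R.
    move=> h; have e : (fun k : nat => \int[a]_x \1_(B `&` S k) x) =
        (fun k : nat => \int[b]_x (\1_(B `&` S k) x : R)).
      by apply/funext => k; apply/eqP; rewrite -subr_eq0 h.
    have la := lim a; rewrite e in la.
    by rewrite -(cvg_lim (@Rhausdorff R) la) -(cvg_lim (@Rhausdorff R) (lim b)) subrr.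
  rewrite cm_setE// /cI; apply: eqC => /=; apply: sub => k.
    by have /= := congr1 (@complex.Re R) (z k).
  by have /= := congr1 (@complex.Im R) (z k).
have d0 : 0 < 65^-1 `^ p / 4 :> R by rewrite divr_gt0// powR_gt0 ?invr_gt0.
have [e e0 he] := nice_lower hX d0; have [N hN] := hy e e0.
have := hN N (leqnn N); rewrite (cT (s N)).2 => h.
have := he _ (cT (s N)).1; rewrite (_ : cm_sub _ y = density (Top sgC A (f (s N)))) in h; last first.
  by apply/funext => B; rewrite /cm_sub y0 subr0.
by move=> /(_ h); apply/negP; rewrite -leNgt; exact: Top_peak_lower.
Qed.

End NotCompactAtOne.

Theorem mainTheorem1 (R : realType) :
  exists phi : R -> R[i] -> R[i],
    (forall t : R, 0 <= t <= 1 -> analytic_self_map (phi t)) /\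
    forall X : bspace R, admissible_space X ->
      (forall t : R, 0 <= t <= 1 -> bounded_op X (Cop (phi t))) /\
      compact_op X (Cop (phi 0)) /\
      ~ compact_op X (Cop (phi 1)) /\
      (forall t : R, 0 <= t <= 1 ->
         forall e : R, 0 < e -> exists d : R, 0 < d /\
           forall s : R, 0 <= s <= 1 -> `|s - t| < d ->
             (opnorm X (op_sub (Cop (phi s)) (Cop (phi t))) < e%:E)%E).
Proof.
exists (fun t => phih (@sgC R) (arcA t)); split.
  by move=> t _; apply: analytic_phih; exact: measurable_arcA.
move=> X hX; have [hb hc] := Cop_bounded_continuous hX.
have [p p1 nX] := admissible_nice hX.
split=> //; split; first exact: compact_Cop0 nX.
split; first exact: not_compact_Cop1 p1 nX.
move=> t ht e e0; have [d d0 hd] := hc e e0.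
have [d' d'0 hd'] := kk_continuous ht d0; exists d'; split => // s hs hst.
by have [h1 h2] := hd' s hs hst; exact: hd.
Qed.
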